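(* Let $c\in\mathbb{C}$ with $c\neq 0$, $c^3\neq -1$, $c^3\neq 8$, and let $S_c$ be the $\mathbb{C}$-algebra generated by $x_1=X$, $x_2=Y$, $x_3=Z$ with relations $XY+YX=cZ^2$, $YZ+ZY=cX^2$, $ZX+XZ=cY^2$. For a point $(u,v,w)\in\mathbb{A}^3_{\mathbb{C}}$ with $u\neq 0$ let $(\Delta,P)$, with $\Delta=\mathrm{diag}(D_1,D_2,D_3)$ and $P^{-1}=(Q_{ij})_{i,j}$, be given by the matrices of Case 1 of the context if $uA\neq 0$, and by those of Case 2 if $4uv-c^2w^2=0=4uw-c^2v^2$ (points with $4uv-c^2w^2=0\ne 4uw-c^2v^2$ being reduced to Case 1 by interchanging the roles of $Y,Z$ and of $v,w$). Then the maps $$\psi_{\pm}(x_i)=Q_{1i}\sqrt{D_1}\,\sigma_1+Q_{2i}\sqrt{D_2}\,\sigma_2\pm Q_{3i}\sqrt{D_3}\,\sigma_3\qquad(i=1,2,3)$$ give a family of explicit representations of $S_c$, with a unique representative for all simple $2$-dimensional representations (up to isomorphism) on the open set of $\mathbf{max}(Z(S_c))$ where $u\neq 0$. Permuting the variables covers the entire Azumaya locus of $S_c$, which is $\mathbf{max}(Z(S_c))$ with the unique isolated singularity lying over $(0,0,0)$ removed.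
   Context: $S_c=S_{1,1,-c}$ is the quaternion Sklyanin algebra. The elements $u=X^2$, $v=Y^2$, $w=Z^2$ are central in $S_c$, and $S_c$ is the Clifford algebra over $R=\mathbb{C}[u,v,w]$ of the ternary symmetric bilinear form with matrix $$Q=\begin{bmatrix}2u&cw&cv\\ cw&2v&cu\\ cv&cu&2w\end{bmatrix}.$$ Put $D=\det Q$. $Z(S_c)$ is the center of $S_c$, and $\mathbf{max}(Z(S_c))$ is its maximal spectrum. It is a two-fold cover of $\mathbb{A}^3=\mathbf{max}(R)$ ramified along $D=0$. Its points other than the unique one over $(0,0,0)$ correspond bijectively to isomorphism classes of simple $2$-dimensional representations of $S_c$. The signs $\pm$ in $\psi_\pm$ correspond to the two points over a point of $\mathbb{A}^3$, and $\psi_+,\psi_-$ give the same class when $D=0$. For each point a choice of the square roots $\sqrt{D_j}$ is fixed. The matrices $\sigma_i$ are $$\sigma_1=\begin{bmatrix}0&1\\1&0\end{bmatrix},\quad \sigma_2=\begin{bmatrix}0&i\\-i&0\end{bmatrix},\quad \sigma_3=\begin{bmatrix}1&0\\0&-1\end{bmatrix}.$$ The matrices $P$ and $\Delta$ below satisfy $P^{\tau}QP=\Delta$, where $P^\tau$ is the transpose. Case 1 ($uA\neq0$). Put $A=4uv-c^2w^2$, $B=cuw-2v^2$, $C=cvw-2u^2$. Then $\Delta=\mathrm{diag}(2u,\;2uA,\;4u^2AD)$ and $$P^\tau=\begin{bmatrix}1&0&0\\-cw&2u&0\\2cuB&2cuC&2uA\end{bmatrix}.$$ Case 2 ($u\neq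 0$, $4uv-c^2w^2=0=4uw-c^2v^2$). Put $Q_0=(w-v)(2w+2v+cu)$, $Q_1=c^2vw-4uw+c^2v^2-2cu^2$, $Q_2=c^2w^2+c^2vw-4uv-2cu^2$, $L=Q_1+Q_2$. Then $\Delta=\mathrm{diag}(2u,\;-2uL,\;-16u^4LD)$ and $$P^\tau=\begin{bmatrix}1&0&0\\-cv-cw&2u&2u\\4cu^2Q_0&4u^2Q_1&-4u^2Q_2\end{bmatrix}.$$ *)

(* Defs.v *)
From HB Require Import structures.
From mathcomp Require Import all_boot all_order all_algebra all_fingroup.
From mathcomp Require Import generic_quotient ring_quotient.
From mathcomp Require Import boolp classical_sets reals complex.
From mathcomp Require Import (canonicals) mpoly monalg.

Set Implicit Arguments.
Unset Strict Implicit.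
Unset Printing Implicit Defensive.

Import Order.TTheory GRing.Theory Num.Theory.
Local Open Scope classical_set_scope.
Local Open Scope ring_scope.

Section Ideals.
Variable A : nzRingType.

Definition is_ideal (J : set A) : Prop :=
  [/\ J 0, forall x y, J x -> J y -> J (x + y)
         & forall a x b, J x -> J (a * x * b)].

Definition ideal_gen (G : set A) : set A :=
  [set x | forall J, is_ideal J -> G `<=` J -> J x].

Definition maximal_ideal (m : set A) : Prop :=
  [/\ is_ideal m, ~ m 1 &
      forall J, is_ideal J -> m `<=` J -> ~ J 1 -> J = m].

Lemma ideal_gen_ideal (G : set A) : is_ideal (ideal_gen G).
Proof.
split=> [J [] //|x y Gx Gy J JJ GJ|a x b Gx J JJ GJ].
- by case: (JJ) => _ + _; apply; [apply: Gx|apply: Gy].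
- by case: (JJ) => _ _; apply; apply: Gx.
Qed.

End Ideals.

Section Center.
Variables (F : comNzRingType) (A : algType F).

Definition central : {pred A} := [pred z | `[< forall a, z * a = a * z >]].

Lemma centralP z : reflect (forall a, z * a = a * z) (z \in central).
Proof. exact: asboolP. Qed.

Fact central_subalg : subalg_closed central.
Proof.
split=> [|k x y /centralP zx /centralP zy|x y /centralP zx /centralP zy];
  apply/centralP=> a.
- by rewrite mul1r mulr1.
- by rewrite mulrDl mulrDr zy -scalerAl -scalerAr zx.
- by rewrite -mulrA zy mulrA zx mulrA.
Qed.
HB.instance Definition _ := GRing.isSubalgClosed.Build F A central central_subalg.

Record center : Type := Center { cval : A; cvalP : cval \in central }.

HB.instance Definition _ := [isSub for cval].
HB.instance Definition _ := [Choice of center by <:].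
HB.instance Definition _ := [SubChoice_isSubAlgebra of center by <:].

Fact center_mulC : commutative (@GRing.mul center).
Proof. by move=> x y; apply: val_inj; rewrite !rmorphM /=; apply/centralP/cvalP. Qed.
HB.instance Definition _ := GRing.PzRing_hasCommutativeMul.Build center center_mulC.

End Center.

Section FreeAlgebra.
Variable F : comNzRingType.

(* Noncommutative polynomials in three variables. *)
Definition free_alg : Type := monalg.malg (monalg.fmonom 'I_3) F.
HB.instance Definition _ := GRing.Lalgebra.on free_alg.

Fact free_scalerAr (k : F) (f g : free_alg) : k *: (f * g) = f * (k *: g).
Proof.
have scaleE (h : free_alg) : k *: h = monalg.mkmalgU monalg.mone k * h.
  by rewrite monalg.mul_malgC.
have scaleEr (h : free_alg) : k *: h = h * monalg.mkmalgU monalg.mone k.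
  rewrite scaleE !monalg.malgM_def monalg.fgmulUg monalg.fgmulgU.
  by apply: eq_bigr => m _; rewrite mulrC monalg.mul1m monalg.mulm1.
by rewrite !scaleEr mulrA.
Qed.
HB.instance Definition _ :=
  GRing.Lalgebra_isAlgebra.Build F free_alg free_scalerAr.

End FreeAlgebra.

(* Locked, lest unification unfold generators into products. *)
HB.lock Definition free_gen (F : comNzRingType) (i : 'I_3) : free_alg F :=
  monalg.mkmalgU (monalg.fmu i) 1.

Section QuotientAlgebra.
Variables (F : comNzRingType) (A : algType F) (I : set A).
Hypotheses (II : is_ideal I) (I1 : ~ I 1).

Definition ideal_pred of is_ideal I : {pred A} := [pred f | `[< I f >]].
Local Notation Ip := (ideal_pred II).

Lemma ideal_predP f : reflect (I f) (f \in Ip).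
Proof. exact: asboolP. Qed.

Fact ideal_pred_zmod : zmod_closed Ip.
Proof.
have [I0 ID IM] := II.
split=> [|f g /ideal_predP If /ideal_predP Ig]; apply/ideal_predP=> //.
by apply: ID => //; move: (IM (-1) _ 1 Ig); rewrite mulN1r mulr1.
Qed.
HB.instance Definition _ := GRing.isZmodClosed.Build A Ip ideal_pred_zmod.

Fact ideal_predM f g h : g \in Ip -> f * g * h \in Ip.
Proof. by move=> /ideal_predP Ig; apply/ideal_predP; case: II => _ _; apply. Qed.

(* ring_quotient only covers commutative rings; its Z-module quotient is      *)
(* extended here to an algebra.                                               *)
Definition quot_alg of ~ I 1 : Type := @Quotient.quot A Ip.
Local Notation Q := (quot_alg I1).
HB.instance Definition _ := GRing.Zmodule.on Q.
HB.instance Definition _ := Quotient.on Q.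

End QuotientAlgebra.

(* Locked, lest unification unfold the operations of the quotient. *)
HB.lock Definition quot_pi (F : comNzRingType) (A : algType F) (I : set A)
    (II : is_ideal I) (I1 : ~ I 1) (f : A) : quot_alg II I1 :=
  \pi_(@Quotient.quot A (ideal_pred II))%qT f.
HB.lock Definition quot_mul (F : comNzRingType) (A : algType F) (I : set A)
    (II : is_ideal I) (I1 : ~ I 1) (s t : quot_alg II I1) : quot_alg II I1 :=
  quot_pi II I1 (repr s * repr t).
HB.lock Definition quot_scale (F : comNzRingType) (A : algType F) (I : set A)
    (II : is_ideal I) (I1 : ~ I 1) (k : F) (s : quot_alg II I1) : quot_alg II I1 :=
  quot_pi II I1 (k *: repr s).

Section QuotientAlgebraTheory.
Variables (F : comNzRingType) (A : algType F) (I : set A).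
Hypotheses (II : is_ideal I) (I1 : ~ I 1).
Local Notation Ip := (ideal_pred II).
Local Notation Q := (quot_alg II I1).
Local Notation quot_pi := (quot_pi II I1).
Local Notation quot_mul := (@quot_mul F A I II I1).
Local Notation quot_scale := (@quot_scale F A I II I1).

Fact quot_piP f g : reflect (quot_pi f = quot_pi g) (f - g \in Ip).
Proof. by rewrite Quotient.idealrBE quot_pi.unlock; apply: eqP. Qed.

Lemma quot_pi_eq f g : quot_pi f = quot_pi g <-> I (f - g).
Proof. by split=> [/quot_piP/ideal_predP//|Ifg]; apply/quot_piP/ideal_predP. Qed.

Fact quot_reprK (s : Q) : quot_pi (repr s) = s.
Proof. by rewrite quot_pi.unlock; apply: reprK. Qed.

Lemma quot_ind (P : Q -> Prop) : (forall f, P (quot_pi f)) -> forall s, P s.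
Proof. by move=> Ppi s; rewrite -(quot_reprK s); apply: Ppi. Qed.

Definition quot_one : Q := quot_pi 1.

Fact quot_piD f g : quot_pi (f + g) = quot_pi f + quot_pi g.
Proof. by rewrite quot_pi.unlock; apply: Quotient.pi_add. Qed.

Fact quot_piM f g : quot_pi (f * g) = quot_mul (quot_pi f) (quot_pi g).
Proof.
have rE h : repr (quot_pi h) - h \in Ip by apply/quot_piP; rewrite quot_reprK.
rewrite quot_mul.unlock; apply/esym/quot_piP; set f' := repr _; set g' := repr _.
have -> : f' * g' - f * g = 1 * (f' - f) * g' + f * (g' - g) * 1.
  by rewrite mul1r mulr1 mulrBl mulrBr addrA subrK.
by rewrite rpredD ?ideal_predM ?rE.
Qed.

Fact quot_piZ k f : quot_pi (k *: f) = quot_scale k (quot_pi f).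
Proof.
rewrite quot_scale.unlock; apply/esym/quot_piP; rewrite -scalerBr -[_ - _]mul1r scalerAl -[_ * _]mulr1.
by apply: ideal_predM; apply/quot_piP; rewrite quot_reprK.
Qed.

Fact quot_mulA : associative quot_mul.
Proof.
by elim/quot_ind=> f; elim/quot_ind=> g; elim/quot_ind=> h; rewrite -!quot_piM mulrA.
Qed.
Fact quot_mul1 : left_id quot_one quot_mul.
Proof. by elim/quot_ind=> f; rewrite -quot_piM mul1r. Qed.
Fact quot_mulr1 : right_id quot_one quot_mul.
Proof. by elim/quot_ind=> f; rewrite -quot_piM mulr1. Qed.
Fact quot_mulDl : left_distributive quot_mul +%R.
Proof.
elim/quot_ind=> f; elim/quot_ind=> g; elim/quot_ind=> h.
by rewrite -quot_piD -!quot_piM -quot_piD mulrDl.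
Qed.
Fact quot_mulDr : right_distributive quot_mul +%R.
Proof.
elim/quot_ind=> f; elim/quot_ind=> g; elim/quot_ind=> h.
by rewrite -quot_piD -!quot_piM -quot_piD mulrDr.
Qed.
Fact quot_1neq0 : quot_one != 0.
Proof.
have pi0 : quot_pi 0 = 0 by apply: (addrI (quot_pi 0)); rewrite -quot_piD !addr0.
by apply/eqP; rewrite -pi0 => /quot_pi_eq; rewrite subr0.
Qed.
HB.instance Definition _ := GRing.Zmodule_isNzRing.Build Q quot_mulA
  quot_mul1 quot_mulr1 quot_mulDl quot_mulDr quot_1neq0.

Fact quot_scaleA a b s : quot_scale a (quot_scale b s) = quot_scale (a * b) s.
Proof. by elim/quot_ind: s => f; rewrite -!quot_piZ scalerA. Qed.
Fact quot_scale1 : left_id 1 quot_scale.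
Proof. by elim/quot_ind=> f; rewrite -quot_piZ scale1r. Qed.
Fact quot_scaleDr : right_distributive quot_scale +%R.
Proof.
move=> k; elim/quot_ind=> f; elim/quot_ind=> g.
by rewrite -quot_piD -!quot_piZ -quot_piD scalerDr.
Qed.
Fact quot_scaleDl s : {morph quot_scale^~ s : a b / a + b}.
Proof. by elim/quot_ind: s => f a b; rewrite -!quot_piZ -quot_piD scalerDl. Qed.
HB.instance Definition _ := GRing.Zmodule_isLmodule.Build F Q
  quot_scaleA quot_scale1 quot_scaleDr quot_scaleDl.

Lemma quot_piME f g : quot_pi (f * g) = quot_pi f * quot_pi g.
Proof. exact: quot_piM. Qed.
Lemma quot_piZE k f : quot_pi (k *: f) = k *: quot_pi f.
Proof. exact: quot_piZ. Qed.

Fact quot_scaleAl (k : F) (s t : Q) : k *: (s * t) = k *: s * t.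
Proof.
elim/quot_ind: s => f; elim/quot_ind: t => g.
by rewrite -quot_piME -!quot_piZE -quot_piME scalerAl.
Qed.
HB.instance Definition _ := GRing.Lmodule_isLalgebra.Build F Q quot_scaleAl.

Fact quot_scaleAr (k : F) (s t : Q) : k *: (s * t) = s * (k *: t).
Proof.
elim/quot_ind: s => f; elim/quot_ind: t => g.
by rewrite -quot_piME -!quot_piZE -quot_piME scalerAr.
Qed.
HB.instance Definition _ := GRing.Lalgebra_isAlgebra.Build F Q quot_scaleAr.

Fact quot_rel (k : F) (x y z : A) : I (x * y + y * x - k *: z ^+ 2) ->
  quot_pi x * quot_pi y + quot_pi y * quot_pi x = k *: quot_pi z ^+ 2.
Proof.
by move=> Irel; rewrite expr2 -!quot_piME -quot_piZE -quot_piD -expr2; apply/quot_pi_eq.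
Qed.

End QuotientAlgebraTheory.

Lemma free_alg_ind (F : comNzRingType) (P : free_alg F -> Prop) :
  P 1 -> (forall f g, P f -> P g -> P (f + g)) -> (forall k f, P f -> P (k *: f)) ->
  (forall i f, P f -> P (free_gen F i * f)) -> forall f, P f.
Proof.
move=> P1 PD PZ PM f.
have -> : f = \sum_(m <- finmap.enum_fset (monalg.msupp f)) monalg.mkmalgU m (monalg.mcoeff m f).
  exact: monalg.monalgE.
elim/big_rec: _ => [|m h _]; first by rewrite -(scale0r (1 : free_alg F)); apply: PZ.
apply: PD; move: (monalg.mcoeff m f) => a; case: m => w.
elim: w => [|i w IHw] in a *.
  suff -> : monalg.mkmalgU (monalg.FMonom [::]) a = a *: (1 : free_alg F) by apply: PZ.
  rewrite -monalg.mul_malgC mulr1; congr (monalg.mkmalgU _ _).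
  by apply/eqP; rewrite monalg.fmP monalg.fm1.
suff -> : monalg.mkmalgU (monalg.FMonom (i :: w)) a =
    free_gen F i * (monalg.mkmalgU (monalg.FMonom w) a : free_alg F) by apply: PM.
rewrite free_gen.unlock monalg.malgM_def monalg.fgmulUU mul1r.
congr (monalg.mkmalgU _ _); apply/eqP.
by rewrite monalg.fmP monalg.fmM monalg.fmU.
Qed.

Fact eval_rel0 (F : fieldType) (A : lalgType F) (c : F) (e : A -> F) :
    {morph e : f g / f - g} -> {morph e : f g / f + g} ->
    {morph e : f g / f * g} -> (forall k f, e (k *: f) = k * e f) ->
  forall x y z, e x = 0 -> e y = 0 -> e z = 0 ->
    e (x * y + y * x - c *: z ^+ 2) = 0.
Proof.
move=> eB eD eM eZ x y z ex ey ez.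
by rewrite eB eD eZ expr2 !eM ex ey ez !mulr0 addr0 subr0.
Qed.

Fact sq_comm (F : fieldType) (A : algType F) (c : F) (x y z : A) : c ^+ 3 != -1 ->
    x * y + y * x = c *: z ^+ 2 -> y * z + z * y = c *: x ^+ 2 ->
    z * x + x * z = c *: y ^+ 2 ->
  x ^+ 2 * y = y * x ^+ 2.
Proof.
move=> c3 xy yz zx.
have bracket (a b d : A) : a * b + b * a = c *: d ^+ 2 ->
    a ^+ 2 * b - b * a ^+ 2 = - (c *: (d ^+ 2 * a - a * d ^+ 2)).
  move=> ab; have -> : a ^+ 2 * b - b * a ^+ 2 =
      a * (a * b + b * a) - (a * b + b * a) * a.
    by rewrite !expr2 mulrDr mulrDl !mulrA opprD addrA addrK.
  by rewrite ab -scalerAr -scalerAl -scalerBr -scalerN opprB.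
have: x ^+ 2 * y - y * x ^+ 2 = (- c ^+ 3) *: (x ^+ 2 * y - y * x ^+ 2).
  rewrite {1}(bracket _ _ _ xy) (bracket _ _ _ zx) (bracket _ _ _ yz).
  by rewrite !scalerN opprK !scalerA scaleNr -expr2 -exprSr.
set d := x ^+ 2 * y - _ => /eqP; rewrite -subr_eq0 -{1}[d]scale1r -scalerBl opprK.
by rewrite scaler_eq0 addrC addr_eq0 (negPf c3) subr_eq0 => /eqP.
Qed.

Section Sklyanin.
Variables (F : fieldType) (c : F).
Local Notation X := (free_gen F 0).
Local Notation Y := (free_gen F 1).
Local Notation Z := (free_gen F 2).

Definition sk_rels : set (free_alg F) :=
  [set X * Y + Y * X - c *: Z ^+ 2;
       Y * Z + Z * Y - c *: X ^+ 2;
       Z * X + X * Z - c *: Y ^+ 2].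

Fact sk_rels_proper : ~ ideal_gen sk_rels 1.
Proof.
suff [e [eB eD eM eZ [e1 e_gen]]] : exists e : free_alg F -> F,
    [/\ {morph e : f g / f - g}, {morph e : f g / f + g}, {morph e : f g / f * g},
        forall k f, e (k *: f) = k * e f & e 1 = 1 /\ forall i, e (free_gen F i) = 0].
  have e0 : e 0 = 0 by rewrite -(subrr 1) eB subrr.
  move=> /(_ [set f | e f = 0]) I1; have /eqP : e 1 = 0; last by rewrite e1 oner_eq0.
  apply: I1; first split=> //= [f g ef eg|f g h eg].
  - by rewrite eD ef eg addr0.
  - by rewrite !eM eg mulr0 mul0r.
  have rel0 := eval_rel0 c eB eD eM eZ.
  by move=> f /= [[]|] ->; apply: rel0; apply: e_gen.
exists (monalg.mcoeff monalg.mone); split.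
- exact: monalg.mcoeffB.
- exact: monalg.mcoeffD.
- by move=> f g; apply: rmorphM.
- by move=> k f; apply: monalg.mcoeffZ.
split=> [|i]; first exact: rmorph1.
rewrite free_gen.unlock monalg.mcoeffU; case: eqP => //.
by move=> /(congr1 (fun m => size (monalg.fmonom_val m))); rewrite monalg.fm1 monalg.fmU.
Qed.

Definition sklyanin : Type := quot_alg (ideal_gen_ideal sk_rels) sk_rels_proper.
HB.instance Definition _ := GRing.Algebra.on sklyanin.

End Sklyanin.

HB.lock Definition sk_gen (F : fieldType) (c : F) (i : 'I_3) : sklyanin c :=
  quot_pi _ _ (free_gen F i).

Section SklyaninTheory.
Variables (F : fieldType) (c : F).
Local Notation sklyanin := (sklyanin c).
Local Notation sk_gen := (sk_gen c).

Fact sk_rel0 (i j k : 'I_3) :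
  sk_rels c (free_gen F i * free_gen F j + free_gen F j * free_gen F i
           - c *: free_gen F k ^+ 2) ->
  sk_gen i * sk_gen j + sk_gen j * sk_gen i = c *: sk_gen k ^+ 2.
Proof.
by move=> Irel; rewrite sk_gen.unlock; apply: quot_rel => J _; apply.
Qed.

Lemma sk_relXY : sk_gen 0 * sk_gen 1 + sk_gen 1 * sk_gen 0 = c *: sk_gen 2 ^+ 2.
Proof. by apply: sk_rel0; left; left. Qed.
Lemma sk_relYZ : sk_gen 1 * sk_gen 2 + sk_gen 2 * sk_gen 1 = c *: sk_gen 0 ^+ 2.
Proof. by apply: sk_rel0; left; right. Qed.
Lemma sk_relZX : sk_gen 2 * sk_gen 0 + sk_gen 0 * sk_gen 2 = c *: sk_gen 1 ^+ 2.
Proof. by apply: sk_rel0; right. Qed.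

Lemma sk_comm_gen (s : sklyanin) :
  (forall i, s * sk_gen i = sk_gen i * s) -> forall t, s * t = t * s.
Proof.
rewrite sk_gen.unlock => sC t; elim/quot_ind: t; elim/free_alg_ind => [|f g IHf IHg|k f IH|i f IH].
- by rewrite -[quot_pi _ _ 1]/(1 : sklyanin) mulr1 mul1r.
- by rewrite quot_piD mulrDr mulrDl IHf IHg.
- by rewrite quot_piZE -scalerAr -scalerAl IH.
- by rewrite quot_piME; apply: commrM; [apply: sC|apply: IH].
Qed.

Fact sk_sq_central (hc : c ^+ 3 != -1) (i : 'I_3) : sk_gen i ^+ 2 \in central (A := sklyanin).
Proof.
have [rXY rYZ rZX] := And3 sk_relXY sk_relYZ sk_relZX.
have [rYX rZY rXZ] := And3 rXY rYZ rZX.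
rewrite addrC in rYX; rewrite addrC in rZY; rewrite addrC in rXZ.
apply/centralP/sk_comm_gen => j.
have E3 (l : 'I_3) : [\/ l = 0, l = 1 | l = 2].
  case: l => [[|[|[|//]]] lt]; [constructor 1|constructor 2|constructor 3];
  by apply: val_inj.
have sqC a : sk_gen a ^+ 2 * sk_gen a = sk_gen a * sk_gen a ^+ 2 by rewrite -exprSr -exprS.
case: (E3 i) => ->; case: (E3 j) => ->.
- exact: sqC.
- exact: (sq_comm hc rXY rYZ rZX).
- exact: (sq_comm hc rXZ rZY rYX).
- exact: (sq_comm hc rYX rXZ rZY).
- exact: sqC.
- exact: (sq_comm hc rYZ rZX rXY).
- exact: (sq_comm hc rZX rXY rYZ).
- exact: (sq_comm hc rZY rYX rXZ).
- exact: sqC.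
Qed.

Definition sk_sq (hc : c ^+ 3 != -1) (i : 'I_3) : center sklyanin :=
  Center (sk_sq_central hc i).

End SklyaninTheory.

Section AffineGeometry.
Variables (F : fieldType) (Z : comAlgType F).

Definition alg_indep n (e : 'I_n -> Z) : Prop :=
  forall q : mpoly.mpoly n F, mpoly.mmap (in_alg Z) e q = 0 -> q = 0.

(* Dimension of an irreducible affine variety with coordinate ring Z, as the  *)
(* transcendence degree of Z over F.                                          *)
Definition variety_dim (n : nat) : Prop :=
  (exists e : 'I_n -> Z, alg_indep e) /\ ~ (exists e : 'I_n.+1 -> Z, alg_indep e).

(* m / m^2, the dual of the Zariski tangent space, has an F-basis of size n.  *)
Definition cotangent_dim (m : set Z) (n : nat) : Prop :=
  let m2 := ideal_gen [set x * y | x in m & y in m] in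
  exists e : 'I_n -> Z,
    [/\ forall i, m (e i),
        forall z, m z -> exists a : 'I_n -> F, m2 (z - \sum_i a i *: e i) &
        forall a : 'I_n -> F, m2 (\sum_i a i *: e i) -> forall i, a i = 0].

(* The maximal ideals m are meant to have residue field F.                    *)
Definition smooth_point (m : set Z) : Prop :=
  exists n, variety_dim n /\ cotangent_dim m n.

End AffineGeometry.

Section Representations.
Variables (F : fieldType) (A : algType F).

Definition simple_rep n (rho : {lrmorphism A -> 'M[F]_n.+1}) : Prop :=
  forall V : {vspace 'cV[F]_n.+1},
    (forall a v, v \in V -> rho a *m v \in V) -> V = 0%VS \/ V = fullv.

Definition rep_equiv n (rho rho' : {lrmorphism A -> 'M[F]_n.+1}) : Prop :=
  exists2 g : 'M[F]_n.+1, g \in unitmx & forall a, g *m rho a = rho' a *m g.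

(* For rho simple this is the point of max(Z(A)) below rho.                   *)
Definition rep_point n (rho : {lrmorphism A -> 'M[F]_n.+1}) : set (center A) :=
  [set z | rho (val z) = 0].

(* Azumaya points of an algebra of PI-degree 2: A / mA is isomorphic to the   *)
(* 2 x 2 matrices.                                                            *)
Definition azumaya_point (m : set (center A)) : Prop :=
  exists f : {lrmorphism A -> 'M[F]_2},
    (forall M, exists a, f a = M) /\
    [set a | f a = 0] = ideal_gen [set val z | z in m].

End Representations.

Section Family.
Variables (F : numClosedFieldType) (c : F).

Definition mx_rows m n (s : seq (seq F)) : 'M[F]_(m, n) :=
  \matrix_(i, j) nth 0 (nth [::] s i) j.

Definition formQ (u v w : F) : 'M[F]_3 := mx_rows 3 3
  [:: [:: 2 * u; c * w; c * v];
      [:: c * w; 2 * v; c * u];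
      [:: c * v; c * u; 2 * w]].

Definition discr (u v w : F) : F := \det (formQ u v w).

Definition diag3 (a b d : F) : 'rV[F]_3 := mx_rows 1 3 [:: [:: a; b; d]].

(* A diagonalisation P^T Q P = diag Delta is stored as (Delta, P^-1).         *)
Definition frame1 (u v w : F) : 'rV[F]_3 * 'M[F]_3 :=
  let A := 4 * u * v - c ^+ 2 * w ^+ 2 in
  let B := c * u * w - 2 * v ^+ 2 in
  let C := c * v * w - 2 * u ^+ 2 in
  (diag3 (2 * u) (2 * u * A) (4 * u ^+ 2 * A * discr u v w),
   invmx (mx_rows 3 3
     [:: [:: 1; 0; 0];
         [:: - (c * w); 2 * u; 0];
         [:: 2 * c * u * B; 2 * c * u * C; 2 * u * A]])^T).

Definition frame2 (u v w : F) : 'rV[F]_3 * 'M[F]_3 :=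
  let Q0 := (w - v) * (2 * w + 2 * v + c * u) in
  let Q1 := c ^+ 2 * v * w - 4 * u * w + c ^+ 2 * v ^+ 2 - 2 * c * u ^+ 2 in
  let Q2 := c ^+ 2 * w ^+ 2 + c ^+ 2 * v * w - 4 * u * v - 2 * c * u ^+ 2 in
  let L := Q1 + Q2 in
  (diag3 (2 * u) (- (2 * u * L)) (- (16 * u ^+ 4 * L * discr u v w)),
   invmx (mx_rows 3 3
     [:: [:: 1; 0; 0];
         [:: - (c * v) - c * w; 2 * u; 2 * u];
         [:: 4 * c * u ^+ 2 * Q0; 4 * u ^+ 2 * Q1; - (4 * u ^+ 2 * Q2)]])^T).

(* The middle branch is frame1 with Y, Z and v, w interchanged.               *)
Definition frame (u v w : F) : 'rV[F]_3 * 'M[F]_3 :=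
  if 4 * u * v - c ^+ 2 * w ^+ 2 != 0 then frame1 u v w
  else if 4 * u * w - c ^+ 2 * v ^+ 2 != 0 then
    ((frame1 u w v).1, xcol 1 2 (frame1 u w v).2)
  else frame2 u v w.

Definition sigma (k : 'I_3) : 'M[F]_2 := mx_rows 2 2
  (nth [::]
    [:: [:: [:: 0; 1]; [:: 1; 0]];
        [:: [:: 0; 'i]; [:: - 'i; 0]];
        [:: [:: 1; 0]; [:: 0; -1]]] k).

(* Points of affine 3-space are rows p = (u, v, w).                           *)
Definition Delta (p : 'rV[F]_3) : 'rV[F]_3 := (frame (p 0 0) (p 0 1) (p 0 2)).1.
Definition Pinv (p : 'rV[F]_3) : 'M[F]_3 := (frame (p 0 0) (p 0 1) (p 0 2)).2.
Definition discr_at (p : 'rV[F]_3) : F := discr (p 0 0) (p 0 1) (p 0 2).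

(* sq p 0 j is the chosen square root of Delta p 0 j; eps = false is psi_+.   *)
(* Since psi x_i psi x_j + psi x_j psi x_i = 2 Q_ij, psi at p = (u, v, w)     *)
(* sends (X^2, Y^2, Z^2) to (2u, 2v, 2w).                                     *)
Definition psi (sq : 'rV[F]_3 -> 'rV[F]_3) (p : 'rV[F]_3) (eps : bool)
    (i : 'I_3) : 'M[F]_2 :=
  Pinv p 0 i * sq p 0 0 *: sigma 0 + Pinv p 1 i * sq p 0 1 *: sigma 1
  + (-1) ^+ eps * (Pinv p 2 i * sq p 0 2) *: sigma 2.

Definition psi_rep (sq : 'rV[F]_3 -> 'rV[F]_3) (p : 'rV[F]_3) (eps : bool)
    (rho : {lrmorphism sklyanin c -> 'M[F]_2}) : Prop :=
  p 0 0 != 0 /\ forall i, rho (sk_gen c i) = psi sq p eps i.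

(* The same family with the variables permuted by s.                          *)
Definition perm_psi_rep (sq : 'rV[F]_3 -> 'rV[F]_3) (s : 'S_3) (p : 'rV[F]_3)
    (eps : bool) (rho : {lrmorphism sklyanin c -> 'M[F]_2}) : Prop :=
  p 0 0 != 0 /\ forall i, rho (sk_gen c (s i)) = psi sq p eps i.

End Family.

(* Main.v *)
Require Import Defs.
From HB Require Import structures.
From Stdlib Require Import Ncring Ncring_tac.
From mathcomp Require Import all_boot all_order all_algebra all_fingroup.
From mathcomp Require Import boolp classical_sets reals complex.
From mathcomp Require Import ring zify.
From mathcomp Require Import -(notations) monalg mpoly.
Import Order.TTheory GRing.Theory Num.Theory.
Local Open Scope classical_set_scope.
Local Open Scope ring_scope.
Set Implicit Arguments.
Unset Strict Implicit.
Unset Printing Implicit Defensive.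

(** The proof determines S_c completely in terms of the central squares.

    Let F be the field of scalars, x_0, x_1, x_2 the generators X, Y, Z, and
    alt = x_0 x_1 x_2 - x_2 x_1 x_0. By the relations, S_c is generated as a module over R = F[X^2, Y^2, Z^2] by 1, the x_i,
    the x_(i+1) x_(i+2) and alt ([sk_spannedP]). A triple of 2 x 2 matrices with
    X_i X_j + X_j X_i = 2 Q_ij satisfies the relations of S_c, and such triples exist:
    writing Q = B^T Delta B with B = P^-1, as the two frames do ([frame1P], [frame2P]),
    combinations of Pauli matrices give psi. Let t_i = 2 p_i be the scalar by which
    x_i ^ 2 acts. Then alt acts by a scalar g, the trace of X_0 X_1 X_2, and g ^ 2 is
    a Gram determinant in t ([char_gamma]):
      g ^ 2 = c^2 (t_0^3 + t_1^3 + t_2^3) - (4 + c^3) t_0 t_1 t_2 = - 1/2 det Q(t).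
    The two signs in psi give the two values of g ([pauli_triple_flip]), so every pair
    (t, g) on this hypersurface with t <> 0 is realised by a surjective representation
    ([point_rep]), after a permutation of the variables making t_0 <> 0.

    Taking traces of an R-combination of the eight generators against the generators
    shows that these representations separate the elements of S_c, and that an element
    acting by scalars in all of them lies in R + R alt ([sk_faithful], [central_normal]).
    Hence the center is R + R alt, a free module with alt ^ 2 = alt_sq_poly, and its
    F-valued characters are the chi t g with (t, g) on the hypersurface. Over the complex numbers
    every maximal ideal is the kernel of some chi t g ([maximal_points]): the residue
    fields have countable dimension over an uncountable field, hence are trivial
    extensions ([residue]).

    Classification. In a simple representation the x_i ^ 2 are scalars, not all 0
    ([simple_nonzero]), so with t_0 <> 0 the x_i form a Clifford triple. Diagonalising Q
    turns it into three anticommuting matrices, the first two of nonzero scalar square;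
    these are simultaneously conjugate to multiples of the first two Pauli matrices
    ([pauli_pair]), and the third is then a multiple of the third Pauli matrix,
    determined up to sign ([clifford_psi]). The sign is seen on g, which vanishes only on
    det Q = 0: this is the uniqueness statement ([psi_unique]).

    Azumaya locus. For a surjective representation over (t, g), Cramer's rule for the
    trace form expresses det G ^ 2 a through half traces of multiples of a
    ([gram_identity]); where det G is invertible this shows that the kernel is generated
    by the maximal ideal below ([rep_kernel]). So each point with t <> 0 is an Azumaya
    point, and the origin is not, since no simple representation lies over it.

    Singular points. The center has transcendence degree 3 ([center_dim]), by counting
    the monomials of bounded degree. Its cotangent space at (t, g) is F^4 modulo the
    gradient of the equation of the hypersurface ([cotangent_regular],
    [cotangent_singular]), and that gradient vanishes at the origin only, because any
    other zero forces (c^3 + 1) (c^3 - 8)^2 = 0 ([conormal_neq0]). *)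

(** * Algebra morphisms defined on the generators *)

Lemma morph_rel (F : fieldType) (A : lalgType F) (B : lalgType F) (e : A -> B) :
    {morph e : f g / f - g} -> {morph e : f g / f + g} ->
    {morph e : f g / f * g} -> (forall k, {morph e : f / k *: f}) ->
  forall c x y z, e (x * y + y * x - c *: z ^+ 2) =
                  e x * e y + e y * e x - c *: e z ^+ 2.
Proof. by move=> eB eD eM eZ c x y z; rewrite eB eD eZ !expr2 !eM. Qed.

Section Words.
Variables (F : fieldType) (A : algType F) (M : 'I_3 -> A).

Definition word_eval (m : monalg.fmonom 'I_3) : A :=
  \prod_(i <- monalg.fmonom_val m) M i.

Fact word_eval_morphism : monalg.mmorphism word_eval.
Proof.
split=> [m n|]; rewrite /word_eval.
  by rewrite monalg.fmM big_cat.
by rewrite monalg.fm1 big_nil.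
Qed.
HB.instance Definition _ :=
  monalg.isMultiplicative.Build _ _ word_eval word_eval_morphism.

End Words.

(** Locked, so that unification does not unfold the sum over all words. *)
HB.lock Definition free_eval (F : fieldType) (A : algType F) (M : 'I_3 -> A)
  (f : free_alg F) : A := monalg.mmap (in_alg A) (word_eval M) f.

Section Universal.
Variables (F : fieldType) (c : F) (A : algType F) (M : 'I_3 -> A).
Local Notation free_eval := (free_eval M).
Local Notation word_eval := (word_eval M).

Lemma free_evalB : {morph free_eval : f g / f - g}.
Proof. by move=> f g; rewrite free_eval.unlock monalg.mmapB. Qed.

Lemma free_evalD : {morph free_eval : f g / f + g}.
Proof. by move=> f g; rewrite free_eval.unlock monalg.mmapD. Qed.

Lemma free_evalM : {morph free_eval : f g / f * g}.
Proof.
have comm_alg (g : free_alg F) m m' :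
  GRing.comm (in_alg A (monalg.mcoeff m g)) (word_eval m').
  by rewrite /GRing.comm /= mulr_algl mulr_algr.
by rewrite free_eval.unlock; case: (monalg.commr_mmap_is_multiplicative comm_alg).
Qed.

Lemma free_eval1 : free_eval 1 = 1.
Proof. rewrite free_eval.unlock; exact: (monalg.mmap1 (f := in_alg A) (h := word_eval)). Qed.

Lemma free_evalZ k f : free_eval (k *: f) = k *: free_eval f.
Proof.
by rewrite free_eval.unlock (monalg.mmapZ (f := in_alg A) (h := word_eval)) /= mulr_algl.
Qed.

Lemma free_eval_gen i : free_eval (free_gen F i) = M i.
Proof.
rewrite free_gen.unlock free_eval.unlock (monalg.mmapU (f := in_alg A)) /word_eval.
by rewrite monalg.fmuE big_seq1 /= scale1r mul1r.
Qed.

Lemma free_eval_rel f g h :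
  free_eval (f * g + g * f - c *: h ^+ 2) =
  free_eval f * free_eval g + free_eval g * free_eval f - c *: free_eval h ^+ 2.
Proof.
exact: (morph_rel free_evalB free_evalD free_evalM free_evalZ).
Qed.

Hypotheses (MXY : M 0 * M 1 + M 1 * M 0 = c *: M 2 ^+ 2)
           (MYZ : M 1 * M 2 + M 2 * M 1 = c *: M 0 ^+ 2)
           (MZX : M 2 * M 0 + M 0 * M 2 = c *: M 1 ^+ 2).

Lemma free_eval_rels f : ideal_gen (sk_rels c) f -> free_eval f = 0.
Proof.
move=> If; apply: (If [set h | free_eval h = 0]) => [|g].
  split=> [|x y|a x b] /=; first by rewrite -(subrr 1) free_evalB subrr.
    by move=> x0 y0; rewrite free_evalD x0 y0 addr0.
  by move=> x0; rewrite !free_evalM x0 mulr0 mul0r.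
by case=> [[|]|] ->; rewrite /= free_eval_rel !free_eval_gen ?MXY ?MYZ ?MZX subrr.
Qed.

Definition sk_lift (s : sklyanin c) : A :=
  free_eval (generic_quotient.repr s).

Lemma sk_lift_pi f : sk_lift (quot_pi _ _ f) = free_eval f.
Proof.
apply/eqP; rewrite -subr_eq0 -free_evalB; apply/eqP/free_eval_rels.
by apply/(quot_pi_eq (ideal_gen_ideal _) (@sk_rels_proper F c)); rewrite quot_reprK.
Qed.

(** The universal property of the presentation: the source of all the representations
    below. *)
Lemma sklyanin_lift :
  exists rho : {lrmorphism sklyanin c -> A}, forall i, rho (sk_gen c i) = M i.
Proof.
have piD := @quot_piD F _ _ (ideal_gen_ideal (sk_rels c)) (@sk_rels_proper F c).
have liftD : {morph sk_lift : s t / s + t}.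
  elim/quot_ind=> f; elim/quot_ind=> g; rewrite -quot_piD.
  by rewrite !sk_lift_pi free_evalD.
have liftM : monoid_morphism sk_lift.
  split; first by rewrite -[1]/(quot_pi _ _ 1) sk_lift_pi free_eval1.
  elim/quot_ind=> f; elim/quot_ind=> g.
  by rewrite -quot_piME !sk_lift_pi free_evalM.
have liftZ : scalable sk_lift.
  by move=> k; elim/quot_ind=> f; rewrite -quot_piZE !sk_lift_pi free_evalZ.
have lift0 : sk_lift 0 = 0.
  by apply: (addrI (sk_lift 0)); rewrite -liftD !addr0.
pose mD := GRing.isNmodMorphism.Build _ _ sk_lift (conj lift0 liftD).
pose mM := GRing.isMonoidMorphism.Build _ _ sk_lift liftM.
pose mZ := GRing.isScalable.Build _ _ _ _ sk_lift liftZ.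
pose rho : {lrmorphism sklyanin c -> A} := HB.pack sk_lift mD mM mZ.
exists rho => i; rewrite /rho /= sk_gen.unlock sk_lift_pi; exact: free_eval_gen.
Qed.

End Universal.

(** * Identities in a noncommutative ring *)

Section NoncommutativeRing.
Variable A : pzRingType.

(** The class through which the tactic for identities in noncommutative rings reads
    the ring operations. *)
Definition ncring_ops :
  @Ring_ops A 0 1 +%R *%R (fun x y : A => x - y) -%R eq.
Proof. by []. Defined.

Lemma ncring_axioms : @Ring A _ _ _ _ _ _ _ ncring_ops.
Proof.
split; try apply _ => //=.
- by move=> x; apply: (@add0r A).
- by move=> x y; apply: (@addrC A).
- by move=> x y z; apply: (@addrA A).
- by move=> x; apply: (@mul1r A).
- by move=> x; apply: (@mulr1 A).
- by move=> x y z; apply: (@mulrA A).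
- by move=> x y z; apply: (@mulrDl A).
- by move=> x y z; apply: (@mulrDr A).
- by [].
- by move=> x; apply: (@subrr A).
Qed.

End NoncommutativeRing.
#[local] Existing Instance ncring_ops.
#[local] Existing Instance ncring_axioms.

(** Words are rewritten by the defining relations; u, v, w stand for c X^2, c Y^2, c Z^2.
    Each proof subtracts the relations with the multipliers that make the difference an
    identity of free rings. *)
Section Identities.
Variables (A : pzRingType) (x y z u v w : A).
Hypotheses (xy : x * y + y * x = w) (yz : y * z + z * y = u) (zx : z * x + x * z = v).

Lemma zyxE : z * y * x = u * x - y * v + w * z - x * y * z.
Proof.
apply/eqP; rewrite -subr_eq0; apply/eqP.
have -> : z * y * x - (u * x - y * v + w * z - x * y * z) =
    (y * z + z * y - u) * x - y * (z * x + x * z - v) + (x * y + y * x - w) * z.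
  by non_commutative_ring.
by rewrite xy yz zx !subrr !mul0r mulr0 subr0 addr0.
Qed.

(** Read as an equation for 2 x y z, this puts x y z in the span of the alternating
    cubic and of the central multiples of generators. *)
Lemma xyzE : x * (y * z) =
  x * y * z - z * y * x + u * x - y * v + w * z - x * (y * z).
Proof. by rewrite zyxE; non_commutative_ring. Qed.

(** The alternating cubic does not depend on the cyclic position of the variables. *)
Lemma zyx_cyclic : u * x = x * u -> y * z * x - x * z * y = x * y * z - z * y * x.
Proof.
move=> ux; apply/eqP; rewrite -subr_eq0; apply/eqP; rewrite zyxE.
set r := (X in _ - X); have -> : y * z * x - x * z * y - r =
    y * (z * x + x * z - v) - (x * y + y * x - w) * z - x * (y * z + z * y - u)
    + (u * x - x * u).
  by rewrite /r; non_commutative_ring.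
by rewrite xy yz zx ux !subrr !mul0r !mulr0 !subr0 addr0.
Qed.

(** The product of a generator by the alternating cubic falls back on words of length
    at most two with central coefficients. *)
Lemma mul_zyx : x * x * z = z * (x * x) -> x * (x * y * z - z * y * x) =
  x * x * (y * z) + x * x * (y * z) + v * (x * y) + z * x * w - v * w - x * x * u.
Proof.
move=> xxz; apply/eqP; rewrite -subr_eq0; apply/eqP.
set r := (X in _ - X); have -> : x * (x * y * z - z * y * x) - r =
   x * x * (u - (y * z + z * y)) - (z * x + x * z - v) * (y * x)
   - (v - z * x) * (x * y + y * x - w) + (x * x * z - z * (x * x)) * y.
  by rewrite /r; non_commutative_ring.
by rewrite xy yz zx xxz !subrr !mul0r !mulr0 !subr0 addr0.
Qed.

End Identities.

(** * Polynomials evaluated in commutative algebras *)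

(** Locked, so that its morphism structures are found without unfolding the sum over
    monomials. *)
HB.lock Definition poly_at (F : comNzRingType) (n : nat) (A : comAlgType F)
  (e : 'I_n -> A) (r : mpoly.mpoly n F) : A := mpoly.mmap (in_alg A) e r.

Section PolyAt.
Variables (F : comNzRingType) (n : nat) (A : comAlgType F) (e : 'I_n -> A).
Local Notation poly_at := (poly_at e).

Fact poly_at_zmod : zmod_morphism poly_at.
Proof. by move=> p q; rewrite poly_at.unlock mpoly.mmapB. Qed.
HB.instance Definition _ := GRing.isZmodMorphism.Build _ _ poly_at poly_at_zmod.

Fact poly_at_monoid : monoid_morphism poly_at.
Proof.
by rewrite poly_at.unlock; have [pM p1] := mpoly.mmap_is_multiplicative e (in_alg A).
Qed.
HB.instance Definition _ := GRing.isMonoidMorphism.Build _ _ poly_at poly_at_monoid.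

Fact poly_at_scalable : scalable poly_at.
Proof. by move=> k p; rewrite poly_at.unlock mpoly.mmapZ /= mulr_algl. Qed.
HB.instance Definition _ := GRing.isScalable.Build _ _ _ _ poly_at poly_at_scalable.

Lemma poly_atX i : poly_at (mpoly.mpolyX F (mpoly.mnm1 i)) = e i.
Proof. by rewrite poly_at.unlock mpoly.mmapX mpoly.mmap1U. Qed.

Lemma poly_atC k : poly_at (mpoly.mpolyC n k) = k%:A.
Proof. by rewrite -mpoly.alg_mpolyC linearZ /= rmorph1. Qed.

End PolyAt.

Lemma mpoly_ring_ind (R : comNzRingType) n (Pr : mpoly.mpoly n R -> Prop) :
    (forall k, Pr (mpoly.mpolyC n k)) -> (forall i, Pr (mpoly.mpolyX R (mpoly.mnm1 i))) ->
    (forall p q, Pr p -> Pr q -> Pr (p + q)) -> (forall p q, Pr p -> Pr q -> Pr (p * q)) ->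
  forall p, Pr p.
Proof.
move=> PC PX PD PM p; elim/mpoly.mpolyind: p => [|k m p _ _ IH].
  by rewrite -(mpoly.mpolyC0 n R).
apply: (PD) => //; rewrite -mpoly.mul_mpolyC; apply: (PM) => //.
rewrite mpoly.mpolyXE_id; apply: (big_ind Pr) => // [|i _].
  by rewrite -(mpoly.mpolyC1 n R).
elim: (mpoly.fun_of_multinom m i) => [|j IHj]; last by rewrite exprS; apply: (PM).
by rewrite expr0 -(mpoly.mpolyC1 n R).
Qed.

(** * Module generators over the central squares *)

Lemma scale_half (F : numFieldType) (V : lmodType F) (a b : V) :
  a = b - a -> a = 2^-1 *: b.
Proof.
move=> e; have -> : b = 2 *: a by rewrite scaler_nat mulr2n {1}e subrK.
by rewrite scalerA mulVf ?scale1r // pnatr_eq0.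
Qed.

Lemma ord3_cyclic (i j : 'I_3) : [\/ j = i, j = i + 1 | j = i + 1 + 1].
Proof.
by case: i j => [[|[|[|//]]] ?] [[|[|[|//]]] ?];
   [constructor 1|constructor 2|constructor 3|constructor 3|constructor 1|
    constructor 2|constructor 2|constructor 3|constructor 1]; apply: val_inj.
Qed.

Lemma ord3_3 (i : 'I_3) : i + 1 + 1 + 1 = i.
Proof. by case: i => [[|[|[|//]]] ?]; apply: val_inj. Qed.

Lemma central_comm (F : comNzRingType) (A : algType F) (z : center A) (a : A) :
  val z * a = a * val z.
Proof. exact: (centralP _ (valP z)). Qed.

Lemma sk_ind (F : fieldType) (c : F) (Pr : sklyanin c -> Prop) :
    Pr 1 -> (forall a b, Pr a -> Pr b -> Pr (a + b)) -> (forall k a, Pr a -> Pr (k *: a)) ->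
    (forall i a, Pr a -> Pr (sk_gen c i * a)) ->
  forall a, Pr a.
Proof.
rewrite sk_gen.unlock => P1 PD PZ PM a; elim/quot_ind: a.
elim/free_alg_ind => [|f h|k f|i f] //.
- by rewrite quot_piD; apply: PD.
- by rewrite quot_piZE; apply: PZ.
- by rewrite quot_piME; apply: PM.
Qed.

(** The structure map of S_c as a module over the polynomials in X^2, Y^2, Z^2. *)
HB.lock Definition sk_ev (F : fieldType) (c : F) (hc : c ^+ 3 != -1)
  (r : mpoly.mpoly 3 F) : sklyanin c := val (poly_at (sk_sq hc) r).

HB.lock Definition sk_alt (F : fieldType) (c : F) : sklyanin c :=
  sk_gen c 0 * sk_gen c 1 * sk_gen c 2 - sk_gen c 2 * sk_gen c 1 * sk_gen c 0.

Section Evaluation.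
Variables (F : fieldType) (c : F) (hc : c ^+ 3 != -1).
Local Notation ev := (sk_ev hc).
Local Notation pX i := (mpoly.mpolyX F (mpoly.mnm1 i)).

Fact sk_ev_zmod : zmod_morphism ev.
Proof. by move=> r s; rewrite sk_ev.unlock !rmorphB. Qed.
HB.instance Definition _ := GRing.isZmodMorphism.Build _ _ ev sk_ev_zmod.

Fact sk_ev_monoid : monoid_morphism ev.
Proof. by split=> [|r s]; rewrite sk_ev.unlock ?rmorph1 // !rmorphM. Qed.
HB.instance Definition _ := GRing.isMonoidMorphism.Build _ _ ev sk_ev_monoid.

Fact sk_ev_scalable : scalable ev.
Proof. by move=> k r; rewrite sk_ev.unlock !linearZ. Qed.
HB.instance Definition _ := GRing.isScalable.Build _ _ _ _ ev sk_ev_scalable.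

Lemma sk_evE r : val (poly_at (sk_sq hc) r) = ev r.
Proof. by rewrite sk_ev.unlock. Qed.

Lemma sk_ev_comm r s : ev r * s = s * ev r.
Proof. by rewrite -sk_evE central_comm. Qed.

Lemma sk_evX i : ev (pX i) = sk_gen c i ^+ 2.
Proof. by rewrite -sk_evE poly_atX. Qed.

End Evaluation.

Section Spanning.
Variables (F : numFieldType) (c : F) (hc : c ^+ 3 != -1).
Local Notation S := (sklyanin c).
Local Notation P := (mpoly.mpoly 3 F).
Local Notation x := (sk_gen c).
Local Notation ev := (sk_ev hc).
Local Notation sk_alt := (sk_alt c).

(** The eight generators of a Clifford algebra of rank three: words of length 0, 1, 2
    and the alternating cubic. Indices are cyclic, modulo 3. *)
Definition sk_normal (r : P) (a b : 'I_3 -> P) (s : P) : S :=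
  ev r + \sum_i ev (a i) * x i + \sum_i ev (b i) * (x (i + 1) * x (i + 1 + 1))
  + ev s * sk_alt.

Lemma sk_rel i : x i * x (i + 1) + x (i + 1) * x i = c *: x (i + 1 + 1) ^+ 2.
Proof.
have E3 (j k : 'I_3) : nat_of_ord j = k -> j = k by apply: val_inj.
case: (ord3_cyclic 0 i) => ->.
- by rewrite (E3 (0 + 1) 1) // (E3 (1 + 1) 2) // sk_relXY.
- by rewrite (E3 (0 + 1) 1) // (E3 (1 + 1) 2) // (E3 (2 + 1) 0) // sk_relYZ.
by rewrite (E3 (0 + 1 + 1) 2) // (E3 (2 + 1) 0) // (E3 (0 + 1) 1) // sk_relZX.
Qed.

Lemma sk_alt_cyclic i :
  sk_alt = x i * x (i + 1) * x (i + 1 + 1) - x (i + 1 + 1) * x (i + 1) * x i.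
Proof.
have rot j : x j * x (j + 1) * x (j + 1 + 1) - x (j + 1 + 1) * x (j + 1) * x j =
    x (j + 1) * x (j + 1 + 1) * x (j + 1 + 1 + 1)
    - x (j + 1 + 1 + 1) * x (j + 1 + 1) * x (j + 1).
  have r1 := sk_rel j; have r2 := sk_rel (j + 1); have r3 := sk_rel (j + 1 + 1).
  rewrite !ord3_3 in r1 r2 r3 *.
  rewrite (zyx_cyclic r1 r2 r3) //.
  by rewrite -scalerAl -scalerAr -sk_evX sk_ev_comm.
have E3 (j k : 'I_3) : nat_of_ord j = k -> j = k by apply: val_inj.
have alt0 : sk_alt = x 0 * x (0 + 1) * x (0 + 1 + 1) - x (0 + 1 + 1) * x (0 + 1) * x 0.
  by rewrite (E3 (0 + 1) 1) // (E3 (1 + 1) 2) // sk_alt.unlock.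
by case: (ord3_cyclic 0 i) => ->; rewrite alt0 // (rot 0) // (rot (0 + 1)).
Qed.

Definition sk_spanned (s : S) : Prop := exists r a b t, s = sk_normal r a b t.

Lemma sk_spanned_add s t : sk_spanned s -> sk_spanned t -> sk_spanned (s + t).
Proof.
move=> [r [a [b [q ->]]]] [r' [a' [b' [q' ->]]]].
exists (r + r'), (fun i => a i + a' i), (fun i => b i + b' i), (q + q').
rewrite /sk_normal !rmorphD mulrDl.
have sumD (f g : 'I_3 -> P) (h : 'I_3 -> S) :
    \sum_i ev (f i + g i) * h i = \sum_i ev (f i) * h i + \sum_i ev (g i) * h i.
  by rewrite -big_split; apply: eq_bigr => i _ /=; rewrite !rmorphD mulrDl.
by rewrite !sumD; non_commutative_ring.
Qed.

Lemma sk_spanned_mul r s : sk_spanned s -> sk_spanned (ev r * s).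
Proof.
move=> [q [a [b [t ->]]]].
exists (r * q), (fun i => r * a i), (fun i => r * b i), (r * t).
have sumM (f : 'I_3 -> P) (h : 'I_3 -> S) :
    \sum_i ev (r * f i) * h i = ev r * \sum_i ev (f i) * h i.
  by rewrite mulr_sumr; apply: eq_bigr => i _; rewrite !rmorphM mulrA.
by rewrite /sk_normal !sumM !rmorphM !mulrDr; congr (_ + _); rewrite mulrA.
Qed.

Lemma sk_spanned_sum (f : 'I_3 -> S) :
  (forall i, sk_spanned (f i)) -> sk_spanned (\sum_i f i).
Proof.
by move=> fS; rewrite !big_ord_recl big_ord0 addr0; do !apply: sk_spanned_add.
Qed.

Lemma sk_spanned_scale k s : sk_spanned s -> sk_spanned (k *: s).
Proof.
move=> sS; have -> : k *: s = ev k%:A * s; last exact: sk_spanned_mul.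
by rewrite linearZ rmorph1 mulr_algl.
Qed.

Lemma ev_sum0 (h : 'I_3 -> S) : \sum_i ev 0 * h i = 0.
Proof. by rewrite big1 // => i _; rewrite !rmorph0 mul0r. Qed.

Lemma ev_sum_delta (h : 'I_3 -> S) i : \sum_j ev (i == j)%:R * h j = h i.
Proof.
rewrite (bigD1 i) //= eqxx !rmorph1 mul1r big1 ?addr0 // => j /negPf ji.
by rewrite eq_sym ji !rmorph0 mul0r.
Qed.

Lemma sk_spanned1 : sk_spanned 1.
Proof.
exists 1, (fun=> 0), (fun=> 0), 0.
by rewrite /sk_normal !ev_sum0 !rmorph0 !rmorph1 mul0r !addr0.
Qed.

Lemma sk_spanned_gen i : sk_spanned (x i).
Proof.
exists 0, (fun j => (i == j)%:R), (fun=> 0), 0.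
by rewrite /sk_normal ev_sum0 ev_sum_delta !rmorph0 mul0r !addr0 add0r.
Qed.

Lemma sk_spanned_gen2 i : sk_spanned (x (i + 1) * x (i + 1 + 1)).
Proof.
exists 0, (fun=> 0), (fun j => (i == j)%:R), 0.
rewrite /sk_normal ev_sum0 (ev_sum_delta (fun i => x (i + 1) * x (i + 1 + 1))) !rmorph0.
by rewrite mul0r !addr0 !add0r.
Qed.

Lemma sk_spanned_alt : sk_spanned sk_alt.
Proof.
exists 0, (fun=> 0), (fun=> 0), 1.
by rewrite /sk_normal !ev_sum0 !rmorph0 !rmorph1 mul1r !add0r.
Qed.

Lemma sk_spanned_sq i s : sk_spanned s -> sk_spanned (x i ^+ 2 * s).
Proof. by rewrite -sk_evX; apply: sk_spanned_mul. Qed.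

Lemma sk_spanned_opp s : sk_spanned s -> sk_spanned (- s).
Proof. by rewrite -scaleN1r; apply: sk_spanned_scale. Qed.

(** For the words in the other cyclic order, the relation exchanges the factors. *)
Lemma sk_spanned_prod i j : sk_spanned (x i * x j).
Proof.
have sq k : sk_spanned (x k ^+ 2) by rewrite -[_ ^+ 2]mulr1; apply/sk_spanned_sq/sk_spanned1.
have next k : sk_spanned (x k * x (k + 1)).
  by have := sk_spanned_gen2 (k + 1 + 1); rewrite ord3_3.
case: (ord3_cyclic i j) => ->; first by rewrite -expr2.
  exact: next.
have -> : x i * x (i + 1 + 1) = c *: x (i + 1) ^+ 2 - x (i + 1 + 1) * x i.
  apply: (canRL (addrK _)); rewrite [LHS]addrC.
  by have := sk_rel (i + 1 + 1); rewrite !ord3_3.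
apply: sk_spanned_add; first exact: sk_spanned_scale.
by apply: sk_spanned_opp; have := next (i + 1 + 1); rewrite ord3_3.
Qed.

Lemma sk_spanned_xyz i : sk_spanned (x i * (x (i + 1) * x (i + 1 + 1))).
Proof.
have r1 := sk_rel i; have r2 := sk_rel (i + 1); have r3 := sk_rel (i + 1 + 1).
rewrite !ord3_3 in r1 r2 r3.
have cube k : sk_spanned (c *: x k ^+ 2 * x k).
  by rewrite -scalerAl; apply/sk_spanned_scale/sk_spanned_sq/sk_spanned_gen.
have := xyzE r1 r2 r3; rewrite -sk_alt_cyclic => /scale_half ->.
apply: sk_spanned_scale; apply: sk_spanned_add; last exact: cube.
apply: sk_spanned_add; first by apply: sk_spanned_add; [exact: sk_spanned_alt|].
by apply: sk_spanned_opp; rewrite -scalerAr -exprS exprSr scalerAl.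
Qed.

(** The span is a left ideal: this is where the identities in words of length three
    and four are used. *)
Lemma sk_spanned_mul_gen i s : sk_spanned s -> sk_spanned (x i * s).
Proof.
have swap r t : x i * (ev r * t) = ev r * (x i * t).
  by rewrite mulrA -sk_ev_comm mulrA.
move=> [q [a [b [t ->]]]]; rewrite /sk_normal 3!mulrDr; do 3?apply: sk_spanned_add.
- by rewrite -sk_ev_comm; apply/sk_spanned_mul/sk_spanned_gen.
- rewrite mulr_sumr; apply: sk_spanned_sum => j; rewrite swap.
  by apply/sk_spanned_mul/sk_spanned_prod.
- rewrite mulr_sumr; apply: sk_spanned_sum => j; rewrite swap.
  apply/sk_spanned_mul; case: (ord3_cyclic i j) => ->.
  + exact: sk_spanned_xyz.
  + rewrite ord3_3.
    have -> : x i * (x (i + 1 + 1) * x i) = c *: (x (i + 1) ^+ 2 * x i) - x i ^+ 2 * x (i + 1 + 1).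
      rewrite scalerAl; have := sk_rel (i + 1 + 1); rewrite !ord3_3 => <-.
      apply: (canRL (addrK _)); rewrite [LHS]addrC mulrDl -sk_evX sk_ev_comm sk_evX.
      by rewrite expr2 !mulrA.
    apply: sk_spanned_add; first by apply/sk_spanned_scale/sk_spanned_sq/sk_spanned_gen.
    by apply/sk_spanned_opp/sk_spanned_sq/sk_spanned_gen.
  + by rewrite !ord3_3 mulrA -expr2; apply/sk_spanned_sq/sk_spanned_gen.
- rewrite swap; apply: sk_spanned_mul; rewrite (sk_alt_cyclic i).
  have r1 := sk_rel i; have r2 := sk_rel (i + 1); have r3 := sk_rel (i + 1 + 1).
  rewrite !ord3_3 in r1 r2 r3.
  rewrite (mul_zyx r1 r2 r3); last by rewrite -expr2 -sk_evX sk_ev_comm.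
  rewrite -expr2 -!scalerAl -!scalerAr.
  have yz : sk_spanned (x i ^+ 2 * (x (i + 1) * x (i + 1 + 1))).
    exact/sk_spanned_sq/sk_spanned_prod.
  do 5?apply: sk_spanned_add; try apply: sk_spanned_opp; do ?[exact: yz | apply: sk_spanned_scale].
  + exact/sk_spanned_sq/sk_spanned_prod.
  + by rewrite -sk_evX -sk_ev_comm sk_evX; apply/sk_spanned_sq/sk_spanned_prod.
  + by apply/sk_spanned_sq; rewrite expr2; apply: sk_spanned_prod.
  + by apply/sk_spanned_sq; rewrite expr2; apply: sk_spanned_prod.
Qed.

Lemma sk_spannedP s : sk_spanned s.
Proof.
elim/sk_ind: s => [|f g IHf IHg|k f IH|i f IH].
- exact: sk_spanned1.
- exact: sk_spanned_add.
- exact: sk_spanned_scale.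
- exact: sk_spanned_mul_gen.
Qed.

End Spanning.

(** * Points where a polynomial does not vanish *)

Section NonRoots.
Variables (F : numFieldType) (n : nat).
Local Notation P := (mpoly.mpoly n F).

(** Kronecker's substitution: sending the i-th variable to y ^ (d ^ i) separates the
    monomials whose exponents are less than d, by uniqueness of the base d expansion. *)
Definition kronecker (d : nat) (m : mpoly.multinom n) : nat :=
  (\sum_(i < n) mpoly.fun_of_multinom m i * d ^ i)%N.

Lemma base_expansion_inj d k (f g : 'I_k -> nat) :
  (forall i, f i < d)%N -> (forall i, g i < d)%N ->
  (\sum_(i < k) f i * d ^ i = \sum_(i < k) g i * d ^ i)%N -> f =1 g.
Proof.
elim: k f g => [|k IH] f g fd gd; first by move=> _ [].
rewrite !big_ord_recl /= !expn0 !muln1.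
have step (h : 'I_k.+1 -> nat) : (\sum_(i < k) h (lift ord0 i) * d ^ bump 0 i =
    (\sum_(i < k) h (lift ord0 i) * d ^ i) * d)%N.
  by rewrite big_distrl; apply: eq_bigr => i _; rewrite /= /bump add1n expnSr mulnA.
rewrite !step => e.
have e0 : f ord0 = g ord0.
  move/(congr1 (modn^~ d)): e; rewrite /= ![(_ ord0 + _)%N]addnC !modnMDl.
  by rewrite !modn_small.
move: e; rewrite e0 => /addnI /eqP; rewrite eqn_pmul2r ?(leq_ltn_trans _ (fd ord0)) //.
move/eqP/IH => e i; case: (unliftP ord0 i) => [j|] -> //.
exact: (e (fun _ => fd _) (fun _ => gd _) j).
Qed.

Lemma mpoly_nonroot (r : P) : r != 0 -> exists v : 'I_n -> F, mpoly.meval v r != 0.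
Proof.
move=> r0; pose d := mpoly.mmeasure mpoly.mdeg r.
have small m (i : 'I_n) : m \in mpoly.msupp r -> (mpoly.fun_of_multinom m i < d)%N.
  move=> mr; apply: leq_ltn_trans (mpoly.msize_mdeg_lt mr).
  by rewrite mpoly.mdegE (bigD1 i) //= leq_addr.
pose q : {poly F} := \sum_(m <- mpoly.msupp r) mpoly.mcoeff m r *: 'X^(kronecker d m).
have q0 : q != 0.
  have : mpoly.msupp r != [::] by rewrite mpoly.msupp_eq0.
  case supp: (mpoly.msupp r) => [//|m s] _.
  have mr : m \in mpoly.msupp r by rewrite supp mem_head.
  apply/eqP => /(congr1 (coefp (kronecker d m))); rewrite /= coef0 coef_sum.
  rewrite (bigD1_seq m) ?mpoly.msupp_uniq //= coefZ coefXn eqxx mulr1.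
  rewrite big_seq_cond big1 ?addr0 => [|m' /andP[m'r m'm]].
    by apply/eqP; rewrite -mpoly.mcoeff_msupp.
  rewrite coefZ coefXn; case: eqP => [e|]; last by rewrite mulr0.
  case/negP: m'm; apply/eqP/mpoly.mnmP => i; symmetry.
  by apply: (base_expansion_inj _ _ e) => j; apply: small.
have [y qy] : exists y, q.[y] != 0.
  pose s := [seq (i%:R : F) | i <- iota 0 (size q)].
  have /allPn [y _ qy] : ~~ all (root q) s.
    apply/negP=> qs; have us : uniq s.
      by rewrite map_inj_uniq ?iota_uniq // => i j /eqP; rewrite eqr_nat => /eqP.
    by have := max_poly_roots q0 qs us; rewrite size_map size_iota ltnn.
  by exists y.
exists (fun i : 'I_n => y ^+ (d ^ i)%N); rewrite mpoly.mevalE.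
have <- // : q.[y] = \sum_(m <- mpoly.msupp r) mpoly.mcoeff m r *
   \prod_(i < n) (y ^+ (d ^ i)%N) ^+ mpoly.fun_of_multinom m i.
rewrite horner_sum; apply: eq_bigr => m _; rewrite hornerZ hornerXn; congr (_ * _).
rewrite /kronecker expr_sum; apply: eq_bigr => i _; by rewrite -exprM mulnC.
Qed.

End NonRoots.

(** * Diagonalisation of the ternary form *)

Lemma det3 (F : comNzRingType) (M : 'M[F]_3) : \det M =
  M 0 0 * (M 1 1 * M 2 2 - M 1 2 * M 2 1) - M 0 1 * (M 1 0 * M 2 2 - M 1 2 * M 2 0)
  + M 0 2 * (M 1 0 * M 2 1 - M 1 1 * M 2 0).
Proof.
pose m a b := M (inord a) (inord b).
have mE i j : M i j = m i j by rewrite /m !inord_val.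
rewrite (expand_det_row _ ord0) !big_ord_recl big_ord0 addr0 /cofactor.
rewrite !(expand_det_row _ ord0) !big_ord_recl !big_ord0 /cofactor.
rewrite !det_mx11 !mxE /= !mE /= /bump /=; ring.
Qed.

Section Frames.
Variables (F : numClosedFieldType) (c : F).

Lemma ord3P (i : 'I_3) : [\/ i = 0, i = 1 | i = 2].
Proof.
case: i => [[|[|[|//]]] lt]; [constructor 1|constructor 2|constructor 3];
  exact: val_inj.
Qed.

Lemma sum3 (V : nmodType) (f : 'I_3 -> V) : \sum_i f i = f 0 + f 1 + f 2.
Proof.
rewrite !big_ord_recl big_ord0 addr0 addrA.
by congr (f _ + f _ + f _); apply: val_inj.
Qed.

(** B plays the part of P^-1. What the sequel needs of a diagonalisation: the first two
    diagonal entries never vanish, and the third does exactly where det Q does. *)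
Definition frame_for (u v w : F) (D : 'rV[F]_3) (B : 'M[F]_3) :=
  [/\ forall i j, \sum_k B k i * B k j * D 0 k = formQ c u v w i j,
      B \in unitmx, D 0 0 != 0, D 0 1 != 0 & (D 0 2 == 0) = (discr c u v w == 0)].

Lemma frame_of_diag u v w (T : 'M[F]_3) (D : 'rV[F]_3) :
    T \in unitmx -> T *m formQ c u v w *m T^T = diag_mx D ->
  forall i j, \sum_k invmx T^T k i * invmx T^T k j * D 0 k = formQ c u v w i j.
Proof.
move=> uT TQT i j; set B := invmx T^T.
have uT' : T^T \in unitmx by rewrite unitmx_tr.
have -> : formQ c u v w = B^T *m diag_mx D *m B.
  by rewrite -TQT !mulmxA -mulmxA mulmxV // mulmx1 /B trmx_inv trmxK mulVmx // mul1mx.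
rewrite mxE; apply: eq_bigr => k _; rewrite mxE (bigD1 k) //= big1 ?addr0.
  by rewrite !mxE eqxx mulr1n mulrAC.
by move=> l /negPf lk; rewrite !mxE lk mulr0n mulr0.
Qed.

Lemma mx_rows3E (s : seq (seq F)) (i j : 'I_3) :
  mx_rows 3 3 s i j = nth 0 (nth [::] s i) j.
Proof. by rewrite mxE. Qed.

Lemma discrE u v w : discr c u v w =
  (8 + 2 * c ^+ 3) * (u * v * w) - 2 * c ^+ 2 * (u ^+ 3 + v ^+ 3 + w ^+ 3).
Proof. by rewrite /discr det3 !mx_rows3E /=; ring. Qed.

(** The matrix identity entry by entry, so that each entry is a polynomial identity in
    u, v, w and c. *)
Lemma mx_rows_diag (T : seq (seq F)) u v w a b d :
    (forall i j, (i < 3)%N -> (j < 3)%N ->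
       let t k l := nth 0 (nth [::] T k) l in
       t i 0%N * (t j 0%N * (2 * u) + t j 1%N * (c * w) + t j 2%N * (c * v)) +
       t i 1%N * (t j 0%N * (c * w) + t j 1%N * (2 * v) + t j 2%N * (c * u)) +
       t i 2%N * (t j 0%N * (c * v) + t j 1%N * (c * u) + t j 2%N * (2 * w)) =
       (if i == j then nth 0 [:: a; b; d] i else 0)) ->
  mx_rows 3 3 T *m formQ c u v w *m (mx_rows 3 3 T)^T = diag_mx (diag3 a b d).
Proof.
move=> H; apply/matrixP=> i j.
have -> : diag_mx (diag3 a b d) i j =
    if (i == j :> nat) then nth 0 [:: a; b; d] i else 0.
  by rewrite mxE -val_eqE mxE /=; case: eqP => [->|]; rewrite ?mulr1n ?mulr0n.
rewrite -(H i j (ltn_ord i) (ltn_ord j)) mxE sum3 !mxE !sum3 !mxE /=; ring.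
Qed.

Lemma frame1P u v w : u != 0 -> 4 * u * v - c ^+ 2 * w ^+ 2 != 0 ->
  frame_for u v w (frame1 c u v w).1 (frame1 c u v w).2.
Proof.
move=> u0 A0; rewrite /frame1 /=; set A := _ - _ in A0 *; set T := mx_rows 3 3 _.
have n2 : (2 : F) != 0 by rewrite pnatr_eq0.
have n4 : (4 : F) != 0 by rewrite pnatr_eq0.
have uA : 4 * u ^+ 2 * A != 0 by rewrite !mulf_neq0 ?expf_neq0.
have uT : T \in unitmx.
  rewrite unitmxE det3 !mx_rows3E /= unitfE.
  by rewrite (_ : _ + _ = 4 * u ^+ 2 * A) //; ring.
split.
- apply: frame_of_diag => //.
  apply: mx_rows_diag => -[|[|[|//]]] [|[|[|//]]] _ _ /=; rewrite ?discrE /A; ring.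
- by rewrite unitmx_inv unitmx_tr.
- by rewrite mxE /= mulf_neq0.
- by rewrite mxE /= !mulf_neq0.
- by rewrite mxE /= mulf_eq0 (negPf uA).
Qed.

(** The determinant of P^T is -8 u^3 L; the point is that L does not vanish where the
    two minors do, which needs c^3 <> 8. *)
Lemma frame2P u v w : u != 0 -> c != 0 -> c ^+ 3 != 8 ->
    4 * u * v - c ^+ 2 * w ^+ 2 = 0 -> 4 * u * w - c ^+ 2 * v ^+ 2 = 0 ->
  frame_for u v w (frame2 c u v w).1 (frame2 c u v w).2.
Proof.
move=> u0 c0 c8 A0 A'0; rewrite /frame2 /=.
set Q0 := (w - v) * _; set Q1 := c ^+ 2 * v * w - _ + _ - _.
set Q2 := c ^+ 2 * w ^+ 2 + _ - _ - _; set L := Q1 + Q2; set T := mx_rows 3 3 _.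
have n2 : (2 : F) != 0 by rewrite pnatr_eq0.
have n4 : (4 : F) != 0 by rewrite pnatr_eq0.
have L0 : L != 0.
  have LE : L = 2 * c * (c * v * w - 2 * u ^+ 2) - (4 * u * v - c ^+ 2 * w ^+ 2)
                - (4 * u * w - c ^+ 2 * v ^+ 2) by rewrite /L /Q1 /Q2; ring.
  rewrite A0 A'0 !subr0 in LE; rewrite LE !mulf_neq0 // subr_eq0.
  apply: contra c8 => /eqP cvw; have u2 : u ^+ 2 != 0 by rewrite expf_neq0.
  (* The two vanishing minors give 16 u^2 v w = c^4 v^2 w^2; if moreover
     c v w = 2 u^2, this becomes 8 = c^3. *)
  have e : 16 * u ^+ 2 * (c * v * w) = c ^+ 3 * (c * v * w) ^+ 2.
    have -> : 16 * u ^+ 2 * (c * v * w) = c * (4 * u * v) * (4 * u * w) by ring.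
    by rewrite (subr0_eq A0) (subr0_eq A'0); ring.
  rewrite cvw in e; have /(mulfI u2)/(mulfI u2) : u ^+ 2 * (u ^+ 2 * c ^+ 3) = u ^+ 2 * (u ^+ 2 * 8).
    apply: (mulfI n4); have -> : 4 * (u ^+ 2 * (u ^+ 2 * c ^+ 3)) = c ^+ 3 * (2 * u ^+ 2) ^+ 2 by ring.
    by rewrite -e; ring.
  by move=> ->.
have uT : T \in unitmx.
  rewrite unitmxE det3 !mx_rows3E /= unitfE (_ : _ + _ = - (8 * u ^+ 3 * L)).
    by rewrite oppr_eq0 !mulf_neq0 ?expf_neq0 ?pnatr_eq0.
  by rewrite /L; ring.
split.
- apply: frame_of_diag => //.
  apply: mx_rows_diag => -[|[|[|//]]] [|[|[|//]]] _ _ /=; rewrite ?discrE /L /Q1 /Q2 /Q0; ring.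
- by rewrite unitmx_inv unitmx_tr.
- by rewrite mxE /= mulf_neq0.
- by rewrite mxE /= oppr_eq0 !mulf_neq0.
- rewrite mxE /= oppr_eq0 mulf_eq0 (_ : _ * L == 0 = false) //.
  by apply/negbTE; rewrite !mulf_neq0 ?expf_neq0 ?pnatr_eq0.
Qed.

Lemma frameP (c0 : c != 0) (c8 : c ^+ 3 != 8) (p : 'rV[F]_3) : p 0 0 != 0 ->
  frame_for (p 0 0) (p 0 1) (p 0 2) (Delta c p) (Pinv c p).
Proof.
rewrite /Delta /Pinv /frame; move: (p 0 0) (p 0 1) (p 0 2) => u v w u0.
case: ifPn => [A0|/negPn/eqP A0]; first exact: frame1P.
case: ifPn => [A'0|/negPn/eqP A'0]; last exact: frame2P.
have [fQ fU f0 f1 f2] := frame1P u0 A'0; split=> //=.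
- move=> i j; transitivity (formQ c u w v (tperm 1 2 i) (tperm 1 2 j)).
    by rewrite -fQ; apply: eq_bigr => k _; rewrite !mxE.
  rewrite !mx_rows3E; case: (ord3P i) => ->; case: (ord3P j) => ->;
    by rewrite ?tpermL ?tpermR ?tpermD.
- by rewrite xcolE unitmx_mul unitmx_perm andbT.
- rewrite f2 !discrE; congr (_ == _); ring.
Qed.

End Frames.

(** * Two by two matrices and the Pauli basis *)

Section TwoByTwo.
Variable F : numClosedFieldType.
Implicit Types (a b d e : F) (M : 'M[F]_2) (v : 'I_3 -> F).

Definition mx2 a b d e : 'M[F]_2 := mx_rows 2 2 [:: [:: a; b]; [:: d; e]].

Lemma ord2P (i : 'I_2) : i = 0 \/ i = 1.
Proof. by case: i => [[|[|//]]] lt; [left|right]; apply: val_inj. Qed.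

Lemma sum2 (V : nmodType) (f : 'I_2 -> V) : \sum_i f i = f 0 + f 1.
Proof.
by rewrite !big_ord_recl big_ord0 addr0; congr (f _ + f _); apply: val_inj.
Qed.

Lemma mx2P M : exists a b d e, M = mx2 a b d e.
Proof.
exists (M 0 0), (M 0 1), (M 1 0), (M 1 1); apply/matrixP=> i j.
by rewrite mxE; case: (ord2P i) => ->; case: (ord2P j) => ->.
Qed.

Lemma mx2_inj a b d e a' b' d' e' : mx2 a b d e = mx2 a' b' d' e' ->
  [/\ a = a', b = b', d = d' & e = e'].
Proof.
by move=> /matrixP H; split; [have:= H 0 0|have:= H 0 1|have:= H 1 0|have:= H 1 1];
   rewrite !mxE.
Qed.

Lemma mx2D a b d e a' b' d' e' :
  mx2 a b d e + mx2 a' b' d' e' = mx2 (a + a') (b + b') (d + d') (e + e').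
Proof.
by apply/matrixP=> i j; rewrite !mxE; case: (ord2P i) => ->; case: (ord2P j) => ->.
Qed.

Lemma mx2Z k a b d e : k *: mx2 a b d e = mx2 (k * a) (k * b) (k * d) (k * e).
Proof.
by apply/matrixP=> i j; rewrite !mxE; case: (ord2P i) => ->; case: (ord2P j) => ->.
Qed.

Lemma mx2N a b d e : - mx2 a b d e = mx2 (- a) (- b) (- d) (- e).
Proof.
by apply/matrixP=> i j; rewrite !mxE; case: (ord2P i) => ->; case: (ord2P j) => ->.
Qed.

Lemma mx2M a b d e a' b' d' e' : mx2 a b d e * mx2 a' b' d' e' =
  mx2 (a * a' + b * d') (a * b' + b * e') (d * a' + e * d') (d * b' + e * e').
Proof.
apply/matrixP=> i j; rewrite !mxE sum2 !mxE.
by case: (ord2P i) => ->; case: (ord2P j) => ->.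
Qed.

Lemma mx2_scalar a : a%:M = mx2 a 0 0 a.
Proof.
apply/matrixP=> i j; rewrite !mxE.
by case: (ord2P i) => ->; case: (ord2P j) => ->; rewrite /= ?mulr1n ?mulr0n.
Qed.

Lemma mx2_one : 1 = mx2 1 0 0 1.
Proof. exact: mx2_scalar. Qed.

Lemma mx2_zero : 0 = mx2 0 0 0 0.
Proof. by rewrite -mx2_scalar raddf0. Qed.

Lemma mx2_tr a b d e : \tr (mx2 a b d e) = a + e.
Proof. by rewrite /mxtrace sum2 !mxE. Qed.

Definition mx2E := (mx2D, mx2Z, mx2N, mx2M, mx2_scalar, mx2_one, mx2_zero, mx2_tr).

Lemma traceless2P M : \tr M = 0 -> exists a b d, M = mx2 a b d (- a).
Proof.
have [a [b [d [e ->]]]] := mx2P M; rewrite mx2_tr => /eqP.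
by rewrite addrC addr_eq0 => /eqP->; exists a, b, d.
Qed.

Lemma traceless_sq M : \tr M = 0 -> exists t, M ^+ 2 = t%:M.
Proof.
move=> /traceless2P [a [b [d ->]]]; exists (a ^+ 2 + b * d).
by rewrite expr2 !mx2E; congr mx2; ring.
Qed.

(** The adjugate reverses products and changes the sign of traceless matrices, so
    - Z Y X is the adjugate of X Y Z, and a matrix plus its adjugate is its trace. *)
Lemma traceless_alt (X Y Z : 'M[F]_2) : \tr X = 0 -> \tr Y = 0 -> \tr Z = 0 ->
  X * Y * Z - Z * Y * X = (\tr (X * Y * Z))%:M.
Proof.
move=> /traceless2P [a [b [d ->]]] /traceless2P [a' [b' [d' ->]]].
move=> /traceless2P [a'' [b'' [d'' ->]]].
by rewrite !mx2E; congr mx2; ring.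
Qed.

(** In the Pauli basis the trace of X Y Z is a multiple of the determinant of the three
    coordinate vectors, whose square is a Gram determinant. *)
Lemma traceless_gram (X Y Z : 'M[F]_2) :
  \tr X = 0 -> \tr Y = 0 -> \tr Z = 0 ->
  let g A B := \tr (A * B) in
  2 * \tr (X * Y * Z) ^+ 2 =
  - (g X X * (g Y Y * g Z Z - g Y Z ^+ 2) - g X Y * (g X Y * g Z Z - g Y Z * g X Z)
     + g X Z * (g X Y * g Y Z - g Y Y * g X Z)).
Proof.
move=> /traceless2P [a [b [d ->]]] /traceless2P [a' [b' [d' ->]]].
move=> /traceless2P [a'' [b'' [d'' ->]]] /=.
by rewrite !mx2E; ring.
Qed.

Lemma sigma0E : sigma F 0 = mx2 0 1 1 0. Proof. by []. Qed.
Lemma sigma1E : sigma F 1 = mx2 0 'i (- 'i) 0. Proof. by []. Qed.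
Lemma sigma2E : sigma F 2 = mx2 1 0 0 (-1). Proof. by []. Qed.
Definition sigmaE := (sigma0E, sigma1E, sigma2E).

Definition pauli (b : 'I_3 -> F) : 'M[F]_2 :=
  b 0 *: sigma F 0 + b 1 *: sigma F 1 + b 2 *: sigma F 2.

Lemma pauliE v : pauli v = mx2 (v 2) (v 0 + v 1 * 'i) (v 0 - v 1 * 'i) (- v 2).
Proof. by rewrite /pauli !sigmaE !mx2E; congr mx2; ring. Qed.

Lemma imaginary_sq : 'i * 'i = -1 :> F.
Proof. by rewrite -expr2 sqrCi. Qed.

Lemma pauli_anticomm v w :
  pauli v * pauli w + pauli w * pauli v = (2 * \sum_k v k * w k)%:M.
Proof. by rewrite !pauliE sum3 !mx2E; congr mx2; ring: imaginary_sq. Qed.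

Lemma pauli_trace v : \tr (pauli v) = 0.
Proof. by rewrite pauliE mx2_tr subrr. Qed.

(** The change of sign that passes from psi_+ to psi_-; as a reflection it reverses the
    sign of the trace of a triple product. *)
Definition flip3 v : 'I_3 -> F := fun k => (-1) ^+ (k == 2) * v k.

Lemma pauli_triple_flip v v' v'' :
  \tr (pauli (flip3 v) * pauli (flip3 v') * pauli (flip3 v'')) =
  - \tr (pauli v * pauli v' * pauli v'').
Proof. by rewrite !pauliE /flip3 /= !mx2E; ring: imaginary_sq. Qed.

Lemma anticomm_sigma M : M * sigma F 0 + sigma F 0 * M = 0 ->
  M * sigma F 1 + sigma F 1 * M = 0 -> exists a, M = a *: sigma F 2.
Proof.
have [a [b [d [e ->]]]] := mx2P M; rewrite !sigmaE !mx2E.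
move=> /mx2_inj [bd ae _ _] /mx2_inj [db _ _ _]; exists a.
have e0 : e = - a by apply/eqP; rewrite -addr_eq0; apply/eqP; rewrite -ae; ring.
have d0 : d = - b by apply/eqP; rewrite -addr_eq0; apply/eqP; rewrite -bd; ring.
have b0 : b = 0.
  have : 2 * 'i * b = 0 by rewrite -[RHS]oppr0 -db d0; ring.
  move/eqP; rewrite !mulf_eq0 pnatr_eq0 (negPf (neq0Ci _)) /=.
  by move/eqP.
by rewrite mx2Z d0 e0 b0 oppr0; congr mx2; ring.
Qed.

Lemma mx2_col a b d e (r s : 'rV[F]_2) :
  mx2 a b d e * (col_mx r s : 'M_(1 + 1, 2)) =
  (col_mx (a *: r + b *: s) (d *: r + e *: s) : 'M_(1 + 1, 2)).
Proof.
have E0 (p q : 'rV[F]_2) j : (col_mx p q : 'M_(1 + 1, 2)) (0 : 'I_2) j = p ord0 j.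
  by rewrite (_ : 0 = lshift 1 (ord0 : 'I_1)) ?col_mxEu //; apply: val_inj.
have E1 (p q : 'rV[F]_2) j : (col_mx p q : 'M_(1 + 1, 2)) (1 : 'I_2) j = q ord0 j.
  by rewrite (_ : 1 = rshift 1 (ord0 : 'I_1)) ?col_mxEd //; apply: val_inj.
apply/matrixP=> i j; rewrite [LHS]mxE sum2 !E0 !E1.
by case: (ord2P i) => ->; rewrite ?E0 ?E1 !mxE.
Qed.

(** The matrix C = i A B is an involution which anticommutes with A. If the row v is
    fixed by C, then v A is negated by C, and in the basis v, v A the matrices A and C
    are the first and the third Pauli matrices; B = - i A C is then the second. *)
Lemma pauli_pair (A B : 'M[F]_2) : A ^+ 2 = 1 -> B ^+ 2 = 1 -> A * B + B * A = 0 ->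
  exists2 h : 'M[F]_2, h \in unitmx & h * A = sigma F 0 * h /\ h * B = sigma F 1 * h.
Proof.
move=> A2 B2 AB; pose C := 'i *: (A * B).
have BA : B * A = - (A * B) by apply/eqP; rewrite -addr_eq0 addrC AB.
have CA : C * A = - (A * C).
  by rewrite /C -scalerAl -scalerAr -mulrA BA mulrN mulrA -scalerN.
have AC : A * C = - (C * A) by rewrite CA opprK.
have C2 : C ^+ 2 = 1.
  rewrite expr2 /C -scalerAl -scalerAr scalerA imaginary_sq -mulrA [B * _]mulrA BA.
  by rewrite mulNr -mulrA -expr2 B2 mulr1 mulrN -expr2 A2 scaleN1r opprK.
have [i vi] : exists i, row i (1 + C) != 0.
  apply/existsP; apply: contraT; rewrite negb_exists => /forallP all0.
  have C1 : C = -1.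
    apply/eqP; rewrite -subr_eq0 opprK addrC; apply/eqP/row_matrixP=> i.
    by have := all0 i; rewrite negbK => /eqP ->; rewrite row0.
  have := CA; rewrite C1 mulN1r mulrN1 opprK => /eqP.
  rewrite eq_sym -subr_eq0 opprK -mulr2n -scaler_nat scaler_eq0 pnatr_eq0 /= => /eqP A0.
  by have := A2; rewrite A0 expr0n /= => /eqP; rewrite eq_sym oner_eq0.
set v := row i (1 + C) in vi.
have vC : v *m C = v.
  by rewrite /v -row_mul mulmxDl mul1mx -[C *m C]expr2 C2 addrC.
pose h : 'M[F]_2 := col_mx v (v *m A).
have hC : h *m C = col_mx v (- (v *m A)).
  by rewrite [LHS](mul_col_mx v (v *m A) C) vC -mulmxA [A *m C]AC mulmxN mulmxA vC.
exists h.
  rewrite unitmxE unitfE; apply/det0P => -[w w0 wh].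
  pose w' : 'M_(1, 1 + 1) := w; pose a := lsubmx w' 0 0; pose b := rsubmx w' 0 0.
  have wE : w' = row_mx a%:M b%:M by rewrite -!mx11_scalar hsubmxK.
  have ab : a *: v + b *: (v *m A) = 0.
    by rewrite -!mul_scalar_mx -mul_row_col -wE.
  have ab' : a *: v - b *: (v *m A) = 0.
    move/(congr1 (mulmx^~ C)): ab; rewrite mul0mx mulmxDl -!scalemxAl vC.
    by rewrite -mulmxA [A *m C]AC mulmxN mulmxA vC scalerN.
  have a0 : a = 0.
    have : 2 *: (a *: v) = 0 by rewrite -[RHS](addr0 0) -{1}ab -ab' addrACA subrr addr0 scaler_nat.
    by move/eqP; rewrite !scaler_eq0 pnatr_eq0 (negPf vi) orbF /= => /eqP.
  have b0 : b = 0.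
    move: ab; rewrite a0 scale0r add0r => /(congr1 (mulmx^~ A)).
    rewrite mul0mx -scalemxAl -mulmxA -[A *m A]expr2 A2 mulmx1 => /eqP.
    by rewrite scaler_eq0 (negPf vi) orbF => /eqP.
  by move/eqP: w0; apply; rewrite -[w]/w' wE a0 b0 !raddf0 row_mx0.
have hA : h * A = sigma F 0 * h.
  rewrite sigmaE /h mx2_col !scale0r !scale1r addr0 add0r.
  by rewrite [LHS](mul_col_mx v (v *m A) A) -mulmxA -[A *m A]expr2 A2 mulmx1.
split=> //; have -> : B = - 'i *: (A * C).
  by rewrite /C -scalerAr scalerA mulNr imaginary_sq opprK scale1r mulrA -expr2 A2 mul1r.
have hC' : h * C = sigma F 2 * h.
  by rewrite sigmaE /h mx2_col !scale0r !scale1r addr0 add0r scaleN1r -hC.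
rewrite -scalerAr mulrA hA -mulrA hC' mulrA scalerAl; congr (_ * h).
by rewrite !sigmaE !mx2E; congr mx2; ring.
Qed.

End TwoByTwo.

(** * Triples with anticommutators given by the form *)

Section CliffordTriples.
Variables (F : numClosedFieldType) (c : F).
Hypotheses (c0 : c != 0) (c8 : c ^+ 3 != 8).
Variable sq : 'rV[F]_3 -> 'rV[F]_3.
Hypothesis sqE : forall p : 'rV[F]_3, p 0 0 != 0 -> forall j, sq p 0 j ^+ 2 = Delta c p 0 j.
Implicit Types (p : 'rV[F]_3) (X : 'I_3 -> 'M[F]_2).

Definition form_at p : 'M[F]_3 := formQ c (p 0 0) (p 0 1) (p 0 2).

Definition clifford X p :=
  forall i j, X i * X j + X j * X i = (2 * form_at p i j)%:M.

Definition psi_vec p (eps : bool) (i : 'I_3) : 'I_3 -> F :=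
  fun k => (-1) ^+ (eps && (k == 2)) * (Pinv c p k i * sq p 0 k).

Lemma psi_pauli p eps i : psi c sq p eps i = pauli (psi_vec p eps i).
Proof.
rewrite /psi /pauli /psi_vec !andbF !mul1r andbT.
by [].
Qed.

Lemma psi_triple_flip p i j k :
  \tr (psi c sq p true i * psi c sq p true j * psi c sq p true k) =
  - \tr (psi c sq p false i * psi c sq p false j * psi c sq p false k).
Proof.
have flip l : psi_vec p true l = flip3 (psi_vec p false l).
  by apply: boolp.funext => n; rewrite /flip3 /psi_vec /= mul1r.
by rewrite !psi_pauli !flip pauli_triple_flip.
Qed.

Lemma psi_clifford p eps : p 0 0 != 0 -> clifford (psi c sq p eps) p.
Proof.
move=> p0 i j; rewrite !psi_pauli pauli_anticomm; congr (2 * _)%:M.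
have [<- _ _ _ _] := frameP c0 c8 p0; apply: eq_bigr => k _.
rewrite /psi_vec mulrACA -signr_addb addbb mul1r mulrACA -expr2 sqE //.
Qed.

(** The combinations Y_k of the X_i by the columns of P anticommute and have squares
    Delta_k. The first two are invertible and can be conjugated to the first two Pauli
    matrices; the third is then determined up to sign. *)
Lemma clifford_psi X p : p 0 0 != 0 -> clifford X p ->
  exists eps, exists2 g, g \in unitmx & forall i, g * X i = psi c sq p eps i * g.
Proof.
move=> p0 XX; have [BQ uB D0 D1 _] := frameP c0 c8 p0.
set B := Pinv c p in BQ uB; set D := Delta c p in BQ D0 D1.
pose P := invmx B; pose s k := sq p 0 k.
have sE k : s k ^+ 2 = D 0 k by apply: sqE.
have s_neq0 k : D 0 k != 0 -> s k != 0 by rewrite -sE expf_eq0.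
pose Y k := \sum_i P i k *: X i.
have PB m n : \sum_k P m k * B k n = (m == n)%:R.
  by have /matrixP/(_ m n) := mulVmx uB; rewrite !mxE.
have XY i : X i = \sum_k B k i *: Y k.
  transitivity (\sum_j (\sum_k P j k * B k i) *: X j).
    rewrite (bigD1 i) //= PB eqxx scale1r big1 ?addr0 // => j ji.
    by rewrite PB (negPf ji) scale0r.
  under eq_bigr do rewrite scaler_suml.
  rewrite exchange_big; apply: eq_bigr => k _; rewrite /Y scaler_sumr.
  by apply: eq_bigr => j _; rewrite scalerA mulrC.
have YY k l : Y k * Y l + Y l * Y k = (2 * ((k == l)%:R * D 0 k))%:M.
  have PQP : P^T *m form_at p *m P = diag_mx D.
    have -> : form_at p = B^T *m diag_mx D *m B.
      apply/matrixP=> i j; rewrite -BQ mxE; apply: eq_bigr => m _.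
      rewrite mxE (bigD1 m) //= big1 ?addr0 => [|n /negPf nm].
        by rewrite !mxE eqxx mulr1n mulrAC.
      by rewrite !mxE nm mulr0n mulr0.
    by rewrite !mulmxA -trmx_mul (mulmxV uB) trmx1 mul1mx -mulmxA mulmxV ?mulmx1.
  have Pkl : \sum_i \sum_j P i k * P j l * form_at p i j = (k == l)%:R * D 0 k.
    rewrite mulr_natl; have /matrixP/(_ k l) := PQP; rewrite !mxE => <-.
    rewrite exchange_big; apply: eq_bigr => j _; rewrite mxE mulr_suml.
    by apply: eq_bigr => i _; rewrite [P^T _ _]mxE mulrAC.
  transitivity (\sum_i \sum_j (P i k * P j l) *: (X i * X j + X j * X i)).
    rewrite /Y; under [RHS]eq_bigr do under eq_bigr do rewrite scalerDr.
    under [RHS]eq_bigr do rewrite big_split; rewrite big_split /=; congr (_ + _).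
      rewrite mulr_suml; apply: eq_bigr => i _; rewrite mulr_sumr.
      by apply: eq_bigr => j _; rewrite -scalerAl -scalerAr scalerA.
    rewrite exchange_big mulr_suml; apply: eq_bigr => i _; rewrite mulr_sumr.
    by apply: eq_bigr => j _; rewrite -scalerAl -scalerAr scalerA mulrC.
  rewrite -Pkl mulr_sumr raddf_sum; apply: eq_bigr => i _.
  rewrite mulr_sumr raddf_sum; apply: eq_bigr => j _.
  by rewrite XX scale_scalar_mx mulrCA.
have Y2 k : Y k ^+ 2 = (D 0 k)%:M.
  have := YY k k; rewrite eqxx mul1r -mulr2n -expr2 => YYk.
  have n2 : (2 : F) != 0 by rewrite pnatr_eq0.
  by apply: (scalerI n2); rewrite scaler_nat YYk scale_scalar_mx.
have s0 := s_neq0 _ D0; have s1 := s_neq0 _ D1.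
pose A := (s 0)^-1 *: Y 0; pose A' := (s 1)^-1 *: Y 1.
have [] := @pauli_pair F A A'.
- by rewrite exprZn Y2 scale_scalar_mx -sE exprVn mulVf // expf_neq0.
- by rewrite exprZn Y2 scale_scalar_mx -sE exprVn mulVf // expf_neq0.
- by rewrite /A /A' -!scalerAl -!scalerAr !scalerA [_^-1 * _]mulrC -scalerDr YY mul0r mulr0 raddf0 scaler0.
move=> h uh [hA hA'].
have hY0 : h * Y 0 = s 0 *: (sigma F 0 * h) by rewrite -hA -scalerAr scalerA mulfV ?scale1r.
have hY1 : h * Y 1 = s 1 *: (sigma F 1 * h) by rewrite -hA' -scalerAr scalerA mulfV ?scale1r.
have [N hN] : exists N, h * Y 2 = N * h by exists (h * Y 2 * h^-1); rewrite mulrVK.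
have [b Nb] : exists b, N = b *: sigma F 2.
  have half k : s k != 0 -> h * Y k = s k *: (sigma F k * h) -> k != 2 ->
      N * sigma F k + sigma F k * N = 0.
    move=> sk0 hYk k2.
    have e : N * (s k *: (sigma F k * h)) + s k *: (sigma F k * h) * Y 2 = 0.
      rewrite -hYk [N * _]mulrA -hN -!mulrA -mulrDr YY.
      by rewrite eq_sym (negPf k2) mul0r mulr0 raddf0 mulr0.
    apply: (mulIr uh); apply: (scalerI sk0); rewrite mul0r scaler0 -[RHS]e.
    by rewrite mulrDl -!mulrA -hN scalerDr -scalerAr -scalerAl -mulrA.
  by apply: anticomm_sigma; apply: half.
have b2 : b ^+ 2 = s 2 ^+ 2.
  have : N ^+ 2 = (D 0 2)%:M.
    apply: (mulIr uh); rewrite expr2 -mulrA -hN mulrA -hN -mulrA -expr2 Y2.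
    by rewrite -[_ * h]/(_ *m h) -[h * _]/(h *m _) mul_scalar_mx mul_mx_scalar.
  rewrite Nb sigmaE mx2Z expr2 mx2M mx2_scalar => /mx2_inj [bb _ _ _].
  by rewrite sE -bb; ring.
have [eps bE] : exists eps : bool, b = (-1) ^+ eps * s 2.
  move/eqP: b2; rewrite eqf_sqr => /orP[] /eqP ->.
    by exists false; rewrite mul1r.
  by exists true; rewrite mulN1r.
exists eps, h => // i; rewrite XY sum3 !mulrDr -!scalerAr hY0 hY1 hN Nb bE.
rewrite /psi !mulrDl -!scalerAl !scalerA; congr (_ + _ *: _).
by rewrite mulrCA.
Qed.

End CliffordTriples.

(** * Two-dimensional representations and their traces *)

Section RepresentationTheory.
Variables (F : numClosedFieldType) (c : F).
Hypotheses (c0 : c != 0) (c1 : c ^+ 3 != -1) (c8 : c ^+ 3 != 8).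
Local Notation S := (sklyanin c).
Local Notation x := (sk_gen c).
Local Notation ev := (sk_ev c1).
Local Notation alt := (sk_alt c).
Local Notation rep := {lrmorphism S -> 'M[F]_2}.
Local Notation mval t r := (mpoly.meval t r).
Implicit Types (rho : rep) (t : 'I_3 -> F) (g : F).

Lemma sk_intertwine (A : algType F) (rho rho' : {lrmorphism S -> A}) h :
  (forall i, h * rho (x i) = rho' (x i) * h) -> forall a, h * rho a = rho' a * h.
Proof.
move=> hx a; elim/sk_ind: a => [|a b IHa IHb|k a IH|i a IH].
- by rewrite !rmorph1 mulr1 mul1r.
- by rewrite !rmorphD mulrDl mulrDr IHa IHb.
- by rewrite !linearZ -scalerAl -scalerAr IH.
- by rewrite !rmorphM mulrA hx -mulrA IH mulrA.
Qed.

Lemma sk_rel_distinct i j k : i != j -> k != i -> k != j ->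
  x i * x j + x j * x i = c *: x k ^+ 2.
Proof.
have yx := etrans (addrC _ _) (@sk_relXY F c).
have zy := etrans (addrC _ _) (@sk_relYZ F c).
have xz := etrans (addrC _ _) (@sk_relZX F c).
by case: (ord3P i) => ->; case: (ord3P j) => ->; case: (ord3P k) => -> //= _ _ _;
  rewrite ?sk_relXY ?sk_relYZ ?sk_relZX ?yx ?zy ?xz.
Qed.

Lemma third_index (i j : 'I_3) : i != j -> exists2 k : 'I_3, k != i & k != j.
Proof.
by case: (ord3P i) => ->; case: (ord3P j) => -> // _;
   [exists 2|exists 1|exists 2|exists 0|exists 1|exists 0].
Qed.

Lemma form_at_diag p i : form_at c p i i = 2 * p 0 i.
Proof. by rewrite mxE; case: (ord3P i) => ->. Qed.

Lemma form_at_off p i j k : i != j -> k != i -> k != j -> form_at c p i j = c * p 0 k.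
Proof.
by rewrite mxE; case: (ord3P i) => ->; case: (ord3P j) => ->; case: (ord3P k) => ->.
Qed.

Lemma clifford_sq X p i : clifford c X p -> X i ^+ 2 = (2 * p 0 i)%:M.
Proof.
move=> /(_ i i); rewrite form_at_diag -mulr2n -expr2 => XX.
have n2 : (2 : F) != 0 by rewrite pnatr_eq0.
by apply: (scalerI n2); rewrite scaler_nat XX scale_scalar_mx.
Qed.

(** The permutation s serves the members of the family with permuted variables. *)
Lemma clifford_rep X p (s : 'S_3) : clifford c X p ->
  exists rho : rep, forall i, rho (x (s i)) = X i.
Proof.
move=> XX; pose M i := X ((s^-1)%g i).
have rel i j k : i != j -> k != i -> k != j -> M i * M j + M j * M i = c *: M k ^+ 2.
  move=> ij ki kj; rewrite /M XX (clifford_sq _ XX) scale_scalar_mx mulrCA.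
  by rewrite (@form_at_off _ _ _ ((s^-1)%g k)) ?(inj_eq perm_inj).
have [rho rhoM] := sklyanin_lift (rel 0 1 2 isT isT isT) (rel 1 2 0 isT isT isT)
  (rel 2 0 1 isT isT isT).
by exists rho => i; rewrite rhoM /M permK.
Qed.

(** The points of affine space are rescaled by 2: psi at p makes x_i ^ 2 act by 2 p_i. *)
Lemma rep_clifford rho t (s : 'S_3) : (forall i, rho (x i ^+ 2) = (t i)%:M) ->
  clifford c (fun i => rho (x (s i))) (\row_i (t (s i) / 2)).
Proof.
move=> rt i j; have n2 : (2 : F) != 0 by rewrite pnatr_eq0.
have [<-|ij] := eqVneq i j.
  have rt2 : rho (x (s i)) * rho (x (s i)) = (t (s i))%:M by rewrite -rt rmorphXn.
  by rewrite rt2 -mulr2n -scaler_nat scale_scalar_mx form_at_diag mxE; congr (_%:M); field.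
have [k ki kj] := third_index ij.
transitivity (rho (x (s i) * x (s j) + x (s j) * x (s i))).
  by rewrite rmorphD !rmorphM.
rewrite (form_at_off _ ij ki kj) mxE (@sk_rel_distinct _ _ (s k)) ?(inj_eq perm_inj) // linearZ /= rt scale_scalar_mx.
by congr (_%:M); field.
Qed.

Definition surjective_rep rho := forall M, exists a, rho a = M.

Lemma surjective_simple rho : surjective_rep rho -> simple_rep rho.
Proof.
move=> sur V VV; have [->|V0] := eqVneq V 0%VS; first by left.
right; apply/vspaceP=> w; rewrite memvf.
have v0 := vpick0 V; set v := vpick V in v0; rewrite (negPf V0) in v0.
have [j vj] : exists j, v j 0 != 0.
  apply/existsP; apply: contraFT v0; rewrite negb_exists => /forallP v0.
  apply/eqP/matrixP=> i k; rewrite (ord1 k) mxE.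
  by have := v0 i; rewrite negbK => /eqP.
have [a aE] := sur (w *m ((v j 0)^-1 *: delta_mx 0 j)).
have := VV a v (memv_pick V); rewrite aE -mulmxA -scalemxAl.
have -> : delta_mx 0 j *m v = (v j 0)%:M.
  apply/matrixP=> i k; rewrite !ord1 -rowE !mxE eqxx mulr1n //.
by rewrite scale_scalar_mx mulVf // mulmx1.
Qed.

Lemma invariant_gen rho (V : {vspace 'cV[F]_2}) :
  (forall i v, v \in V -> rho (x i) *m v \in V) ->
  forall a v, v \in V -> rho a *m v \in V.
Proof.
move=> VV a; elim/sk_ind: a => [|a b IHa IHb|k a IH|i a IH] v vV.
- by rewrite rmorph1 mul1mx.
- by rewrite rmorphD mulmxDl rpredD ?IHa ?IHb.
- by rewrite linearZ -scalemxAl rpredZ ?IH.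
- by rewrite rmorphM -mulmxA VV ?IH.
Qed.

Lemma mx_ker_full (N : 'M[F]_2) : lker (linfun (mulmx N : 'cV_2 -> 'cV_2)) = fullv ->
  N = 0.
Proof.
move=> full; apply/matrixP=> i j; rewrite mxE.
have : delta_mx j 0 \in lker (linfun (mulmx N : 'cV_2 -> 'cV_2)) by rewrite full memvf.
rewrite memv_ker lfunE /= -colE => /eqP/matrixP/(_ i 0).
by rewrite !mxE.
Qed.

(** Schur's lemma: an eigenspace of a central element is invariant. *)
Lemma simple_central rho (z : center S) : simple_rep rho ->
  exists k, rho (val z) = k%:M.
Proof.
move=> sim; set N := rho (val z).
have [k [v vN v0]] : exists k, exists2 v : 'rV[F]_2, v *m N^T = k *: v & v != 0.
  have /closed_rootP [k] : size (char_poly N^T) != 1 by rewrite size_char_poly.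
  by rewrite -eigenvalue_root_char => /eigenvalueP kN; exists k.
exists k; apply/eqP; rewrite -subr_eq0; apply/eqP/mx_ker_full.
set V := lker _; have [V0|//] : V = 0%VS \/ V = fullv.
  apply: sim => a w; rewrite !memv_ker !lfunE /= => /eqP Nw; apply/eqP.
  rewrite mulmxA; have -> : (N - k%:M) *m rho a = rho a *m (N - k%:M).
    rewrite mulmxBl mulmxBr -scalar_mxC; congr (_ - _).
    by rewrite -[LHS]rmorphM central_comm rmorphM.
  by rewrite -mulmxA Nw mulmx0.
have : v^T \in V.
  rewrite memv_ker lfunE /= mulmxBl mul_scalar_mx -linearZ /= -vN trmx_mul trmxK.
  by rewrite subrr.
by rewrite V0 memv0 trmx_eq0 (negPf v0).
Qed.

(** The square of the alternating cubic at the point t, namely - 1/2 det Q(t). *)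
Definition alt_sq_val t : F :=
  c ^+ 2 * (t 0 ^+ 3 + t 1 ^+ 3 + t 2 ^+ 3) - (4 + c ^+ 3) * (t 0 * t 1 * t 2).

(** The data of a representation which only depend on its central character: (t, g)
    are the coordinates of the point below it. *)
Definition sk_char rho t g :=
  [/\ forall i, \tr (rho (x i)) = 0, forall i, rho (x i ^+ 2) = (t i)%:M
    & rho alt = g%:M].

Lemma rep_ev rho t r : (forall i, rho (x i ^+ 2) = (t i)%:M) ->
  rho (ev r) = (mval t r)%:M.
Proof.
move=> rt; elim/mpoly.mpolyind: r => [|k m r _ _ IH]; first by rewrite !raddf0.
rewrite !rmorphD /= IH; congr (_ + _).
rewrite !linearZ /= mpoly.mevalX -scale_scalar_mx; congr (_ *: _).
rewrite mpoly.mpolyXE_id !rmorph_prod; apply: eq_bigr => i _.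
by rewrite !rmorphXn /= sk_evX -rt rmorphXn.
Qed.

Lemma tr_scalarM k (M : 'M[F]_2) : \tr (k%:M * M) = k * \tr M.
Proof. by rewrite -[_ * M]/(_ *m M) mul_scalar_mx mxtraceZ. Qed.

Lemma mxtraceC (M N : 'M[F]_2) : \tr (M * N) = \tr (N * M).
Proof. exact: mxtrace_mulC. Qed.

Section Character.
Variables (rho : rep) (t : 'I_3 -> F) (g : F).
Hypothesis rho_tg : sk_char rho t g.
Local Notation X i := (rho (x i)).

Lemma char_sq i : X i ^+ 2 = (t i)%:M.
Proof. by have [_ <- _] := rho_tg; rewrite rmorphXn. Qed.

Lemma char_tr i : \tr (X i) = 0.
Proof. by have [] := rho_tg. Qed.

Lemma char_pair i j : \tr (X i * X j) = formQ c (t 0) (t 1) (t 2) i j.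
Proof.
have [_ rt _] := rho_tg; have n2 : (2 : F) != 0 by rewrite pnatr_eq0.
have XX := rep_clifford 1%g rt i j; rewrite !perm1 in XX.
have := congr1 mxtrace XX; rewrite mxtraceD mxtrace_scalar [\tr (X j * _)]mxtrace_mulC.
rewrite -!mulr2n -[LHS]mulr_natl -[RHS]mulr_natl => /(mulfI n2) ->.
rewrite /form_at !mxE; case: (ord3P i) => ->; case: (ord3P j) => ->; rewrite /= !perm1; by field.
Qed.

Lemma char_triple i : \tr (X i * X (i + 1) * X (i + 1 + 1)) = g.
Proof.
have [_ _] := rho_tg; rewrite (sk_alt_cyclic c1 i) rmorphB !rmorphM.
by rewrite traceless_alt ?char_tr // !mx2_scalar => /mx2_inj [].
Qed.

Lemma char_trace : \tr (X 0 * X 1 * X 2) = g.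
Proof. by rewrite -(char_triple 0); congr (\tr (_ * X _ * X _)); apply: val_inj. Qed.

Lemma char_gamma : g ^+ 2 = alt_sq_val t.
Proof.
have n2 : (2 : F) != 0 by rewrite pnatr_eq0.
apply: (mulfI n2); rewrite -char_trace.
by rewrite traceless_gram ?char_tr // !char_pair !mxE /= /alt_sq_val; ring.
Qed.

Lemma char_normal r a b q : rho (sk_normal c1 r a b q) =
  (mval t r)%:M + \sum_i mval t (a i) *: X i
  + \sum_i mval t (b i) *: (X (i + 1) * X (i + 1 + 1)) + (mval t q * g)%:M.
Proof.
have [_ rt rg] := rho_tg.
have evM s a' : rho (ev s * a') = mval t s *: rho a'.
  by rewrite rmorphM /= (rep_ev _ rt); apply: mul_scalar_mx.
rewrite /sk_normal !rmorphD /= evM rg (rep_ev _ rt) scale_scalar_mx.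
congr (_ + _ + _ + _); rewrite rmorph_sum; apply: eq_bigr => i _; rewrite /= evM //.
by rewrite rmorphM.
Qed.

Lemma char_normal_tr r a b q : \tr (rho (sk_normal c1 r a b q)) =
  2 * mval t r + c * \sum_i mval t (b i) * t i + 2 * (mval t q * g).
Proof.
have tr0 : \tr (\sum_i mval t (a i) *: X i) = 0.
  by rewrite raddf_sum big1 // => i _ /=; rewrite mxtraceZ char_tr mulr0.
rewrite char_normal !mxtraceD tr0 addr0 !mxtrace_scalar ![2 * _]mulr_natl.
congr (_ + _ + _).
rewrite raddf_sum mulr_sumr; apply: eq_bigr => i _ /=.
rewrite mxtraceZ char_pair [RHS]mulrCA; congr (_ * _).
by rewrite mxE; case: (ord3P i) => ->.
Qed.

(** The traces against the generators pick out the coefficients a and b: 1 and the alternating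
    cubic contribute nothing, and X_(i+1) X_(i+2) X_l has trace g for i = l, while for
    i <> l a scalar square comes out and leaves a traceless generator. *)
Lemma char_normal_tr_gen r a b q l : \tr (rho (sk_normal c1 r a b q) * X l) =
  \sum_i mval t (a i) * formQ c (t 0) (t 1) (t 2) i l + mval t (b l) * g.
Proof.
rewrite char_normal !mulrDl ![in LHS]mulr_suml !mxtraceD !tr_scalarM.
rewrite char_tr !mulr0 add0r addr0; congr (_ + _); rewrite raddf_sum /=.
  by apply: eq_bigr => i _; rewrite -scalerAl mxtraceZ char_pair.
have sqM i M : X i * (X i * M) = t i *: M.
  by rewrite mulrA -expr2 char_sq; apply: mul_scalar_mx.
rewrite (bigD1 l) //= big1 ?addr0 => [|i il]; rewrite -scalerAl mxtraceZ.
  by rewrite mxtraceC mulrA char_triple.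
case: (ord3_cyclic i l) il => ->; rewrite ?eqxx // => _.
  by rewrite mxtraceC sqM mxtraceZ char_tr !mulr0.
by rewrite -mulrA -expr2 char_sq mxtraceC tr_scalarM char_tr !mulr0.
Qed.

End Character.

Lemma traceless_char rho : (forall i, \tr (rho (x i)) = 0) -> exists t g, sk_char rho t g.
Proof.
move=> tr0.
have /boolp.choice [t rt] : forall i, exists u, rho (x i ^+ 2) = u%:M.
  by move=> i; have [u] := traceless_sq (tr0 i); exists u; rewrite rmorphXn.
exists t, (\tr (rho (x 0) * rho (x 1) * rho (x 2))); split=> //.
by rewrite sk_alt.unlock rmorphB !rmorphM /= traceless_alt ?tr0.
Qed.

End RepresentationTheory.

(** * The center as a free module of rank two *)

HB.lock Definition alt_sq_poly (F : numClosedFieldType) (c : F) : mpoly.mpoly 3 F :=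
  let T i := mpoly.mpolyX F (mpoly.mnm1 i) in
  c ^+ 2 *: (T 0 ^+ 3 + T 1 ^+ 3 + T 2 ^+ 3) - (4 + c ^+ 3) *: (T 0 * T 1 * T 2).

Section CenterStructure.
Variables (F : numClosedFieldType) (c : F).
Hypotheses (c0 : c != 0) (c1 : c ^+ 3 != -1) (c8 : c ^+ 3 != 8).
Local Notation S := (sklyanin c).
Local Notation x := (sk_gen c).
Local Notation ev := (sk_ev c1).
Local Notation alt := (sk_alt c).
Local Notation rep := {lrmorphism S -> 'M[F]_2}.
Local Notation mval t r := (mpoly.meval t r).
Implicit Types (rho : rep) (t : 'I_3 -> F) (g : F).

(** Since Delta_1 and Delta_2 are nonzero, the first two Pauli matrices are in the image,
    and these generate all matrices. *)
Lemma spanning_surjective rho (p : 'rV[F]_3) (sq : 'rV[F]_3 -> 'rV[F]_3) eps : p 0 0 != 0 ->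
    (forall j, sq p 0 j ^+ 2 = Delta c p 0 j) ->
    (forall i, exists a, rho a = psi c sq p eps i) ->
  surjective_rep rho.
Proof.
move=> p0 sqE im; have [_ uB D0 D1 _] := frameP c0 c8 p0.
have imZ k M : (exists a, rho a = M) -> exists a, rho a = k *: M.
  by move=> [a <-]; exists (k *: a); rewrite linearZ.
have imD M N : (exists a, rho a = M) -> (exists a, rho a = N) -> exists a, rho a = M + N.
  by move=> [a <-] [b <-]; exists (a + b); rewrite rmorphD.
have imM M N : (exists a, rho a = M) -> (exists a, rho a = N) -> exists a, rho a = M * N.
  by move=> [a <-] [b <-]; exists (a * b); rewrite rmorphM.
have im1 : exists a, rho a = 1 by exists 1; rewrite rmorph1.
set B := Pinv c p in uB.
have sig (k : 'I_3) : k != 2 -> sq p 0 k != 0 -> exists a, rho a = sigma F k.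
  move=> k2 sk.
  have -> : sigma F k = (sq p 0 k)^-1 *: \sum_i invmx B i k *: psi c sq p eps i.
    have BP l : \sum_i invmx B i k * B l i = (l == k)%:R.
      have /matrixP/(_ l k) := mulmxV uB; rewrite !mxE => <-.
      by apply: eq_bigr => i _; rewrite mulrC.
    pose e (l : 'I_3) : F := (-1) ^+ (eps && (l == 2)) * sq p 0 l.
    have psiE i : psi c sq p eps i = \sum_l (B l i * e l) *: sigma F l.
      rewrite sum3 /e /= !andbF andbT !mul1r /psi; congr (_ + _ *: _).
      by rewrite mulrCA.
    under eq_bigr do rewrite psiE scaler_sumr.
    rewrite exchange_big (bigD1 k) //= [X in _ + X]big1 ?addr0 => [|l lk].
      under eq_bigr do rewrite scalerA mulrA.
      rewrite -scaler_suml -mulr_suml BP eqxx mul1r /e (negPf k2) andbF mul1r.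
      by rewrite scalerA mulVf ?scale1r.
    under eq_bigr do rewrite scalerA mulrA.
    by rewrite -scaler_suml -mulr_suml BP (negPf lk) mul0r scale0r.
  by apply: (imZ); rewrite sum3; do !apply: (imD); apply: (imZ).
have s_neq0 k : Delta c p 0 k != 0 -> sq p 0 k != 0 by rewrite -sqE expf_eq0.
have im0 := sig 0 isT (s_neq0 _ D0); have im1' := sig 1 isT (s_neq0 _ D1).
move=> M; have [a [b [d [e ->]]]] := mx2P M.
have -> : mx2 a b d e = ((a + e) / 2) *: 1 + ((a - e) / 2 * 'i) *: (sigma F 0 * sigma F 1)
   + ((b + d) / 2) *: sigma F 0 + (- ((b - d) / 2 * 'i)) *: sigma F 1.
  by rewrite !sigmaE !mx2E; congr mx2; field: (imaginary_sq F).
by do !apply: (imD); do ?apply: (imZ) => //; apply: (imM).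
Qed.

(** Both signs of psi satisfy the equation for t; they give opposite values of g, so one
    of them gives the prescribed square root. *)
Lemma rep_at (sq : 'rV[F]_3 -> 'rV[F]_3) (s : 'S_3) t g :
    (forall p : 'rV[F]_3, p 0 0 != 0 -> forall j, sq p 0 j ^+ 2 = Delta c p 0 j) ->
    t (s 0) != 0 -> g ^+ 2 = alt_sq_val c t ->
  exists eps rho, [/\ perm_psi_rep sq s (\row_i (t (s i) / 2)) eps rho,
                      surjective_rep rho & sk_char rho t g].
Proof.
move=> sqE ts0 gE; set p := \row_i _.
have p0 : p 0 0 != 0 by rewrite mxE mulf_neq0 // invr_eq0 pnatr_eq0.
have n2 : (2 : F) != 0 by rewrite pnatr_eq0.
have ex eps : exists rho g', [/\ perm_psi_rep sq s p eps rho, surjective_rep rho,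
    sk_char rho t g' & g' = \tr (rho (x 0) * rho (x 1) * rho (x 2))].
  have cl := psi_clifford c0 c8 sqE eps p0.
  have [rho rhoE] := clifford_rep s cl.
  have rhoE' i : rho (x i) = psi c sq p eps ((s^-1)%g i) by rewrite -rhoE permKV.
  have [t' [g' ch]] : exists t' g', sk_char rho t' g'.
    by apply: traceless_char => i; rewrite rhoE' psi_pauli pauli_trace.
  have t'E : t' =1 t.
    move=> i; have := char_sq ch i; rewrite rhoE' (clifford_sq _ cl) !mx2_scalar.
    by move=> /mx2_inj [<- _ _ _]; rewrite mxE permKV; field.
  have {t'E}ch : sk_char rho t g'.
    by have [? H ?] := ch; split=> // i; rewrite H t'E.
  exists rho, g'; split=> //.
    apply: (@spanning_surjective _ p sq eps) => // [j|i]; first exact: sqE.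
    by exists (x (s i)).
  by rewrite (char_trace c1 ch).
have [rho [g' [ps sur ch g'E]]] := ex false.
have [rho2 [g2 [ps2 sur2 ch2 g2E]]] := ex true.
have g2N : g2 = - g'.
  rewrite g2E g'E; have [_ H] := ps; have [_ H2] := ps2.
  have E i : rho (x i) = psi c sq p false ((s^-1)%g i) by rewrite -H permKV.
  have E2 i : rho2 (x i) = psi c sq p true ((s^-1)%g i) by rewrite -H2 permKV.
  by rewrite !E !E2 psi_triple_flip.
have := char_gamma c1 ch; rewrite -gE => /eqP; rewrite eqf_sqr => /orP[] /eqP e.
  by exists false, rho; split=> //; rewrite -e.
by exists true, rho2; split=> //; rewrite -[g]opprK -e -g2N.
Qed.

Lemma point_rep t g : (exists i, t i != 0) -> g ^+ 2 = alt_sq_val c t ->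
  exists2 rho : rep, surjective_rep rho & sk_char rho t g.
Proof.
move=> [i ti] gE; pose sq (p : 'rV[F]_3) : 'rV[F]_3 := \row_j sqrtC (Delta c p 0 j).
have [|//|//|eps [rho [_ sur ch]]] := @rep_at sq (tperm 0 i) t g.
- by move=> p _ j; rewrite mxE sqrtCK.
- by rewrite tpermL.
- by exists rho.
Qed.

Lemma alt_sq_polyE t : mval t (alt_sq_poly c) = alt_sq_val c t.
Proof.
rewrite alt_sq_poly.unlock !exprS !expr0 !mulr1 !(mpoly.mevalB, mpoly.mevalD, mpoly.mevalZ).
by rewrite !mpoly.mevalM !mpoly.mevalXU /alt_sq_val; ring.
Qed.

(** Where det Q and the first coordinate do not vanish there are two distinct values of g, and
    frames are available. *)
Definition generic t := t 0 != 0 /\ alt_sq_val c t != 0.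

Lemma generic_zero (r : mpoly.mpoly 3 F) : (forall t, generic t -> mval t r = 0) -> r = 0.
Proof.
move=> r0; apply/eqP/negPn/negP=> rn.
pose T := mpoly.mpolyX F (mpoly.mnm1 (0 : 'I_3)).
have Tn : T != 0.
  by apply/eqP => /(congr1 (mpoly.meval (fun=> 1))); rewrite mpoly.mevalXU rmorph0 => /eqP; rewrite oner_eq0.
have Dn : alt_sq_poly c != 0.
  apply/eqP => /(congr1 (mpoly.meval (fun i => (i == 0)%:R))).
  rewrite alt_sq_polyE rmorph0 /alt_sq_val /= => /eqP.
  by rewrite !expr1n !expr0n /= !mulr0 !addr0 subr0 mulr1 expf_eq0 /= (negPf c0).
have [v] := mpoly_nonroot (mulf_neq0 rn (mulf_neq0 Tn Dn)).
rewrite !rmorphM /= mpoly.mevalXU alt_sq_polyE !mulf_eq0 !negb_or => /and3P[rv tv Dv].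
by rewrite r0 ?eqxx in rv.
Qed.

Lemma discr_alt_sq t : discr c (t 0) (t 1) (t 2) = - 2 * alt_sq_val c t.
Proof. by rewrite discrE /alt_sq_val; ring. Qed.

Lemma generic_pair t : generic t -> exists g (rho rho' : rep), [/\ g != 0,
  surjective_rep rho, surjective_rep rho', sk_char rho t g & sk_char rho' t (- g)].
Proof.
move=> [t0 Dt]; pose g := sqrtC (alt_sq_val c t); have gE : g ^+ 2 = alt_sq_val c t by rewrite sqrtCK.
have ex : exists i, t i != 0 by exists 0.
have [rho sur ch] := point_rep ex gE.
have [|rho' sur' ch'] := @point_rep t (- g) ex; first by rewrite sqrrN.
by exists g, rho, rho'; split=> //; rewrite -sqrf_eq0 gE.
Qed.

(** The trace of the element against x_l is (A Q)_l + b_l g, and it vanishes as x_l is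
    traceless. Comparing the two signs of g gives b = 0, then A Q = 0 with Q
    invertible. *)
Lemma normal_scalar r a b q :
    (forall rho t g, surjective_rep rho -> sk_char rho t g -> g != 0 ->
       exists k, rho (sk_normal c1 r a b q) = k%:M) ->
  forall i, a i = 0 /\ b i = 0.
Proof.
move=> sc; have n2 : (2 : F) != 0 by rewrite pnatr_eq0.
suff ab t : generic t -> forall i, mval t (a i) = 0 /\ mval t (b i) = 0.
  by move=> i; split; apply: generic_zero => t /ab /(_ i) [].
move=> gt; have [g [rho [rho' [g0 sur sur' ch ch']]]] := generic_pair gt.
have gn : - g != 0 by rewrite oppr_eq0.
pose A := \row_i mval t (a i); pose M := formQ c (t 0) (t 1) (t 2).
have AM_l l : (A *m M) 0 l = \sum_i mval t (a i) * M i l.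
  by rewrite [LHS]mxE; apply: eq_bigr => i _; rewrite [A _ _]mxE.
have lin (rh : rep) h l : sk_char rh t h -> surjective_rep rh -> h != 0 ->
    (A *m M) 0 l + mval t (b l) * h = 0.
  move=> chr sr h0; have e := char_normal_tr_gen c1 chr r a b q l.
  have [k sk] := sc _ _ _ sr chr h0.
  by rewrite AM_l -e sk tr_scalarM (char_tr chr) mulr0.
have b0 l : mval t (b l) = 0.
  have := etrans (lin _ _ l ch sur g0) (esym (lin _ _ l ch' sur' gn)) => /addrI.
  rewrite mulrN => /eqP; rewrite -subr_eq0 opprK -mulr2n -mulr_natl !mulf_eq0.
  by rewrite (negPf n2) (negPf g0) orbF => /eqP.
have AM : A *m M = 0.
  apply/rowP=> l; have := lin _ _ l ch sur g0.
  by rewrite b0 mul0r addr0 => ->; rewrite mxE.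
have uM : M \in unitmx.
  rewrite unitmxE unitfE -/(discr c (t 0) (t 1) (t 2)) discr_alt_sq.
  by rewrite mulf_neq0 ?oppr_eq0 //; case: gt.
have A0 : A = 0 by rewrite -[A](mulmxK uM) AM mul0mx.
by move=> i; split=> //; have /rowP/(_ i) := A0; rewrite !mxE.
Qed.

Lemma char_ev_alt r q rho t g : sk_char rho t g ->
  rho (ev r + ev q * alt) = (mval t r + mval t q * g)%:M.
Proof.
move=> [_ rt rg]; rewrite rmorphD rmorphM /= rg !(rep_ev c1 _ rt).
by rewrite -[_%:M * _]/(_%:M *m _) -scalar_mxM -raddfD.
Qed.

Lemma ev_alt_eq0 r q : (forall rho t g, surjective_rep rho -> sk_char rho t g -> g != 0 ->
    rho (ev r + ev q * alt) = 0) -> r = 0 /\ q = 0.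
Proof.
move=> z; have n2 : (2 : F) != 0 by rewrite pnatr_eq0.
suff rq t : generic t -> mval t r = 0 /\ mval t q = 0.
  by split; apply: generic_zero => t /rq [].
move=> gt; have [g [rho [rho' [g0 sur sur' ch ch']]]] := generic_pair gt.
have gn : - g != 0 by rewrite oppr_eq0.
have lin (rh : rep) h : sk_char rh t h -> surjective_rep rh -> h != 0 ->
    mval t r + mval t q * h = 0.
  move=> chr sr h0; have := z _ _ _ sr chr h0.
  by rewrite (char_ev_alt _ _ chr) mx2_scalar mx2_zero => /mx2_inj [].
have q0 : mval t q = 0.
  have := etrans (lin _ _ ch sur g0) (esym (lin _ _ ch' sur' gn)) => /addrI.
  rewrite mulrN => /eqP; rewrite -subr_eq0 opprK -mulr2n -mulr_natl !mulf_eq0.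
  by rewrite (negPf n2) (negPf g0) orbF => /eqP.
by split=> //; have := lin _ _ ch sur g0; rewrite q0 mul0r addr0.
Qed.

Lemma sk_normal0 r q : sk_normal c1 r (fun=> 0) (fun=> 0) q = ev r + ev q * alt.
Proof. by rewrite /sk_normal !ev_sum0 !addr0. Qed.

(** The representations over generic points separate the elements of S_c. From here
    on, identities in S_c are checked in 2 x 2 matrices. *)
Lemma sk_faithful s : (forall rho t g, surjective_rep rho -> sk_char rho t g -> g != 0 ->
    rho s = 0) -> s = 0.
Proof.
have [r [a [b [q ->]]]] := sk_spannedP c1 s => z.
have ab := @normal_scalar r a b q; have {}ab i : a i = 0 /\ b i = 0.
  by apply: ab => rho t g sur ch g0; exists 0; rewrite raddf0; apply: z ch g0.
have aE : a = fun=> 0 by apply: boolp.funext => i; have [] := ab i.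
have bE : b = fun=> 0 by apply: boolp.funext => i; have [] := ab i.
rewrite aE bE sk_normal0 in z *.
by have [-> ->] := ev_alt_eq0 z; rewrite !rmorph0 mul0r addr0.
Qed.

Lemma alt_comm s : alt * s = s * alt.
Proof.
apply/eqP; rewrite -subr_eq0; apply/eqP/sk_faithful => rho t g _ [_ _ rg] _.
rewrite rmorphB !rmorphM /= rg; apply/eqP; rewrite subr_eq0; apply/eqP/esym.
exact: scalar_mxC.
Qed.

Lemma alt_square : alt ^+ 2 = ev (alt_sq_poly c).
Proof.
apply/eqP; rewrite -subr_eq0; apply/eqP/sk_faithful => rho t g _ ch _.
have [_ rt rg] := ch; rewrite rmorphB rmorphXn /= rg (rep_ev c1 _ rt) alt_sq_polyE.
by rewrite -(char_gamma c1 ch) -rmorphXn subrr.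
Qed.

Lemma central_normal s : (forall a, s * a = a * s) -> exists r q, s = ev r + ev q * alt.
Proof.
have [r [a [b [q ->]]]] := sk_spannedP c1 s => sC.
have zC : sk_normal c1 r a b q \in central (A := S) by apply/centralP.
have ab i : a i = 0 /\ b i = 0.
  apply: (@normal_scalar r a b q) => rho t g sur _ _.
  exact: (simple_central (Center zC) (surjective_simple sur)).
have aE : a = fun=> 0 by apply: boolp.funext => i; have [] := ab i.
have bE : b = fun=> 0 by apply: boolp.funext => i; have [] := ab i.
by exists r, q; rewrite aE bE sk_normal0.
Qed.

End CenterStructure.

(** * Coordinates and characters of the center *)

Lemma quadratic_mul (R : comNzRingType) (a b a' b' h : R) :
  (a + b * h) * (a' + b' * h) = a * a' + b * b' * (h * h) + (a * b' + b * a') * h.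
Proof. by ring. Qed.

Section CenterPoints.
Variables (F : numClosedFieldType) (c : F).
Hypotheses (c0 : c != 0) (c1 : c ^+ 3 != -1) (c8 : c ^+ 3 != 8).
Local Notation S := (sklyanin c).
Local Notation Z := (center S).
Local Notation P := (mpoly.mpoly 3 F).
Local Notation rep := {lrmorphism S -> 'M[F]_2}.
Local Notation mval t r := (mpoly.meval t r).
Local Notation evz := (poly_at (sk_sq c1)).
Implicit Types (rho : rep) (t : 'I_3 -> F) (g : F) (z : Z) (m : set Z).

Lemma alt_central : sk_alt c \in central (A := S).
Proof. by apply/centralP=> s; rewrite (alt_comm c0 c1 c8). Qed.

Definition altz : Z := Center alt_central.

Lemma val_normal r q : val (evz r + evz q * altz) = sk_ev c1 r + sk_ev c1 q * sk_alt c.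
Proof. by rewrite rmorphD rmorphM /= !sk_ev.unlock. Qed.

Lemma coords_exist z : exists rq : P * P, z = evz rq.1 + evz rq.2 * altz.
Proof.
have [r [q zE]] := central_normal c0 c1 c8 (fun a => central_comm z a).
by exists (r, q); apply: val_inj; rewrite val_normal.
Qed.

(** The coordinates in the basis 1, alt of the center over the polynomials. *)
Definition coords z : P * P := sval (boolp.cid (coords_exist z)).

Lemma coordsE z : z = evz (coords z).1 + evz (coords z).2 * altz.
Proof. exact: svalP (boolp.cid (coords_exist z)). Qed.

Lemma coords_uniq r q z : z = evz r + evz q * altz -> coords z = (r, q).
Proof.
move=> zE; suff [e1 e2] : (coords z).1 - r = 0 /\ (coords z).2 - q = 0.
  by rewrite [coords z]surjective_pairing (subr0_eq e1) (subr0_eq e2).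
apply: (@ev_alt_eq0 F c c0 c1 c8) => rho t g _ _ _.
rewrite -val_normal !rmorphB mulrBl addrACA -opprD -coordsE -zE subrr.
exact: rmorph0.
Qed.

Lemma coordsD z z' : coords (z + z') =
  ((coords z).1 + (coords z').1, (coords z).2 + (coords z').2).
Proof.
by apply: coords_uniq; rewrite {1}(coordsE z) {1}(coordsE z') !rmorphD mulrDl addrACA.
Qed.

Lemma coordsZ k z : coords (k *: z) = (k *: (coords z).1, k *: (coords z).2).
Proof.
by apply: coords_uniq; rewrite {1}(coordsE z) scalerDr !linearZ /= scalerAl.
Qed.

Lemma altz_square : altz * altz = evz (alt_sq_poly c).
Proof.
apply: val_inj; rewrite rmorphM sk_evE -(alt_square c0 c1 c8) expr2.
by [].
Qed.

Lemma coordsM z z' : coords (z * z') =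
  ((coords z).1 * (coords z').1 + (coords z).2 * (coords z').2 * alt_sq_poly c,
   (coords z).1 * (coords z').2 + (coords z).2 * (coords z').1).
Proof.
apply: coords_uniq; rewrite {1}(coordsE z) {1}(coordsE z').
by rewrite quadratic_mul altz_square !rmorphD !rmorphM.
Qed.

Lemma coords_poly r : coords (evz r) = (r, 0).
Proof. by apply: coords_uniq; rewrite rmorph0 mul0r addr0. Qed.

Lemma coords_altz : coords altz = (0, 1).
Proof. by apply: coords_uniq; rewrite rmorph0 rmorph1 mul1r add0r. Qed.

Lemma coords1 : coords 1 = (1, 0).
Proof. by rewrite -(rmorph1 evz) coords_poly. Qed.

Lemma coords0 : coords 0 = (0, 0).
Proof. by rewrite -(rmorph0 evz) coords_poly. Qed.

Lemma coords_inj z : coords z = (0, 0) -> z = 0.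
Proof. by move=> z0; rewrite (coordsE z) z0 /= rmorph0 mul0r addr0. Qed.

(** The candidate for the character of the center at the point (t, g); it is
    multiplicative only for points of the hypersurface g ^+ 2 = alt_sq_val c t. *)
Definition chi t g z : F := mval t (coords z).1 + mval t (coords z).2 * g.

Lemma rep_chi rho t g z : sk_char rho t g -> rho (val z) = (chi t g z)%:M.
Proof. by move=> ch; rewrite {1}(coordsE z) val_normal (char_ev_alt _ _ _ ch). Qed.

Section Chi.
Variables (t : 'I_3 -> F) (g : F).

Lemma chi_poly r : chi t g (evz r) = mval t r.
Proof. by rewrite /chi coords_poly rmorph0 mul0r addr0. Qed.

Lemma chi_altz : chi t g altz = g.
Proof. by rewrite /chi coords_altz rmorph0 rmorph1 mul1r add0r. Qed.

Lemma chi_sq i : chi t g (sk_sq c1 i) = t i.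
Proof. by rewrite -(poly_atX (sk_sq c1)) chi_poly mpoly.mevalXU. Qed.

Lemma chiD z z' : chi t g (z + z') = chi t g z + chi t g z'.
Proof. by rewrite /chi coordsD /= !rmorphD /=; ring. Qed.

Lemma chiZ k z : chi t g (k *: z) = k * chi t g z.
Proof. by rewrite /chi coordsZ /= !mpoly.mevalZ; ring. Qed.

Lemma chi1 : chi t g 1 = 1.
Proof. by rewrite -(rmorph1 evz) chi_poly rmorph1. Qed.

Lemma chi0 : chi t g 0 = 0.
Proof. by rewrite -(scale0r 1) chiZ mul0r. Qed.

Hypothesis tg : g ^+ 2 = alt_sq_val c t.

Lemma chiM z z' : chi t g (z * z') = chi t g z * chi t g z'.
Proof.
rewrite /chi coordsM /= !mpoly.mevalD !mpoly.mevalM alt_sq_polyE -tg; ring.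
Qed.

Lemma chi_maximal : maximal_ideal [set z | chi t g z = 0].
Proof.
split=> [|/=|J [J0 JD JM] sJ J1]; first split=> /=.
- exact: chi0.
- by move=> z z' cz cz'; rewrite chiD cz cz' addr0.
- by move=> a z b cz; rewrite !chiM cz mulr0 mul0r.
- by rewrite chi1 => /eqP; rewrite oner_eq0.
apply/seteqP; split=> [z Jz /=|//]; apply/eqP/negPn/negP=> cz; apply: J1.
have Jd : J (z - chi t g z *: 1).
  by apply: sJ; rewrite /= -scaleN1r chiD !chiZ chi1; ring.
have -> : 1 = (chi t g z)^-1 *: 1 * z * 1 + (- ((chi t g z)^-1 *: 1)) * (z - chi t g z *: 1) * 1.
  rewrite !mulr1 mulNr mulrBr -!scalerAl !mul1r scalerA mulVf //.
  by rewrite scale1r opprB addrC subrK.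
by apply: JD; apply: JM.
Qed.

End Chi.

Lemma rep_point_chi rho t g : sk_char rho t g ->
  rep_point rho = [set z | chi t g z = 0].
Proof.
move=> ch; apply/seteqP; split=> z; rewrite /rep_point /= (rep_chi _ ch).
  by rewrite mx2_scalar mx2_zero => /mx2_inj [].
by move=> ->; rewrite raddf0.
Qed.

(** The measure of a polynomial is its degree plus one: these elements have coordinates
    of degree less than N. *)
Definition bounded_coords N z :=
  (mpoly.mmeasure mpoly.mdeg (coords z).1 <= N)%N &&
  (mpoly.mmeasure mpoly.mdeg (coords z).2 <= N)%N.

(** Each coordinate is a combination of the monomials with exponents less than N, of
    which there are N ^ 3. *)
Lemma bounded_dependent k N (z : 'I_k -> Z) :
    (2 * N ^ 3 < k)%N -> (forall i, bounded_coords N (z i)) ->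
  exists2 v : 'I_k -> F, exists i, v i != 0 & \sum_i v i *: z i = 0.
Proof.
move=> Nk zN; pose T : finType := (bool * {ffun 'I_3 -> 'I_N})%type.
have cardT : #|T| = (2 * N ^ 3)%N.
  by rewrite card_prod card_bool card_ffun !card_ord.
pose mon (h : {ffun 'I_3 -> 'I_N}) : mpoly.multinom 3 :=
  mpoly.Multinom [tuple (h i : nat) | i < 3].
pose co (b : bool) z := if b then (coords z).1 else (coords z).2.
pose A := \matrix_(i < k, j < #|T|)
  let bh := enum_val j in mpoly.mcoeff (mon bh.2) (co bh.1 (z i)).
have : kermx A != 0.
  rewrite kermx_eq0 /row_free; apply/eqP => rA.
  by have := rank_leq_col A; rewrite rA cardT leqNgt Nk.
case/rowV0Pn => w /sub_kermxP wA w0; exists (fun i => w 0 i).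
  apply/existsP; apply: contraNT w0; rewrite negb_exists => /forallP w0.
  by apply/eqP/rowP=> i; rewrite mxE; apply/eqP; have := w0 i; rewrite negbK.
set s := \sum_i _.
have coD b y y' : co b (y + y') = co b y + co b y' by rewrite /co coordsD; case: b.
have coZ b l y : co b (l *: y) = l *: co b y by rewrite /co coordsZ; case: b.
have co0 b : co b 0 = 0 by rewrite /co coords0; case: b.
have coS b : co b s = \sum_i w 0 i *: co b (z i).
  by rewrite (big_morph _ (coD b) (co0 b)); apply: eq_bigr => i _; rewrite coZ.
suff cs b : co b s = 0.
  by apply: coords_inj; rewrite [coords s]surjective_pairing [_.1](cs true) [_.2](cs false).
apply/mpoly.mpolyP=> m; rewrite mpoly.mcoeff0 coS raddf_sum /=.
have [mN|mN] := boolP [forall i : 'I_3, (mpoly.fun_of_multinom m i < N)%N].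
  pose h : {ffun 'I_3 -> 'I_N} := [ffun i => Ordinal (forallP mN i)].
  have -> : m = mon h.
    by apply/mpoly.mnmP=> i; rewrite mpoly.mnmE ffunE.
  have /rowP/(_ (enum_rank (b, h))) := wA; rewrite !mxE => {2}<-.
  by apply: eq_bigr => i _; rewrite !mxE enum_rankK mpoly.mcoeffZ.
apply: big1 => i _; rewrite mpoly.mcoeffZ mpoly.memN_msupp_eq0 ?mulr0 //.
apply/negP=> /mpoly.msize_mdeg_lt sm; case/negP: mN; apply/forallP=> j.
apply: leq_trans (_ : (mpoly.mdeg m).+1 <= _)%N.
  by rewrite ltnS mpoly.mdegE (bigD1 j) //= leq_addr.
by apply: leq_trans sm _; case/andP: (zN i) => s1 s2; rewrite /co; case: b.
Qed.

End CenterPoints.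

(** * Maximal ideals of the center *)

(** The form in which uncountability is used: F is not the union of an increasing
    sequence of finite sets. *)
Definition infinite_fibre (F : eqType) := forall f : F -> nat,
  exists N, forall k, exists s : seq F,
    [/\ uniq s, size s = k & all (fun y => f y <= N)%N s].

Section Ideals.
Variables (F : fieldType) (Z : comAlgType F) (m : set Z).
Hypothesis mm : maximal_ideal m.

Lemma max_ideal0 : m 0. Proof. by have [[]] := mm. Qed.
Lemma max_idealD y z : m y -> m z -> m (y + z).
Proof. by have [[_ D _] _ _] := mm; apply: D. Qed.
Lemma max_idealM a z : m z -> m (a * z).
Proof. by have [[_ _ M] _ _] := mm => mz; rewrite -[_ * _]mulr1; apply: M. Qed.
Lemma max_idealZ k z : m z -> m (k *: z).
Proof. by move=> mz; rewrite -[z]mul1r scalerAl; apply: max_idealM. Qed.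
Lemma max_idealN z : m z -> m (- z).
Proof. by rewrite -scaleN1r; apply: max_idealZ. Qed.
Lemma max_idealB y z : m y -> m z -> m (y - z).
Proof. by move=> my mz; apply: max_idealD => //; apply: max_idealN. Qed.
Lemma max_ideal_scalar k : m (k *: 1) -> k = 0.
Proof.
move=> mk; apply/eqP/negPn/negP=> k0; have [_ + _] := mm; apply.
by have := max_idealZ k^-1 mk; rewrite scalerA mulVf // scale1r.
Qed.

Lemma max_ideal_inv d : ~ m d -> exists a, m (1 - a * d).
Proof.
move=> md; pose J : set Z := [set y | exists a, m (y - a * d)].
have [_ _ mmax] := mm; have [//|J1] := pselect (J 1).
case: md; rewrite -(mmax J) //.
- by exists 1; rewrite mul1r subrr; apply: max_ideal0.
- split; [|move=> y y' [a ya] [a' ya']|move=> b y b' [a ya]].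
  + by exists 0; rewrite mul0r subr0; apply: max_ideal0.
  + by exists (a + a'); rewrite mulrDl opprD addrACA; apply: max_idealD.
  + by exists (b * b' * a); rewrite mulrAC -!mulrA -!mulrBr mulrA; apply: max_idealM.
- by move=> y my; exists 0; rewrite mul0r subr0.
Qed.

End Ideals.

Section Nullstellensatz.
Variables (F : numClosedFieldType) (c : F).
Hypotheses (c0 : c != 0) (c1 : c ^+ 3 != -1) (c8 : c ^+ 3 != 8).
Hypothesis unc : infinite_fibre F.
Local Notation S := (sklyanin c).
Local Notation Z := (center S).
Local Notation coords := (coords c0 c1 c8).
Local Notation chi := (chi c0 c1 c8).
Local Notation mval t r := (mpoly.meval t r).
Local Notation evz := (poly_at (sk_sq c1)).
Local Notation altz := (altz c0 c1 c8).

(** Otherwise each z - k has an inverse a_k modulo m. By uncountability infinitely many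
    a_k have coordinates of degree below a common bound, so there is a linear relation
    between the inverses of the z - l_i for finitely many distinct l_i. Clearing
    denominators gives p(z) in m for a nonzero polynomial p, which splits into linear
    factors invertible modulo m. *)
Lemma residue (m : set Z) z : maximal_ideal m -> exists k, m (z - k *: 1).
Proof.
move=> mm; apply: contrapT => no.
have /boolp.choice [a aP] k : exists a, m (1 - a * (z - k *: 1)).
  by apply: (max_ideal_inv mm) => mk; apply: no; exists k.
pose d k := z - k *: 1.
pose f k := maxn (mpoly.mmeasure mpoly.mdeg (coords (a k)).1)
                 (mpoly.mmeasure mpoly.mdeg (coords (a k)).2).
have [N /(_ (2 * N ^ 3).+1%N) [s [us ss sN]]] := unc f.
pose l (i : 'I_(2 * N ^ 3).+1) := nth 0 s i.
have l_inj : injective l.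
  by move=> i j /eqP; rewrite nth_uniq ?ss // => /eqP/val_inj.
have [i|v [i0 vi0] v0] := @bounded_dependent F c c0 c1 c8 _ N (fun i => a (l i)) (leqnn _).
  have /(allP sN) : l i \in s by rewrite mem_nth ?ss.
  by rewrite /= geq_max.
pose p : {poly F} := \sum_i v i *: \prod_(j | j != i) ('X - (l j)%:P).
have p0 : p != 0.
  apply/eqP => /(congr1 (horner^~ (l i0))); rewrite horner0 horner_sum.
  rewrite (bigD1 i0) //= [X in _ + X]big1 ?addr0 => [|i ii0].
    rewrite hornerZ horner_prod => /eqP; rewrite mulf_eq0 (negPf vi0) /=.
    apply/negP/prodf_neq0 => j ji; rewrite !hornerE subr_eq0.
    by rewrite (inj_eq l_inj) eq_sym.
  by rewrite hornerZ horner_prod (bigD1 i0) 1?eq_sym //= hornerXsubC subrr mul0r mulr0.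
have zX k : horner_alg z ('X - k%:P) = d k.
  by rewrite rmorphB /= horner_algX horner_algC.
have mp : m (horner_alg z p).
  have -> : horner_alg z p =
    \sum_i v i *: ((\prod_(j | j != i) d (l j)) * (1 - a (l i) * d (l i))).
    transitivity (\sum_i v i *: \prod_(j | j != i) d (l j)).
      rewrite rmorph_sum; apply: eq_bigr => k _; rewrite /= linearZ rmorph_prod /=.
      rewrite mulr_algl; congr (_ *: _); apply: eq_bigr => j _; apply: zX.
    apply/eqP; rewrite -subr_eq0 -sumrB; apply/eqP.
    transitivity ((\sum_i v i *: a (l i)) * \prod_j d (l j)); last by rewrite v0 mul0r.
    rewrite mulr_suml; apply: eq_bigr => k _; rewrite -scalerBr -scalerAl; congr (_ *: _).
    by rewrite (bigD1 k (P := xpredT)) //= mulrBr mulr1 subKr mulrC mulrA.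
  apply: big_ind => [|????|k _]; [exact: (max_ideal0 mm)|exact: (max_idealD mm)|].
  by apply/(max_idealZ mm)/(max_idealM mm).
have [r pr] := closed_field_poly_normal p; rewrite pr linearZ rmorph_prod /= mulr_algl in mp.
have lc : lead_coef p != 0 by rewrite lead_coef_eq0.
suff : m (lead_coef p *: 1) by move/(max_ideal_scalar mm)/eqP; rewrite (negPf lc).
elim: r {pr} mp => [|k r IH]; rewrite ?big_nil // big_cons zX => mk.
apply: IH; set y := \prod_(_ <- _) _ in mk *.
have -> : lead_coef p *: y = (lead_coef p *: y) * (1 - a k * d k) + a k * (lead_coef p *: (d k * y)).
  rewrite -!scalerAr -!scalerAl -scalerDr; congr (_ *: _).
  by rewrite mulrBr mulr1 [a k * (_ * _)]mulrA [X in _ - X]mulrC subrK.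
by apply: (max_idealD mm); apply: (max_idealM mm).
Qed.

(** The residues of the generators of the center are the coordinates of the point. *)
Theorem maximal_points (m : set Z) : maximal_ideal m ->
  exists t g, g ^+ 2 = alt_sq_val c t /\ m = [set z | chi t g z = 0].
Proof.
move=> mm; pose R z k := m (z - k *: 1).
have RD z k z' k' : R z k -> R z' k' -> R (z + z') (k + k').
  by move=> Rz Rz'; rewrite /R scalerDl opprD addrACA; apply: (max_idealD mm).
have RM z k z' k' : R z k -> R z' k' -> R (z * z') (k * k').
  rewrite /R => Rz Rz'; have -> : z * z' - (k * k') *: 1 = z' * (z - k *: 1) + (k *: 1) * (z' - k' *: 1).
    rewrite !mulrBr [z' * z]mulrC -!scalerAr -!scalerAl !mul1r !mulr1 scalerA [k * k']mulrC.
    by rewrite -scalerA addrA subrK.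
  by apply: (max_idealD mm); apply: (max_idealM mm).
have Runiq z k k' : R z k -> R z k' -> k = k'.
  move=> Rz Rz'; apply/eqP; rewrite -subr_eq0; apply/eqP/(max_ideal_scalar mm).
  have -> : (k - k') *: 1 = (z - k' *: 1) - (z - k *: 1) :> Z.
    by rewrite scalerBl opprB [RHS]addrC addrA subrK.
  exact: (max_idealB mm).
have RC k : R (k *: 1) k by rewrite /R subrr; apply: (max_ideal0 mm).
have /boolp.choice [t tR] i := residue (sk_sq c1 i) mm.
have [g gR] := residue altz mm.
have Rev r : R (evz r) (mval t r).
  elim/mpoly_ring_ind: r => [k|i|p q IHp IHq|p q IHp IHq].
  - by rewrite poly_atC mpoly.mevalC; apply: (RC).
  - by rewrite poly_atX mpoly.mevalXU.
  - by rewrite !rmorphD; apply: (RD).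
  - by rewrite !rmorphM; apply: (RM).
have Rchi z : R z (chi t g z).
  by rewrite {1}(coordsE c0 c1 c8 z); apply: (RD) => //; apply: (RM).
exists t, g; split.
  apply: (Runiq (altz * altz)); first by rewrite expr2; apply: (RM).
  by rewrite altz_square -alt_sq_polyE.
apply/seteqP; split=> z /=.
  move=> mz; apply: (max_ideal_scalar mm); have -> : chi t g z *: 1 = z - (z - chi t g z *: 1) by rewrite opprB addrC subrK.
  by apply: (max_idealB mm) => //; apply: Rchi.
by move=> cz; have := Rchi z; rewrite /R cz scale0r subr0.
Qed.

End Nullstellensatz.

(** * Classification of the simple representations *)

Section SimpleRepresentations.
Variables (F : numClosedFieldType) (c : F).
Hypotheses (c0 : c != 0) (c1 : c ^+ 3 != -1) (c8 : c ^+ 3 != 8).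
Local Notation S := (sklyanin c).
Local Notation x := (sk_gen c).
Local Notation Z := (center S).
Local Notation rep := {lrmorphism S -> 'M[F]_2}.
Local Notation chi := (chi c0 c1 c8).
Implicit Types (rho : rep) (t : 'I_3 -> F) (g : F).

Lemma rep_equiv_surj rho rho' : rep_equiv rho rho' -> surjective_rep rho' ->
  surjective_rep rho.
Proof.
move=> [h uh hE] sur M; have [a aE] := sur (h * M * h^-1); exists a.
by apply: (mulrI uh); rewrite [LHS]hE aE -[_ *m h]/(_ * h) mulrVK.
Qed.

Lemma rep_equiv_tr rho rho' a : rep_equiv rho rho' -> \tr (rho a) = \tr (rho' a).
Proof.
move=> [h uh hE]; have -> : rho a = h^-1 * (rho' a * h).
  by rewrite -[rho' a * h]hE -[h *m _]/(h * _) mulKr.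
by rewrite mxtraceC -mulrA mulrV // mulr1.
Qed.

Lemma rep_equiv_char rho rho' t g : rep_equiv rho rho' -> sk_char rho' t g ->
  sk_char rho t g.
Proof.
move=> e [tr0 rt rg]; have [h uh hE] := e.
have sc a k : rho' a = k%:M -> rho a = k%:M.
  by move=> ak; apply: (mulrI uh); rewrite [LHS]hE ak -[RHS]/(h *m _) scalar_mxC.
split=> [i|i|]; last exact: sc.
  by rewrite (rep_equiv_tr _ e).
exact: sc.
Qed.

(** Over the origin the x_i anticommute and have square zero, so the kernel of each is
    invariant and nonzero: they all vanish, and every line is invariant. *)
Lemma simple_nonzero rho t : simple_rep rho -> (forall i, rho (x i ^+ 2) = (t i)%:M) ->
  exists i, t i != 0.
Proof.
move=> sim rt; apply/existsP; apply: contraT; rewrite negb_exists => /forallP t0.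
have {}t0 i : t i = 0 by apply/eqP; have := t0 i; rewrite negbK.
have X2 i : rho (x i) * rho (x i) = 0.
  by rewrite -expr2 -rmorphXn /= rt t0 raddf0.
have XX i j : rho (x i) * rho (x j) = - (rho (x j) * rho (x i)).
  apply/eqP; rewrite -addr_eq0; apply/eqP.
  have := rep_clifford 1%g rt i j; rewrite !perm1 => ->.
  have [<-|ij] := eqVneq i j; first by rewrite form_at_diag mxE t0 mul0r !mulr0 raddf0.
  have [k ki kj] := third_index ij.
  by rewrite (form_at_off _ _ ij ki kj) mxE t0 mul0r !mulr0 raddf0.
have X0 i : rho (x i) = 0.
  apply: mx_ker_full; set V := lker _.
  have [V0|//] : V = 0%VS \/ V = fullv.
    apply: sim; apply: invariant_gen => j v; rewrite !memv_ker !lfunE /= => /eqP iv.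
    by rewrite mulmxA -[_ *m rho (x j)]/(_ * _) XX mulNmx -mulmxA iv mulmx0 oppr0.
  have kerX (w : 'cV[F]_2) : rho (x i) *m w = 0.
    have : rho (x i) *m w \in V.
      rewrite memv_ker lfunE /= mulmxA -[rho (x i) *m rho (x i)]/(rho (x i) * rho (x i)).
      by rewrite X2 mul0mx.
    by rewrite V0 memv0 => /eqP.
  have : delta_mx 0 0 \in V by rewrite memv_ker lfunE /= kerX.
  rewrite V0 memv0 => /eqP/matrixP/(_ 0 0); rewrite !mxE /= => /eqP.
  by rewrite oner_eq0.
pose d : 'cV[F]_2 := delta_mx 0 0; have [] : <[d]>%VS = 0%VS \/ <[d]>%VS = fullv.
- by apply: sim; apply: invariant_gen => i v _; rewrite X0 mul0mx mem0v.
- move/eqP; rewrite -subv0 -memvE memv0 => /eqP/matrixP/(_ 0 0).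
  by rewrite !mxE /= => /eqP; rewrite oner_eq0.
move=> full; have : delta_mx 1 0 \in <[d]>%VS by rewrite full memvf.
by case/vlineP => k /matrixP/(_ 1 0); rewrite !mxE /= mulr0 => /eqP; rewrite oner_eq0.
Qed.

Lemma simple_psi (sq : 'rV[F]_3 -> 'rV[F]_3) (s : 'S_3) rho t :
    (forall p : 'rV[F]_3, p 0 0 != 0 -> forall j, sq p 0 j ^+ 2 = Delta c p 0 j) ->
    (forall i, rho (x i ^+ 2) = (t i)%:M) -> t (s 0) != 0 ->
  exists eps rho0, perm_psi_rep sq s (\row_i (t (s i) / 2)) eps rho0 /\ rep_equiv rho rho0.
Proof.
move=> sqE rt ts0; set p := \row_i _.
have p0 : p 0 0 != 0 by rewrite mxE mulf_neq0 // invr_eq0 pnatr_eq0.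
have [eps [h uh hE]] := clifford_psi c0 c8 sqE p0 (rep_clifford s rt).
have [rho0 rho0E] := clifford_rep s (psi_clifford c0 c8 sqE eps p0).
exists eps, rho0; split=> //; exists h => //; apply: sk_intertwine => i.
by rewrite -(permKV s i) rho0E -hE.
Qed.

(** A choice of square roots, for the statements which do not mention the family. *)
Definition sqrt_row (p : 'rV[F]_3) : 'rV[F]_3 := \row_j sqrtC (Delta c p 0 j).

Lemma sqrt_rowE (p : 'rV[F]_3) : p 0 0 != 0 -> forall j, sqrt_row p 0 j ^+ 2 = Delta c p 0 j.
Proof. by move=> _ j; rewrite mxE sqrtCK. Qed.

Lemma perm_psi_char (sq : 'rV[F]_3 -> 'rV[F]_3) (s : 'S_3) p eps rho :
    (forall p : 'rV[F]_3, p 0 0 != 0 -> forall j, sq p 0 j ^+ 2 = Delta c p 0 j) ->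
    perm_psi_rep sq s p eps rho ->
  surjective_rep rho /\ exists t g, sk_char rho t g /\ forall i, t (s i) = 2 * p 0 i.
Proof.
move=> sqE [p0 rhoE]; split.
  apply: (@spanning_surjective _ _ c0 c8 _ p sq eps) => // [j|i]; first exact: sqE.
  by exists (x (s i)).
have [|t [g ch]] := @traceless_char _ _ rho.
  by move=> i; rewrite -(permKV s i) rhoE psi_pauli pauli_trace.
exists t, g; split=> // i; have := char_sq ch (s i).
rewrite rhoE (clifford_sq _ (psi_clifford c0 c8 sqE eps p0)) !mx2_scalar.
by case/mx2_inj.
Qed.

Lemma simple_char rho : simple_rep rho ->
  exists t g, [/\ sk_char rho t g, exists i, t i != 0 & surjective_rep rho].
Proof.
move=> sim; have /boolp.choice [t rt] i : exists k, rho (x i ^+ 2) = k%:M.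
  exact: (simple_central (sk_sq c1 i) sim).
have [i ti] := simple_nonzero sim rt.
have [|eps [rho0 [ps eq0]]] := simple_psi sqrt_rowE rt (_ : t (tperm 0 i 0) != 0).
  by rewrite tpermL.
have [sur [t' [g [ch _]]]] := perm_psi_char sqrt_rowE ps.
have ch' := rep_equiv_char eq0 ch; exists t', g; split=> //.
- exists i; have := char_sq ch' i; rewrite -rmorphXn /= rt !mx2_scalar => /mx2_inj [e _ _ _].
  by rewrite -e.
- exact: rep_equiv_surj eq0 sur.
Qed.

End SimpleRepresentations.

(** * Azumaya points *)

Section Azumaya.
Variables (F : numClosedFieldType) (c : F).
Hypotheses (c0 : c != 0) (c1 : c ^+ 3 != -1) (c8 : c ^+ 3 != 8).
Local Notation S := (sklyanin c).
Local Notation x := (sk_gen c).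
Local Notation Z := (center S).
Local Notation rep := {lrmorphism S -> 'M[F]_2}.
Local Notation chi := (chi c0 c1 c8).
Local Notation mval t r := (mpoly.meval t r).
Local Notation evz := (poly_at (sk_sq c1)).
Implicit Types (rho : rep) (t : 'I_3 -> F) (g : F).

(** The reduced trace of S_c takes values in the center: one central element computes
    the traces in all the representations. *)
Lemma half_trace (a : S) : exists z : Z, forall rho t g, sk_char rho t g ->
  \tr (rho a) = 2 * chi t g z.
Proof.
have [r [a' [b [q ->]]]] := sk_spannedP c1 a.
pose X i := mpoly.mpolyX F (mpoly.mnm1 (i : 'I_3)).
exists (evz (r + (c / 2) *: \sum_i b i * X i) + evz q * altz c0 c1 c8).
move=> rho t g ch; rewrite (char_normal_tr c1 ch) chiD chi_poly.
rewrite (chiM _ _ _ (char_gamma c1 ch)) chi_poly chi_altz.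
rewrite mpoly.mevalD mpoly.mevalZ raddf_sum /=.
under [in RHS]eq_bigr do rewrite mpoly.mevalM mpoly.mevalXU.
by field.
Qed.

Definition half_tr (a : S) : Z := sval (boolp.cid (half_trace a)).

Lemma half_trE rho t g a : sk_char rho t g -> \tr (rho a) = 2 * chi t g (half_tr a).
Proof. by move=> ch; apply: (svalP (boolp.cid (half_trace a))) ch. Qed.

End Azumaya.

Section GramMatrices.
Variable F : numClosedFieldType.

(** The Gram matrix factors through the matrix of coordinates of the E_k, which is
    therefore invertible: the E_k form a basis, and the trace form is nondegenerate. *)
Lemma trace_nondegenerate (E : 'I_4 -> 'M[F]_2) (Y : 'M[F]_2) :
    \det (\matrix_(k, l) \tr (E k * E l)) != 0 ->
  (forall k, \tr (Y * E k) = 0) -> Y = 0.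
Proof.
move=> G0 YE.
have trE (M N : 'M[F]_2) : (mxvec M *m (mxvec N^T)^T) 0 0 = \tr (M * N).
  transitivity (\sum_(p : 'I_2 * 'I_2) M p.1 p.2 * N p.2 p.1).
    rewrite mxE (reindex _ (curry_mxvec_bij _ _)) /=; apply: eq_bigr => -[i j] _.
    by rewrite [(mxvec N^T)^T _ _]mxE /= !mxvecE mxE.
  rewrite -(pair_bigA _ (fun i j => M i j * N j i)) /mxtrace /=.
  by apply: eq_bigr => i _; rewrite mxE.
pose V : 'M[F]_(4, 2 * 2) := \matrix_k mxvec (E k).
pose V' : 'M[F]_(4, 2 * 2) := \matrix_k mxvec (E k)^T.
have GE : \matrix_(k, l) \tr (E k * E l) = V *m V'^T.
  apply/matrixP=> k l; rewrite mxE -trE [RHS]mxE mxE.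
  by apply: eq_bigr => i _; rewrite !mxE.
have uV : (V : 'M_4) \in unitmx.
  rewrite unitmxE unitfE; apply: contraNneq G0 => V0.
  by rewrite GE (det_mulmx (V : 'M_4) (V'^T : 'M_4)) V0 mul0r.
have : (V : 'M_4) *m (mxvec Y^T)^T = 0.
  apply/matrixP=> k l; rewrite (ord1 l) [RHS]mxE -(YE k) mxtraceC -trE !mxE.
  by apply: eq_bigr => i _; rewrite !mxE.
move/(congr1 (mulmx (invmx (V : 'M_4)))); rewrite mulKmx // mulmx0 => /eqP.
rewrite trmx_eq0 => /eqP Y0.
by apply: trmx_inj; apply: (can_inj mxvecK); rewrite Y0 trmx0 linear0.
Qed.

End GramMatrices.

Section AzumayaKernel.
Variables (F : numClosedFieldType) (c : F).
Hypotheses (c0 : c != 0) (c1 : c ^+ 3 != -1) (c8 : c ^+ 3 != 8).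
Local Notation S := (sklyanin c).
Local Notation x := (sk_gen c).
Local Notation Z := (center S).
Local Notation rep := {lrmorphism S -> 'M[F]_2}.
Local Notation chi := (chi c0 c1 c8).
Local Notation half_tr := (half_tr c0 c1 c8).
Implicit Types (rho : rep) (t : 'I_3 -> F) (g : F).

Lemma chi_morph t g : g ^+ 2 = alt_sq_val c t ->
  exists f : {rmorphism Z -> F}, forall z, f z = chi t g z.
Proof.
move=> tg; have zm : zmod_morphism (chi t g).
  by move=> y z; rewrite -scaleN1r chiD chiZ mulN1r.
have mm : monoid_morphism (chi t g).
  by split=> [|y z]; [exact: chi1|exact: chiM].
pose mZ := GRing.isZmodMorphism.Build _ _ (chi t g) zm.
pose mM := GRing.isMonoidMorphism.Build _ _ (chi t g) mm.
pose f : {rmorphism Z -> F} := HB.pack (chi t g) mZ mM.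
by exists f.
Qed.

(** Cramer's rule for the coordinates of a in the e_k, with respect to the trace form.
    It is only available where the determinant of G is invertible; the extra factor
    det G makes both sides vanish elsewhere. *)
Lemma gram_identity (e : 'I_4 -> S) (a : S) :
  let G := \matrix_(k, l) half_tr (e k * e l) in
  val (\det G) * (val (\det G) * a) =
  val (\det G) * \sum_k val (\sum_l \adj G l k * half_tr (a * e l)) * e k.
Proof.
move=> G; apply/eqP; rewrite -subr_eq0; apply/eqP/(sk_faithful c0 c1 c8) => rho t g _ ch _.
have tg := char_gamma c1 ch; have [f fE] := chi_morph tg.
have zE z b : rho (val z * b) = f z *: rho b.
  by rewrite rmorphM /= (rep_chi _ _ _ _ ch) -fE; apply: mul_scalar_mx.
have n2 : (2 : F) != 0 by rewrite pnatr_eq0.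
rewrite rmorphB /= !zE -scalerBr.
have [->|dG] := eqVneq (f (\det G)) 0; first by rewrite scale0r.
suff -> : f (\det G) *: rho a - rho (\sum_k val (\sum_l \adj G l k * half_tr (a * e l)) * e k) = 0.
  by rewrite scaler0.
have trf b : \tr (rho b) = 2 * f (half_tr b) by rewrite fE -(half_trE c0 c1 c8 _ ch).
have GE : \matrix_(k, l) \tr (rho (e k) * rho (e l)) = 2 *: map_mx f G.
  by apply/matrixP=> k l; rewrite !mxE -trf rmorphM.
apply: (@trace_nondegenerate _ (fun k => rho (e k))).
  by rewrite GE detZ det_map_mx mulf_neq0 ?expf_neq0.
move=> n; rewrite mulrBl -scalerAl mxtraceD mxtraceZ -rmorphM.
apply/eqP; rewrite raddfN subr_eq0 -rmorphM /= trf; apply/eqP.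
transitivity (\sum_k \sum_l f (half_tr (a * e l)) * (2 * (f (\adj G l k) * f (G k n)))).
  have adjG l : \sum_k f (\adj G l k) * f (G k n) = f (\det G) *+ (l == n).
    have /(congr1 (fun M : 'M_4 => f (M l n))) := mul_adj_mx G.
    rewrite [(_ *m _) l n]mxE [(_%:M) l n]mxE rmorph_sum rmorphMn /= => <-.
    by apply: eq_bigr => k _; rewrite rmorphM.
  rewrite exchange_big (bigD1 n) //= [X in _ + X]big1 ?addr0 => [|l ln].
    by rewrite -mulr_sumr -mulr_sumr adjG eqxx mulr1n; ring.
  by rewrite -mulr_sumr -mulr_sumr adjG (negPf ln) mulr0n !mulr0.
rewrite mulr_suml rmorph_sum [RHS]raddf_sum; apply: eq_bigr => k _.
rewrite /= -mulrA zE mxtraceZ trf rmorph_sum mulr_suml.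
by apply: eq_bigr => l _; rewrite rmorphM /= [G k n]mxE; ring.
Qed.

Lemma ideal_gen_val (m : set Z) z a : m z -> ideal_gen [set val y | y in m] (val z * a).
Proof.
move=> mz J [_ _ JM] sJ; rewrite -[val z * a](mul1r) mulrA; apply: JM.
by apply: sJ; exists z.
Qed.

Lemma ideal_genD (A : nzRingType) (G : set A) y z :
  ideal_gen G y -> ideal_gen G z -> ideal_gen G (y + z).
Proof. by have [_ + _] := ideal_gen_ideal G; apply. Qed.

Lemma ideal_genM (A : nzRingType) (G : set A) u v z :
  ideal_gen G z -> ideal_gen G (u * z * v).
Proof. by have [_ _ +] := ideal_gen_ideal G; apply. Qed.

(** Lift a basis of the matrices to e_k, so that det G is invertible at the point. If
    rho kills a, then all half traces of the a e_l lie in m, so det G ^ 2 a is in m S_c by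
    Cramer's rule, and so is (1 - det G ^ 2) a. *)
Lemma rep_kernel rho t g : surjective_rep rho -> sk_char rho t g ->
  [set a | rho a = 0] = ideal_gen [set val z | z in [set z | chi t g z = 0]].
Proof.
move=> sur ch; set m := [set z | chi t g z = 0].
have tg := char_gamma c1 ch; have [f fE] := chi_morph tg.
have n2 : (2 : F) != 0 by rewrite pnatr_eq0.
apply/seteqP; split=> [a /= a0|a]; last first.
  apply; first split=> [|y z|y b z] /=; first exact: rmorph0.
  - by move=> y0 z0; rewrite rmorphD /= y0 z0 addr0.
  - by move=> b0; rewrite !rmorphM /= b0 mulr0 mul0r.
  - by move=> _ [z mz <-] /=; rewrite (rep_chi _ _ _ _ ch) mz raddf0.
(* The Gram matrix of 1 and the Pauli matrices for the half trace is the identity. *)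
have /boolp.choice [e eE] k : exists b, rho b = nth 0 [:: 1; sigma F 0; sigma F 1; sigma F 2] (k : 'I_4).
  exact: sur.
pose G := \matrix_(k, l) half_tr (e k * e l).
have fG : f (\det G) = 1.
  rewrite -det_map_mx -(det1 F 4); congr (\det _); apply/matrixP=> k l.
  rewrite !mxE fE; apply: (mulfI n2); rewrite -(half_trE _ _ _ _ ch) rmorphM /= !eE.
  case: k => [[|[|[|[|//]]]] ?]; case: l => [[|[|[|[|//]]]] ?];
    rewrite -val_eqE /= ?sigmaE !mx2E; ring: (imaginary_sq F).
have := gram_identity e a; rewrite -/G /= => id.
have -> : a = val (\det G) * (val (\det G) * a) + val (1 - \det G * \det G) * a.
  by rewrite mulrA -mulrDl rmorphB rmorphM rmorph1 addrC subrK mul1r.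
apply: ideal_genD; last first.
  apply: ideal_gen_val; rewrite /m /= -fE rmorphB rmorphM rmorph1 fG mulr1 subrr //.
rewrite id -[_ * _]mulr1; apply: ideal_genM.
apply: (big_ind (ideal_gen _)) => [|y z|k _].
- by have [] := ideal_gen_ideal [set val z | z in m].
- exact: ideal_genD.
apply: ideal_gen_val; rewrite /m /= -fE rmorph_sum big1 // => l _.
rewrite rmorphM fE; apply/eqP; rewrite mulf_eq0; apply/orP; right.
rewrite fE; have := half_trE c0 c1 c8 (a * e l) ch; rewrite rmorphM /= a0 mul0r raddf0.
by move/esym/eqP; rewrite mulf_eq0 (negPf n2).
Qed.

Lemma azumaya_chi t g : (exists i, t i != 0) -> g ^+ 2 = alt_sq_val c t ->
  azumaya_point [set z | chi t g z = 0].
Proof.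
move=> t0 tg; have [rho sur ch] := point_rep c0 c1 c8 t0 tg.
by exists rho; split=> //; apply: rep_kernel.
Qed.

Lemma rep_point_maximal rho : simple_rep rho -> maximal_ideal (rep_point rho).
Proof.
move=> sim; have [t [g [ch _ _]]] := simple_char c0 c1 c8 sim.
by rewrite (rep_point_chi _ _ _ ch); apply: chi_maximal (char_gamma c1 ch).
Qed.

Lemma maximal_eq (A : nzRingType) (m m' : set A) : maximal_ideal m -> maximal_ideal m' ->
  m `<=` m' -> m = m'.
Proof. by move=> [_ _ mx] [I' m'1 _] mm'; rewrite (mx m'). Qed.

Lemma azumaya_rep m : maximal_ideal m -> azumaya_point m ->
  exists rho, [/\ simple_rep rho, surjective_rep rho & rep_point rho = m].
Proof.
move=> mm [rho [sur ker]]; have sim := surjective_simple sur.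
exists rho; split=> //; apply/esym/maximal_eq => //; first exact: rep_point_maximal.
move=> z mz; rewrite /rep_point /= -[_ = 0]/([set a | rho a = 0] (val z)) ker.
by move=> J _; apply; exists z.
Qed.

End AzumayaKernel.

(** * Dimension of the center *)

Section TranscendenceDegree.
Variables (F : numClosedFieldType) (c : F).
Hypotheses (c0 : c != 0) (c1 : c ^+ 3 != -1) (c8 : c ^+ 3 != 8).
Local Notation S := (sklyanin c).
Local Notation Z := (center S).
Local Notation coords := (coords c0 c1 c8).
Local Notation bounded_coords := (bounded_coords c0 c1 c8).
Local Notation msz := (mpoly.mmeasure mpoly.mdeg).
Implicit Types z : Z.

Lemma poly_atE n (A : comAlgType F) (e : 'I_n -> A) q :
  poly_at e q = mpoly.mmap (in_alg A) e q.
Proof. by rewrite poly_at.unlock. Qed.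

Lemma sk_sq_indep : alg_indep (sk_sq c1).
Proof.
move=> q q0; have : poly_at (sk_sq c1) q = 0 by rewrite poly_atE.
by move/(congr1 coords); rewrite coords_poly coords0 => -[].
Qed.

Lemma poly_at_comp n k (A : comAlgType F) (e : 'I_n -> mpoly.mpoly k F) (e' : 'I_k -> A) q :
  poly_at e' (poly_at e q) = poly_at (fun i => poly_at e' (e i)) q.
Proof.
elim/mpoly_ring_ind: q => [a|i|p q IHp IHq|p q IHp IHq].
- by rewrite !poly_atC mpoly.alg_mpolyC poly_atC.
- by rewrite !poly_atX.
- by rewrite !rmorphD /= IHp IHq.
- by rewrite !rmorphM /= IHp IHq.
Qed.

Lemma meval_poly_at n k (e : 'I_n -> mpoly.mpoly k F) (v : 'I_k -> F) q :
  mpoly.meval v (poly_at e q) = mpoly.meval (fun i => mpoly.meval v (e i)) q.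
Proof.
elim/mpoly_ring_ind: q => [a|i|p q IHp IHq|p q IHp IHq].
- by rewrite poly_atC mpoly.alg_mpolyC !mpoly.mevalC.
- by rewrite poly_atX mpoly.mevalXU.
- by rewrite !rmorphD /= IHp IHq.
- by rewrite !rmorphM /= IHp IHq.
Qed.

(** A relation between the first generators is read as a polynomial in all of them; it
    is nonzero because it does not vanish at some point. *)
Lemma alg_indep_widen n k (nk : (n <= k)%N) (A : comAlgType F) (e : 'I_k -> A) :
  alg_indep e -> alg_indep (fun i => e (widen_ord nk i)).
Proof.
move=> ind q q0; pose X i := mpoly.mpolyX F (mpoly.mnm1 (widen_ord nk i)).
have z0 : poly_at X q = 0.
  apply: ind; rewrite -poly_atE poly_at_comp -[RHS]q0 -poly_atE.
  by congr poly_at; apply: boolp.funext => i; rewrite poly_atX.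
apply/eqP/negPn/negP => /mpoly_nonroot [v]; apply/negP/negPn.
pose v' (i : 'I_k) := if insub (val i) is Some j then v j else 0.
have := congr1 (mpoly.meval v') z0; rewrite rmorph0 meval_poly_at.
have -> : (fun i => mpoly.meval v' (X i)) = v; last by move=> ->.
apply: boolp.funext => i; rewrite mpoly.mevalXU /v' /=.
by case: insubP => [j _ ji|]; [congr v; apply: val_inj|rewrite ltn_ord].
Qed.

Lemma bounded_coordsM a b z z' : bounded_coords a z -> bounded_coords b z' ->
  bounded_coords (a + b + (msz (alt_sq_poly c)).+2) (z * z').
Proof.
move=> /andP[z1 z2] /andP[z'1 z'2]; rewrite /bounded_coords coordsM /=.
have M d d' (p q : mpoly.mpoly 3 F) : (msz p <= d)%N -> (msz q <= d')%N ->
    (msz (p * q)%R <= (d + d').+1)%N.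
  by move=> pd qd; apply: leq_trans (mpoly.msizeM_le _ _) _; rewrite ltnS leq_add.
have D d (p q : mpoly.mpoly 3 F) : (msz p <= d)%N -> (msz q <= d)%N -> (msz (p + q)%R <= d)%N.
  by move=> pd qd; apply: leq_trans (mpoly.msizeD_le _ _) _; rewrite geq_max pd.
apply/andP; split; apply: (D).
- by apply: leq_trans (M _ _ _ _ z1 z'1) _; rewrite addnS ltnS leq_addr.
- apply: leq_trans (M _ _ _ _ (M _ _ _ _ z2 z'2) (leqnn _)) _.
  by rewrite !addnS addSn.
- by apply: leq_trans (M _ _ _ _ z1 z'2) _; rewrite addnS ltnS leq_addr.
- by apply: leq_trans (M _ _ _ _ z2 z'1) _; rewrite addnS ltnS leq_addr.
Qed.

Lemma bounded_coords1 : bounded_coords 1 1.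
Proof. by rewrite /bounded_coords coords1 /= mpoly.msize1 mpoly.msize0. Qed.

Lemma bounded_coordsW a b z : (a <= b)%N -> bounded_coords a z -> bounded_coords b z.
Proof. by move=> ab /andP[z1 z2]; rewrite /bounded_coords (leq_trans z1) ?(leq_trans z2). Qed.

(** The n ^ 4 monomials in four elements with exponents less than n have coordinates of
    degree O(n), hence lie in a space of dimension O(n ^ 3). *)
Lemma trdeg_le3 (e : 'I_4 -> Z) : ~ alg_indep e.
Proof.
move=> ind; pose d0 := (msz (alt_sq_poly c)).+2.
have [K eK] : exists K, forall j, bounded_coords K (e j).
  exists (\max_j (maxn (msz (coords (e j)).1) (msz (coords (e j)).2))) => j.
  by apply/andP; split; apply: leq_trans (leq_bigmax j); rewrite ?leq_maxl ?leq_maxr.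
pose C := (K + d0).+1.
have powC j k : bounded_coords (k * C + 1) (e j ^+ k).
  elim: k => [|k IH]; first by rewrite expr0 bounded_coords1.
  rewrite exprS; apply: bounded_coordsW (bounded_coordsM (eK j) IH); rewrite /C -/d0 mulSn; lia.
(* C' n bounds the degrees of the monomials, and n is such that 2 (n C') ^ 3 < n ^ 4. *)
pose C' := (4 * (C + 1 + d0) + 1)%N; pose n := (2 * C' ^ 3 + 1)%N.
pose I : finType := {ffun 'I_4 -> 'I_n}.
pose mon (h : I) : mpoly.multinom 4 := mpoly.Multinom [tuple (h i : nat) | i < 4].
have cardI : #|I| = (n ^ 4)%N by rewrite card_ffun !card_ord.
pose z (i : 'I_#|I|) := \prod_j e j ^+ (enum_val i j).
have zsmall i : bounded_coords (n * C') (z i).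
  have bnd j : bounded_coords (n * C + 1) (e j ^+ (enum_val i j)).
    by apply: bounded_coordsW (powC j _); rewrite leq_add2r leq_mul2r ltnW ?orbT.
  rewrite /z !big_ord_recl big_ord0 mulr1.
  apply: bounded_coordsW (bounded_coordsM (bnd _) (bounded_coordsM (bnd _) (bounded_coordsM (bnd _) (bnd _)))).
  rewrite -/d0 /C'; have : (0 < n)%N by rewrite /n addn1.
  nia.
have [|v [i0 vi0] v0] := bounded_dependent _ zsmall.
  rewrite cardI expnMn /n; have : (0 < n)%N by rewrite /n addn1.
  rewrite /n; nia.
pose q : mpoly.mpoly 4 F := \sum_i v i *: mpoly.mpolyX F (mon (enum_val i)).
have q0 : q = 0.
  apply: ind; rewrite -poly_atE -v0 /q rmorph_sum; apply: eq_bigr => i _; rewrite /= linearZ /=; congr (_ *: _).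
  rewrite mpoly.mpolyXE_id rmorph_prod; apply: eq_bigr => j _.
  by rewrite /= rmorphXn /= poly_atX mpoly.mnmE.
have := congr1 (mpoly.mcoeff (mon (enum_val i0))) q0; rewrite mpoly.mcoeff0 raddf_sum /=.
rewrite (bigD1 i0) //= big1 ?addr0 => [|i ii0].
  by rewrite mpoly.mcoeffZ mpoly.mcoeffX eqxx mulr1 => /eqP; rewrite (negPf vi0).
rewrite mpoly.mcoeffZ mpoly.mcoeffX; case: eqP => [e0|]; last by rewrite mulr0.
case/eqP: ii0; apply: enum_val_inj; apply/ffunP=> j; apply: val_inj.
by have := congr1 (fun m => mpoly.fun_of_multinom m j) e0; rewrite !mpoly.mnmE.
Qed.

Lemma center_dim n : variety_dim Z n <-> n = 3.
Proof.
split=> [[[e ind] no]|->]; last first.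
  by split; [exists (sk_sq c1); apply: sk_sq_indep|move=> [e]; apply: trdeg_le3].
case: (ltngtP n 3) => // n3.
  by case: no; exists (fun i => sk_sq c1 (widen_ord n3 i)); apply/alg_indep_widen/sk_sq_indep.
by case: (@trdeg_le3 (fun i => e (widen_ord n3 i))); apply: alg_indep_widen.
Qed.

End TranscendenceDegree.

(** * Cotangent spaces of the center *)

Section CotangentSpace.
Variables (F : numClosedFieldType) (c : F).
Hypotheses (c0 : c != 0) (c1 : c ^+ 3 != -1) (c8 : c ^+ 3 != 8).
Local Notation S := (sklyanin c).
Local Notation Z := (center S).
Local Notation P := (mpoly.mpoly 3 F).
Local Notation coords := (coords c0 c1 c8).
Local Notation chi := (chi c0 c1 c8).
Local Notation altz := (altz c0 c1 c8).
Local Notation evz := (poly_at (sk_sq c1)).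
Local Notation mval t r := (mpoly.meval t r).
Implicit Types z : Z.

Variables (t : 'I_3 -> F) (g : F).
Hypothesis tg : g ^+ 2 = alt_sq_val c t.

Definition point_ideal : set Z := [set z | chi t g z = 0].
Definition point_sq : set Z := ideal_gen [set y * z | y in point_ideal & z in point_ideal].

Lemma point_ideal_maximal : maximal_ideal point_ideal.
Proof. exact: chi_maximal tg. Qed.

(** The coordinates of the affine space containing the hypersurface: t_0, t_1, t_2 and,
    at the last index, g. *)
Definition four_vector (a : 'I_3 -> F) (b : F) (k : 'I_4) : F :=
  if unlift ord_max k is Some i then a i else b.

Definition local_gen (k : 'I_4) : Z :=
  if unlift ord_max k is Some i then sk_sq c1 i - t i *: 1 else altz - g *: 1.

Lemma sum4 (V : nmodType) (f : 'I_4 -> V) :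
  \sum_k f k = f ord_max + \sum_i f (lift ord_max i).
Proof. by rewrite (bigD1_ord ord_max). Qed.

Lemma four_vector_lift a b i : four_vector a b (lift ord_max i) = a i.
Proof. by rewrite /four_vector liftK. Qed.
Lemma four_vector_max a b : four_vector a b ord_max = b.
Proof. by rewrite /four_vector unlift_none. Qed.

Lemma local_gen_point k : point_ideal (local_gen k).
Proof.
rewrite /point_ideal /= /local_gen; case: (unlift ord_max k) => [i|].
  by rewrite -scaleN1r chiD !chiZ chi_sq chi1; ring.
by rewrite -scaleN1r chiD !chiZ chi_altz chi1; ring.
Qed.

Lemma point_sq0 : point_sq 0. Proof. by have [] := ideal_gen_ideal [set y * z | y in point_ideal & z in point_ideal]. Qed.
Lemma point_sqD y z : point_sq y -> point_sq z -> point_sq (y + z). Proof. exact: ideal_genD. Qed.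
Lemma point_sqM a z : point_sq z -> point_sq (a * z).
Proof. by move=> mz; rewrite -[_ * _]mulr1; apply: ideal_genM. Qed.
Lemma point_sqZ k z : point_sq z -> point_sq (k *: z).
Proof. by move=> mz; rewrite -[z]mul1r scalerAl; apply: point_sqM. Qed.
Lemma point_sq_mul y z : point_ideal y -> point_ideal z -> point_sq (y * z).
Proof. by move=> my mz J _; apply; exists y => //; exists z. Qed.

Definition local_comb (a : 'I_4 -> F) : Z := \sum_k a k *: local_gen k.

Lemma local_combD a b : local_comb (fun k => a k + b k) = local_comb a + local_comb b.
Proof. by rewrite /local_comb -big_split; apply: eq_bigr => k _; rewrite scalerDl. Qed.
Lemma local_comb_scale l a : local_comb (fun k => l * a k) = l *: local_comb a.
Proof. by rewrite /local_comb scaler_sumr; apply: eq_bigr => k _; rewrite scalerA. Qed.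
Lemma local_comb_point a : point_ideal (local_comb a).
Proof.
rewrite /local_comb; apply: (big_ind point_ideal) => [|y z|k _].
- exact: (max_ideal0 point_ideal_maximal).
- exact: (max_idealD point_ideal_maximal).
- exact/(max_idealZ point_ideal_maximal)/local_gen_point.
Qed.

(** First-order Taylor expansion at the point: k is the value and a the differential. *)
Definition jet z k a := point_sq (z - k *: 1 - local_comb a).

Lemma jet_const k : jet (k *: 1) k (fun=> 0).
Proof.
rewrite /jet subrr sub0r /local_comb big1 ?oppr0 //; first exact: point_sq0.
by move=> i _; rewrite scale0r.
Qed.

Lemma jetD y k a z l b : jet y k a -> jet z l b -> jet (y + z) (k + l) (fun i => a i + b i).
Proof.
rewrite /jet => jy jz; have -> : y + z - (k + l) *: 1 - local_comb (fun i => a i + b i) =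
    (y - k *: 1 - local_comb a) + (z - l *: 1 - local_comb b).
  by rewrite local_combD scalerDl !opprD (addrACA y) (addrACA (y - k *: 1)).
exact: point_sqD.
Qed.

Lemma jetM y k a z l b : jet y k a -> jet z l b ->
  jet (y * z) (k * l) (fun i => k * b i + l * a i).
Proof.
rewrite /jet local_combD !local_comb_scale => jy jz.
have E (A : comAlgType F) (y' z' p q : A) : y' * z' - (k * l) *: 1 - (k *: q + l *: p) =
    z' * (y' - k *: 1 - p) + (k *: 1 + p) * (z' - l *: 1 - q) + p * q.
  rewrite -[k *: q]mulr_algl -[l *: p]mulr_algl -scalerA -[k *: (l *: 1)]mulr_algl.
  by move: (k *: 1) (l *: 1) => K L; ring.
rewrite E; apply: point_sqD; last exact: point_sq_mul (local_comb_point a) (local_comb_point b).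
by apply: point_sqD; apply: point_sqM.
Qed.

Definition grad (r : P) (i : 'I_3) : F := mval t (mpoly.mderiv i r).

Lemma jet_ext z k a k' a' : k = k' -> a =1 a' -> jet z k a -> jet z k' a'.
Proof. by move=> -> /boolp.funext ->. Qed.

Lemma local_comb_delta k : local_comb (fun j => (k == j)%:R) = local_gen k.
Proof.
rewrite /local_comb (bigD1 k) //= eqxx scale1r big1 ?addr0 // => j /negPf jk.
by rewrite eq_sym jk scale0r.
Qed.

Lemma jet_sq i : jet (sk_sq c1 i) (t i) (fun j => (lift ord_max i == j)%:R).
Proof. by rewrite /jet local_comb_delta /local_gen liftK subrr; apply: point_sq0. Qed.

Lemma jet_altz : jet altz g (fun j => (ord_max == j)%:R).
Proof. by rewrite /jet local_comb_delta /local_gen unlift_none subrr; apply: point_sq0. Qed.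

Lemma gradX i j : grad (mpoly.mpolyX F (mpoly.mnm1 i)) j = (i == j)%:R.
Proof.
rewrite /grad mpoly.mderivX mpoly.mnm1E mpoly.mevalZ.
case: eqP => [<-|_]; last by rewrite mul0r.
rewrite mul1r (_ : mpoly.mnm_sub _ _ = mpoly.mnm0) ?mpoly.mpolyX0 ?rmorph1 //.
by apply/mpoly.mnmP=> k; rewrite mpoly.mnmBE subnn mpoly.mnm0E.
Qed.

(** Taylor's formula, from the generators of the polynomial ring and the Leibniz rule. *)
Lemma jet_poly r : jet (evz r) (mval t r) (four_vector (grad r) 0).
Proof.
elim/mpoly_ring_ind: r => [k|i|p q IHp IHq|p q IHp IHq].
- rewrite poly_atC; apply: jet_ext (jet_const k); first by rewrite mpoly.mevalC.
  move=> j; rewrite /four_vector; case: unlift => // i.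
  by rewrite /grad mpoly.mderivC rmorph0.
- rewrite poly_atX; apply: jet_ext (jet_sq i); first by rewrite mpoly.mevalXU.
  move=> j; rewrite /four_vector; case: unliftP => [k ->|->]; first by rewrite gradX (inj_eq lift_inj).
  by rewrite eq_sym eq_liftF.
- rewrite rmorphD; apply: jet_ext (jetD IHp IHq); first by rewrite rmorphD.
  move=> j; rewrite /four_vector; case: unlift => [k|]; last by rewrite addr0.
  by rewrite /grad mpoly.mderivD rmorphD.
- rewrite rmorphM; apply: jet_ext (jetM IHp IHq); first by rewrite rmorphM.
  move=> j; rewrite /four_vector; case: unlift => [k|]; last by rewrite !mulr0 addr0.
  rewrite /grad mpoly.mderivM rmorphD !rmorphM /= addrC.
  by rewrite [mval t q * _]mulrC.
Qed.

Lemma jet_exists z : exists a, jet z (chi t g z) a.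
Proof.
have j := jetD (jet_poly (coords z).1) (jetM (jet_poly (coords z).2) jet_altz).
by rewrite -coordsE in j; eexists; exact: j.
Qed.

(** The gradient of alt_sq_val t - g ^+ 2. *)
Definition conormal : 'I_4 -> F := four_vector (grad (alt_sq_poly c)) (- (2 * g)).

Lemma conormal_relation : point_sq (local_comb conormal).
Proof.
have jD := jet_poly (alt_sq_poly c); rewrite -(altz_square c0 c1 c8) alt_sq_polyE -tg in jD.
have jA := jetM jet_altz jet_altz; rewrite -expr2 in jA.
have := point_sqD jA (point_sqZ (-1) jD); rewrite scaleN1r opprB.
set y := altz * altz - _; set la := local_comb _; set lb := local_comb _.
have -> : y - la + (lb - y) = lb - la by rewrite addrC addrA subrK.
rewrite /lb /la -scaleN1r -local_comb_scale -local_combD; congr (point_sq (local_comb _)).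
apply: boolp.funext => k; rewrite /conormal /four_vector eq_sym; case: unliftP => [i ->|->].
  by rewrite eq_sym eq_liftF /=; ring.
by rewrite eqxx /=; ring.
Qed.

(** The derivative along w. It depends on the chosen coordinates, and is a derivation of
    the center when w is orthogonal to the conormal vector, that is, tangent. *)
Definition tangent_form (w : 'I_4 -> F) z : F :=
  \sum_i w (lift ord_max i) * (grad (coords z).1 i + g * grad (coords z).2 i)
  + w ord_max * mval t (coords z).2.

Lemma gradD p q i : grad (p + q) i = grad p i + grad q i.
Proof. by rewrite /grad mpoly.mderivD rmorphD. Qed.
Lemma gradZ k p i : grad (k *: p) i = k * grad p i.
Proof. by rewrite /grad mpoly.mderivZ mpoly.mevalZ. Qed.
Lemma gradM p q i : grad (p * q) i = grad p i * mval t q + mval t p * grad q i.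
Proof. by rewrite /grad mpoly.mderivM rmorphD !rmorphM. Qed.

Lemma tangent_formD w y z : tangent_form w (y + z) = tangent_form w y + tangent_form w z.
Proof.
rewrite /tangent_form coordsD /= rmorphD /= mulrDr addrACA -big_split; congr (_ + _).
by apply: eq_bigr => i _; rewrite !gradD /=; ring.
Qed.

Lemma tangent_formZ w k z : tangent_form w (k *: z) = k * tangent_form w z.
Proof.
rewrite /tangent_form coordsZ /= mpoly.mevalZ mulrDr; congr (_ + _); last by ring.
by rewrite mulr_sumr; apply: eq_bigr => i _; rewrite !gradZ; ring.
Qed.

Lemma tangent_formM w y z : \sum_k w k * conormal k = 0 ->
  tangent_form w (y * z) = chi t g y * tangent_form w z + chi t g z * tangent_form w y.
Proof.
rewrite sum4 /conormal four_vector_max; under eq_bigr do rewrite four_vector_lift.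
move=> wD; have {}wD : \sum_i w (lift ord_max i) * grad (alt_sq_poly c) i = w ord_max * (2 * g).
  by move/eqP: wD; rewrite mulrN addrC subr_eq0 => /eqP.
rewrite /tangent_form /chi coordsM /= rmorphD !rmorphM /=.
set r := (coords y).1; set q := (coords y).2; set r' := (coords z).1; set q' := (coords z).2.
transitivity (mval t q * mval t q' * (\sum_i w (lift ord_max i) * grad (alt_sq_poly c) i) +
  (mval t r + mval t q * g) * (\sum_i w (lift ord_max i) * (grad r' i + g * grad q' i))
  + (mval t r' + mval t q' * g) * (\sum_i w (lift ord_max i) * (grad r i + g * grad q i))
  + w ord_max * (mval t r * mval t q' + mval t q * mval t r')).
  congr (_ + _); rewrite ![_ * (\sum_(i < 3) _)]mulr_sumr -!big_split; apply: eq_bigr => i _ /=.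
  rewrite !gradD !gradM rmorphM /= alt_sq_polyE -tg; ring.
by rewrite wD; ring.
Qed.

Lemma tangent_form_gen w k : tangent_form w (local_gen k) = w k.
Proof.
have d1 : tangent_form w 1 = 0.
  by rewrite /tangent_form coords1 /= /grad -(mpoly.mpolyC1) big1 => [|i _];
     rewrite ?mpoly.mderivC ?mpoly.mderiv0 !rmorph0 ?mulr0 ?addr0 ?mulr0.
rewrite /local_gen; case: unliftP => [i ->|->]; rewrite -scaleN1r tangent_formD !tangent_formZ d1 !mulr0 addr0.
  rewrite -(poly_atX (sk_sq c1)) /tangent_form coords_poly /= rmorph0 mulr0 addr0.
  rewrite (bigD1 i) //= big1 ?addr0 => [|j ji].
    by rewrite gradX eqxx /grad mpoly.mderiv0 rmorph0 mulr0 addr0 mulr1.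
  by rewrite gradX eq_sym (negPf ji) /grad mpoly.mderiv0 mpoly.meval0 !mulr0 addr0 mulr0.
rewrite /tangent_form coords_altz /= rmorph1 mulr1 big1 ?add0r // => i _.
by rewrite /grad mpoly.mderiv0 -(mpoly.mpolyC1) mpoly.mderivC !rmorph0 mulr0 addr0 mulr0.
Qed.

Lemma tangent_form_comb w a : tangent_form w (local_comb a) = \sum_k a k * w k.
Proof.
have d0 : tangent_form w 0 = 0 by rewrite -(scale0r 0) tangent_formZ mul0r.
by rewrite /local_comb (big_morph _ (tangent_formD w) d0); apply: eq_bigr => k _; rewrite tangent_formZ tangent_form_gen.
Qed.

(** A derivation at the point annihilates the square of the maximal ideal; this bounds
    the dimension of the cotangent space from below. *)
Lemma tangent_form_sq w z : \sum_k w k * conormal k = 0 -> point_sq z -> tangent_form w z = 0.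
Proof.
move=> wn mz; have [] : chi t g z = 0 /\ tangent_form w z = 0; last by [].
apply: (mz [set y | chi t g y = 0 /\ tangent_form w y = 0]); first split=> /=.
- by rewrite chi0 -(scale0r 0) tangent_formZ mul0r.
- by move=> y y' [cy dy] [cy' dy']; rewrite chiD tangent_formD cy dy cy' dy' !addr0.
- move=> a y b [cy dy]; rewrite !(chiM _ _ _ tg) !tangent_formM // !(chiM _ _ _ tg) cy dy.
  by rewrite !(mulr0, mul0r, addr0).
- move=> _ [y my [y' my' <-]] /=; rewrite (chiM _ _ _ tg) tangent_formM //.
  by rewrite my my' !(mulr0, mul0r, addr0).
Qed.

(** The relation given by the conormal vector eliminates the j-th local generator. The
    three others are independent: for each of them there is a tangent vector w, with
    w_j adjusted, on which it takes the value 1 and the other two the value 0. *)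
Lemma cotangent_regular j : conormal j != 0 -> cotangent_dim point_ideal 3.
Proof.
move=> nj; exists (fun i => local_gen (lift j i)); split=> [i|z mz|a az i0].
- exact: local_gen_point.
- have [a] := jet_exists z; rewrite mz /jet scale0r subr0 => ja.
  exists (fun i => a (lift j i) - a j / conormal j * conormal (lift j i)).
  have := point_sqD ja (point_sqZ (a j / conormal j) conormal_relation); congr (point_sq _).
  rewrite /local_comb !(bigD1_ord j) //= scalerDr scalerA divfK // scaler_sumr.
  under [in RHS]eq_bigr do rewrite scalerBl -scalerA.
  by rewrite sumrB opprD (addrA z) addrACA subrK opprB [- _ + _]addrC.
- pose w k : F := if unlift j k is Some i then (i == i0)%:R else - (conormal (lift j i0) / conormal j).
  have wj : w j = - (conormal (lift j i0) / conormal j) by rewrite /w unlift_none.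
  have wl i : w (lift j i) = (i == i0)%:R by rewrite /w liftK.
  have wn : \sum_k w k * conormal k = 0.
    rewrite (bigD1_ord j) //= wj mulNr divfK // (bigD1 i0) //= wl eqxx mul1r addKr.
    by rewrite big1 // => i /negPf ii0; rewrite wl ii0 mul0r.
  have d0 : tangent_form w 0 = 0 by rewrite -(scale0r 0) tangent_formZ mul0r.
  have := tangent_form_sq wn az; rewrite (big_morph _ (tangent_formD w) d0) (bigD1 i0) //=.
  rewrite tangent_formZ tangent_form_gen wl eqxx mulr1 big1 ?addr0 // => i /negPf ii0.
  by rewrite tangent_formZ tangent_form_gen wl ii0 mulr0.
Qed.

(** When the conormal vector vanishes all vectors are tangent, so that the four local
    generators are independent modulo the square of the ideal. *)
Lemma cotangent_singular : (forall k, conormal k = 0) -> ~ cotangent_dim point_ideal 3.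
Proof.
move=> n0 [e [em espan _]].
have /boolp.choice [A AE] k := espan _ (local_gen_point k).
pose M : 'M[F]_(4, 3) := \matrix_(k, i) A k i.
have : kermx M != 0.
  rewrite kermx_eq0 /row_free; apply/eqP => rM.
  by have := rank_leq_col M; rewrite rM.
case/rowV0Pn => v /sub_kermxP vM v0.
have l2 : point_sq (local_comb (v 0)).
  have -> : local_comb (v 0) = \sum_k v 0 k *: (local_gen k - \sum_i A k i *: e i).
    rewrite /local_comb; under [RHS]eq_bigr do rewrite scalerBr.
    rewrite sumrB; apply/eqP; rewrite -subr_eq0 opprB addrC subrK; apply/eqP.
    under eq_bigr do rewrite scaler_sumr.
    rewrite exchange_big big1 // => i _ /=; under eq_bigr do rewrite scalerA.
    rewrite -scaler_suml; have /rowP/(_ i) := vM; rewrite !mxE.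
    by under eq_bigr do rewrite mxE; move=> ->; rewrite scale0r.
  apply: (big_ind point_sq) => [|y z|k _]; [exact: point_sq0|exact: point_sqD|].
  by apply: point_sqZ; apply: AE.
case/eqP: v0; apply/rowP=> k; rewrite mxE.
have wn : \sum_l (k == l)%:R * conormal l = 0 by rewrite big1 // => l _; rewrite n0 mulr0.
have := tangent_form_sq wn l2; rewrite tangent_form_comb (bigD1 k) //= eqxx mulr1 big1 ?addr0 // => l /negPf lk.
by rewrite eq_sym lk mulr0.
Qed.

End CotangentSpace.

(** * The singular point *)

Section Smoothness.
Variables (F : numClosedFieldType) (c : F).
Hypotheses (c0 : c != 0) (c1 : c ^+ 3 != -1) (c8 : c ^+ 3 != 8).
Implicit Types (t : 'I_3 -> F) (g : F).

Lemma grad_alt_sq t i j k : j != i -> k != i -> j != k ->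
  grad t (alt_sq_poly c) i = 3 * c ^+ 2 * t i ^+ 2 - (4 + c ^+ 3) * (t j * t k).
Proof.
have gradN (p : mpoly.mpoly 3 F) l : grad t (- p) l = - grad t p l.
  by rewrite -scaleN1r gradZ mulN1r.
rewrite alt_sq_poly.unlock !exprS !expr0 !mulr1 !gradD gradN !gradZ !gradD !gradM.
rewrite !gradX !mpoly.mevalM !mpoly.mevalXU.
by case: (ord3P i) => ->; case: (ord3P j) => -> //; case: (ord3P k) => -> // _ _ _ /=; ring.
Qed.

(** Vanishing partial derivatives give s t_i ^ 3 = K Q for all i, with s = 3 c^2,
    K = 4 + c^3 and Q = t_0 t_1 t_2. The product of the three equations is
    s^3 Q^3 = K^3 Q^3, and s^3 - K^3 = - (c^3 + 1) (c^3 - 8)^2 is nonzero; so Q = 0, and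
    then t = 0. *)
Lemma conormal_neq0 t g : (exists i, t i != 0) -> g ^+ 2 = alt_sq_val c t ->
  exists j, conormal c t g j != 0.
Proof.
move=> [i0 ti0] tg; apply/existsP; apply: contraT; rewrite negb_exists => /forallP n0.
have n3 : (3 : F) != 0 by rewrite pnatr_eq0.
pose s := 3 * c ^+ 2; pose K := 4 + c ^+ 3.
have s0 : s != 0 by rewrite mulf_neq0 ?expf_neq0.
have E i j k : j != i -> k != i -> j != k -> s * t i ^+ 2 = K * (t j * t k).
  move=> ji ki jk; have := n0 (lift ord_max i); rewrite negbK /conormal four_vector_lift.
  by rewrite (grad_alt_sq _ ji ki jk) subr_eq0 => /eqP.
pose Q := t 0 * t 1 * t 2.
have cube i : s * t i ^+ 3 = K * Q.
  rewrite exprSr mulrA /Q; case: (ord3P i) => ->.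
  - by rewrite (E 0 1 2) //; ring.
  - by rewrite (E 1 0 2) //; ring.
  - by rewrite (E 2 0 1) //; ring.
have KQ0 : K * Q != 0 by rewrite -(cube i0) mulf_neq0 ?expf_neq0.
have Q0 : Q != 0 by apply: contraNneq KQ0 => ->; rewrite mulr0.
have : (s ^+ 3 - K ^+ 3) * Q ^+ 3 = 0.
  have -> : (s ^+ 3 - K ^+ 3) * Q ^+ 3 =
      (s * t 0 ^+ 3) * (s * t 1 ^+ 3) * (s * t 2 ^+ 3) - (K * Q) ^+ 3 by rewrite /Q; ring.
  by rewrite !cube; ring.
move/eqP; rewrite mulf_eq0 expf_eq0 (negPf Q0) /= orbF.
have -> : s ^+ 3 - K ^+ 3 = - ((c ^+ 3 + 1) * (c ^+ 3 - 8) ^+ 2) by rewrite /s /K; ring.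
by rewrite oppr_eq0 mulf_eq0 expf_eq0 /= addr_eq0 subr_eq0 (negPf c1) (negPf c8).
Qed.

Lemma smooth_chi t g : (exists i, t i != 0) -> g ^+ 2 = alt_sq_val c t ->
  smooth_point [set z | chi c0 c1 c8 t g z = 0].
Proof.
move=> t0 tg; have [j nj] := conormal_neq0 t0 tg; exists 3%N; split.
  by apply/center_dim.
exact: cotangent_regular nj.
Qed.

Lemma singular_origin : ~ smooth_point [set z | chi c0 c1 c8 (fun=> 0) 0 z = 0].
Proof.
have D0 : 0 ^+ 2 = alt_sq_val c (fun=> 0) by rewrite /alt_sq_val !expr0n /= !mulr0 !addr0 subr0 mulr0.
move=> [n [/(center_dim c0 c1 c8) ->]]; apply: (cotangent_singular D0) => k.
rewrite /conormal /four_vector; case: unlift => [i|]; last by rewrite mulr0 oppr0.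
have [j ji] : exists j, j != i by exists (i + 1); case: (ord3P i) => ->.
have [l lj li] := third_index ji; rewrite eq_sym in lj.
by rewrite (grad_alt_sq _ ji li lj) expr0n !mulr0 subr0.
Qed.

End Smoothness.

(** * Uniqueness in the family *)

Section PsiFamily.
Variables (F : numClosedFieldType) (c : F).
Hypotheses (c0 : c != 0) (c1 : c ^+ 3 != -1) (c8 : c ^+ 3 != 8).
Local Notation S := (sklyanin c).
Local Notation x := (sk_gen c).
Local Notation Z := (center S).
Local Notation rep := {lrmorphism S -> 'M[F]_2}.
Local Notation chi := (chi c0 c1 c8).
Variable sq : 'rV[F]_3 -> 'rV[F]_3.
Hypothesis sqE : forall p : 'rV[F]_3, p 0 0 != 0 -> forall j, sq p 0 j ^+ 2 = Delta c p 0 j.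
Implicit Types (rho : rep) (t : 'I_3 -> F) (g : F) (p : 'rV[F]_3) (m : set Z).

Lemma psi_rep_perm p eps rho : psi_rep sq p eps rho <-> perm_psi_rep sq 1%g p eps rho.
Proof. by split=> -[p0 H]; split=> // i; have := H i; rewrite perm1. Qed.

Lemma rep_equiv_point rho rho' : rep_equiv rho rho' -> rep_point rho = rep_point rho'.
Proof.
move=> [h uh hE]; apply/seteqP; split=> z; rewrite /rep_point /= => z0.
  by apply: (mulIr uh); rewrite mul0r -[LHS]hE z0 mulmx0.
by apply: (mulrI uh); rewrite mulr0 [LHS]hE z0 mul0mx.
Qed.

Lemma chi_point_inj t g t' g' :
  [set z | chi t g z = 0] = [set z | chi t' g' z = 0] -> t = t' /\ g = g'.
Proof.
move=> e; split.
  apply: boolp.funext => i.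
  have : [set z | chi t g z = 0] (sk_sq c1 i - t i *: 1).
    by rewrite /= -scaleN1r chiD !chiZ chi_sq chi1; ring.
  rewrite e /= -scaleN1r chiD !chiZ chi_sq chi1 => /eqP.
  by rewrite mulN1r mulr1 subr_eq0 => /eqP.
have : [set z | chi t g z = 0] (altz c0 c1 c8 - g *: 1).
  by rewrite /= -scaleN1r chiD !chiZ chi_altz chi1; ring.
rewrite e /= -scaleN1r chiD !chiZ chi_altz chi1 => /eqP.
by rewrite mulN1r mulr1 subr_eq0 => /eqP.
Qed.

Lemma psi_char p eps rho : psi_rep sq p eps rho -> exists g,
  surjective_rep rho /\ sk_char rho (fun i => 2 * p 0 i) g.
Proof.
move=> /psi_rep_perm /(perm_psi_char c0 c8 sqE) [sur [t [g [ch tE]]]]; exists g.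
by split=> //; rewrite (_ : (fun i => _) = t) //; apply: boolp.funext => i; rewrite -tE perm1.
Qed.

(** The point below determines (t, g). Opposite signs at the same p have opposite g, so
    they lie over the same point only if g = 0, that is, det Q = 0. *)
Lemma psi_unique p eps rho p' eps' rho' : psi_rep sq p eps rho -> psi_rep sq p' eps' rho' ->
  rep_point rho = rep_point rho' -> p' = p /\ (eps' = eps \/ discr_at c p = 0).
Proof.
move=> ps ps'; have [g [_ ch]] := psi_char ps; have [g' [_ ch']] := psi_char ps'.
rewrite (rep_point_chi c0 c1 c8 ch) (rep_point_chi c0 c1 c8 ch') => /chi_point_inj [tt' gg'].
have n2 : (2 : F) != 0 by rewrite pnatr_eq0.
have pp : p' = p.
  by apply/rowP=> i; apply: (mulfI n2); have := congr1 (fun f => f i) tt'.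
split=> //; have [->|ee] := eqVneq eps' eps; first by left.
right; have gN : g' = - g.
  rewrite -(char_trace c1 ch) -(char_trace c1 ch'); have [_ H] := ps; have [_ H'] := ps'.
  have flip := psi_triple_flip c sq p 0 1 2.
  rewrite !H !H' pp; move: ee; case: eps {ps H}; case: eps' {ps' H'} => // _.
  by rewrite flip opprK.
have gz : g = 0.
  have : 2 * g = 0 by rewrite mulr_natl mulr2n {1}gg' gN addNr.
  by move/eqP; rewrite mulf_eq0 (negPf n2) => /eqP.
have n4 : (4 : F) != 0 by rewrite pnatr_eq0.
have D0 : alt_sq_val c (fun i => 2 * p 0 i) = 0 by rewrite -(char_gamma c1 ch) gz expr0n.
apply: (mulfI n4); rewrite mulr0 -[RHS]oppr0 -D0 /discr_at discrE /alt_sq_val; ring.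
Qed.

Lemma psi_exists p eps : p 0 0 != 0 -> exists rho, psi_rep sq p eps rho.
Proof.
move=> p0; have [rho rhoE] := clifford_rep 1%g (psi_clifford c0 c8 sqE eps p0).
by exists rho; split=> // i; rewrite -rhoE perm1.
Qed.

Lemma rep_point_sq rho t g i : sk_char rho t g -> rep_point rho (sk_sq c1 i) <-> t i = 0.
Proof. by move=> ch; rewrite (rep_point_chi c0 c1 c8 ch) /= chi_sq. Qed.

End PsiFamily.

(** * Uncountability of the complex numbers *)

Section Uncountable.
Variable R : realType.

(** Among k disjoint closed subintervals of [a, b] one avoids A: a point of A in each of
    them would give k distinct points. The gaps between them make the points distinct. *)
Lemma avoid_finite (A : set R) k (a b : R) : a < b ->
    (forall s : seq R, uniq s -> size s = k -> ~ (forall y, y \in s -> A y)) ->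
  exists a' b', [/\ a <= a', a' < b', b' <= b & forall y, a' <= y <= b' -> ~ A y].
Proof.
move=> ab fin; have [k0|k0] := posnP k.
  by case: (fin [::]) => //; rewrite k0.
pose d := (b - a) / (2 * k)%:R.
have kR : (0 : R) < (2 * k)%:R by rewrite ltr0n muln_gt0.
have d0 : 0 < d by rewrite divr_gt0 ?subr_gt0.
pose lo (j : nat) := a + (2 * j)%:R * d; pose hi (j : nat) := a + (2 * j).+1%:R * d.
have [[j jk jA]|no] := pselect (exists2 j, (j < k)%N & forall y, lo j <= y <= hi j -> ~ A y).
  exists (lo j), (hi j); split=> //.
  - by rewrite lerDl mulr_ge0 ?ler0n ?ltW.
  - by rewrite ltrD2l ltr_pM2r // ltr_nat.
  - rewrite -lerBrDl -[leRHS](divfK (lt0r_neq0 kR)) mulrC ler_pM2l // ler_nat.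
    by move: jk; clear; lia.
have /boolp.choice [y yP] (j : 'I_k) : exists y, lo j <= y <= hi j /\ A y.
  apply: contrapT => nj; apply: no; exists j => // y yj Ay.
  by apply: nj; exists y.
case: (fin [seq y j | j <- enum 'I_k]).
- rewrite map_inj_uniq ?enum_uniq // => i j.
  wlog: i j / (i <= j)%N => [H yij|].
    by case: (leqP i j) => ij; [exact: H|apply/esym/H => //; exact: ltnW].
  rewrite leq_eqVlt => /orP[/eqP/val_inj //|ij] yij; exfalso.
  have [/andP[_ yi] _] := yP i; have [/andP[yj _] _] := yP j.
  have : lo j <= hi i by rewrite (le_trans yj) // -yij.
  by rewrite lerD2l ler_pM2r // ler_nat; move: ij; clear; lia.
- by rewrite size_map size_enum_ord.
- by move=> _ /mapP [j _ ->]; have [] := yP j.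
Qed.

(** Cantor's nested intervals: if each sublevel set of f were finite, closed intervals
    avoiding them one after the other would have a common point, on which f would
    exceed every natural number. *)
Lemma real_infinite_fibre : infinite_fibre R.
Proof.
move=> f; apply: contrapT => /forallNP no.
have step (N : nat) (I : R * R) : exists J : R * R, I.1 < I.2 ->
    [/\ I.1 <= J.1, J.1 < J.2, J.2 <= I.2 & forall y, J.1 <= y <= J.2 -> (N < f y)%N].
  have [I12|] := boolP (I.1 < I.2); last by exists I.
  have /existsNP [k nok] := no N.
  have [|a [b [Ia ab bI H]]] := @avoid_finite [set y | (f y <= N)%N] k _ _ I12.
    by move=> s us ss sN; apply: nok; exists s; split=> //; apply/allP.
  by exists (a, b) => _; split=> // y yJ; rewrite ltnNge; apply/negP/H.
have /boolp.choice [G GP] (NI : nat * (R * R)) := step NI.1 NI.2.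
pose J := fix J n := if n is n'.+1 then G (n', J n') else (0, 1) : R * R.
have J12 n : (J n).1 < (J n).2.
  elim: n => [|n IH] /=; first exact: ltr01.
  by have [] := GP (n, J n) IH.
have mono n k : (J n).1 <= (J (n + k)%N).1 /\ (J (n + k)%N).2 <= (J n).2.
  elim: k => [|k [IH1 IH2]]; first by rewrite addn0.
  rewrite addnS /=; have [le1 _ le2 _] := GP ((n + k)%N, J (n + k)%N) (J12 _).
  by split; [exact: le_trans IH1 le1|exact: le_trans le2 IH2].
have cross n k : (J n).1 <= (J k).2.
  have [le1 _] := mono n k; have [_ le2] := mono k n; rewrite addnC in le2.
  by apply: le_trans le1 (le_trans (ltW (J12 _)) le2).
pose E : set R := [set (J n).1 | n in setT].
have supE : has_sup E.
  by split; [exists (J 0).1; exists 0|exists (J 0).2 => _ [n _ <-]; apply: cross].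
pose y := sup E.
have yJ n : (J n).1 <= y <= (J n).2.
  apply/andP; split; first by apply: sup_upper_bound => //; exists n.
  by apply: sup_le_ub => [|_ [k _ <-]]; [case: supE|apply: cross].
have [_ _ _ /(_ y)] := GP (f y, J (f y)) (J12 _).
by move=> /(_ (yJ (f y).+1)); rewrite ltnn.
Qed.

Lemma complex_infinite_fibre : infinite_fibre (complex R).
Proof.
move=> f; have [N NP] := real_infinite_fibre (fun y => f (real_complex R y)).
exists N => k; have [s [us ss sN]] := NP k.
exists (map (real_complex R) s); split; rewrite ?size_map //.
  by rewrite map_inj_uniq //; apply: fmorph_inj.
by rewrite all_map.
Qed.

End Uncountable.

(** * The family psi and the Azumaya locus *)

Theorem lemma2 (R : realType) (c : R[i]) (c0 : c != 0) (c1 : c ^+ 3 != -1)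
  (c8 : c ^+ 3 != 8)
  (sq : 'rV[R[i]]_3 -> 'rV[R[i]]_3)
  (sqE : forall p : 'rV[R[i]]_3, p 0 0 != 0 -> forall j, sq p 0 j ^+ 2 = Delta c p 0 j) :
  let Sc := sklyanin c in
  let u := sk_sq c1 0 in
  [/\ (* the psi are simple representations, psi_+ and psi_- at p lying over 2p *)
      forall (p : 'rV[R[i]]_3) (eps : bool), p 0 0 != 0 ->
        exists rho : {lrmorphism Sc -> 'M[R[i]]_2},
          [/\ psi_rep sq p eps rho, simple_rep rho,
              maximal_ideal (rep_point rho), ~ rep_point rho u
            & forall i, rep_point rho (sk_sq c1 i - (2 * p 0 i)%:A)],
      (* every simple representation where u <> 0 has a unique representative *)
      forall rho : {lrmorphism Sc -> 'M[R[i]]_2},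
        simple_rep rho -> ~ rep_point rho u ->
        exists (p : 'rV[R[i]]_3) (eps : bool) (rho0 : {lrmorphism Sc -> 'M[R[i]]_2}),
          [/\ psi_rep sq p eps rho0, rep_equiv rho rho0
            & forall p' eps' rho', psi_rep sq p' eps' rho' -> rep_equiv rho rho' ->
                p' = p /\ (eps' = eps \/ discr_at c p = 0)],
      (* every point of the open set u <> 0 is reached by exactly one member *)
      forall m : set (center Sc), maximal_ideal m -> ~ m u ->
        exists (p : 'rV[R[i]]_3) (eps : bool) (rho0 : {lrmorphism Sc -> 'M[R[i]]_2}),
          [/\ psi_rep sq p eps rho0, rep_point rho0 = m
            & forall p' eps' rho', psi_rep sq p' eps' rho' -> rep_point rho' = m ->
                p' = p /\ (eps' = eps \/ discr_at c p = 0)],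
      (* permuting the variables covers the Azumaya locus *)
      (forall m : set (center Sc), maximal_ideal m ->
         azumaya_point m <->
         exists (s : 'S_3) (p : 'rV[R[i]]_3) (eps : bool)
           (rho : {lrmorphism Sc -> 'M[R[i]]_2}),
           [/\ perm_psi_rep sq s p eps rho, simple_rep rho & rep_point rho = m]) /\
      (forall rho : {lrmorphism Sc -> 'M[R[i]]_2}, simple_rep rho ->
         exists (s : 'S_3) (p : 'rV[R[i]]_3) (eps : bool)
           (rho0 : {lrmorphism Sc -> 'M[R[i]]_2}),
           perm_psi_rep sq s p eps rho0 /\ rep_equiv rho rho0)
    & (* the Azumaya locus is the complement of the unique singular point *)
      exists m0 : set (center Sc),
        [/\ maximal_ideal m0,
            forall m, maximal_ideal m -> ((forall i, m (sk_sq c1 i)) <-> m = m0),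
            forall m, maximal_ideal m -> (~ smooth_point m <-> m = m0)
          & forall m, maximal_ideal m -> (azumaya_point m <-> m <> m0)]].
Proof.
move=> Sc u; have unc := @complex_infinite_fibre R.
have D0 : (0 : R[i]) ^+ 2 = alt_sq_val c (fun=> 0).
  by rewrite /alt_sq_val !expr0n /= !mulr0 !addr0 subr0 mulr0.
have origin t g : (forall i, t i = 0) -> g ^+ 2 = alt_sq_val c t -> t = (fun=> 0) /\ g = 0.
  move=> t0; have -> : t = (fun=> 0) by apply: boolp.funext.
  by rewrite -D0 expr0n => /eqP; rewrite expf_eq0 /= => /eqP ->.
have nonzero t : ~ (exists i, t i != 0) -> forall i, t i = 0 :> R[i].
  move=> no i; apply/eqP/negPn/negP => ti; apply: no; by exists i.
split.
- move=> p eps p0; have [rho ps] := psi_exists c0 c8 sqE eps p0.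
  have [g [sur ch]] := psi_char c0 c8 sqE ps; have sim := surjective_simple sur.
  exists rho; split=> //; first exact: (rep_point_maximal c0 c1 c8).
    rewrite (rep_point_sq c0 c1 c8 0 ch) => /eqP.
    by rewrite mulf_eq0 pnatr_eq0 (negPf p0).
  move=> i; rewrite (rep_point_chi c0 c1 c8 ch) /= -scaleN1r chiD !chiZ chi_sq chi1; ring.
- move=> rho sim nu; have [t [g [ch _ _]]] := simple_char c0 c1 c8 sim.
  have t0 : t 0 != 0 by apply/eqP => /(rep_point_sq c0 c1 c8 0 ch).
  have ts : t ((1 : 'S_3)%g 0) != 0 by rewrite perm1.
  have [_ rt _] := ch; have [eps [rho0 [/psi_rep_perm ps eqv]]] := simple_psi c0 c8 sqE rt ts.
  exists (\row_i (t ((1 : 'S_3)%g i) / 2)), eps, rho0; split=> // p' eps' rho' ps' eqv'.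
  apply: (psi_unique c0 c1 c8 sqE ps ps').
  by rewrite -(rep_equiv_point eqv) -(rep_equiv_point eqv').
- move=> m mm nu; have [t [g [tg mE]]] := maximal_points c0 c1 c8 unc mm.
  have t0 : t 0 != 0 by apply/eqP => t0; apply: nu; rewrite mE /= chi_sq.
  have ts : t ((1 : 'S_3)%g 0) != 0 by rewrite perm1.
  have [eps [rho0 [/psi_rep_perm ps _ ch]]] := rep_at c0 c1 c8 sqE ts tg.
  have rm : rep_point rho0 = m by rewrite (rep_point_chi c0 c1 c8 ch) mE.
  exists (\row_i (t ((1 : 'S_3)%g i) / 2)), eps, rho0; split=> // p' eps' rho' ps' rm'.
  by apply: (psi_unique c0 c1 c8 sqE ps ps'); rewrite rm rm'.
- split=> [m mm|rho sim].
    split=> [az|[s [p [eps [rho [_ sim <-]]]]]].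
      have [rho [sim _ rm]] := azumaya_rep c0 c1 c8 mm az.
      have [t [g [ch [i ti] _]]] := simple_char c0 c1 c8 sim.
      have ts : t (tperm 0 i 0) != 0 by rewrite tpermL.
      have [eps [rho0 [ps sur ch0]]] := rep_at c0 c1 c8 sqE ts (char_gamma c1 ch).
      exists (tperm 0 i), (\row_j (t (tperm 0 i j) / 2)), eps, rho0; split.
      - exact: ps.
      - exact: surjective_simple.
      by rewrite -rm !(rep_point_chi c0 c1 c8 ch) (rep_point_chi c0 c1 c8 ch0).
    have [t [g [ch t0 _]]] := simple_char c0 c1 c8 sim.
    by rewrite (rep_point_chi c0 c1 c8 ch); apply: azumaya_chi t0 (char_gamma c1 ch).
  have [t [g [[_ rt _] [i ti] _]]] := simple_char c0 c1 c8 sim.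
  have ts : t (tperm 0 i 0) != 0 by rewrite tpermL.
  have [eps [rho0 H]] := simple_psi c0 c8 sqE rt ts.
  by exists (tperm 0 i), (\row_j (t (tperm 0 i j) / 2)), eps, rho0.
exists [set z | chi c0 c1 c8 (fun=> 0) 0 z = 0]; split.
- exact: chi_maximal D0.
- move=> m mm; split=> [msq|-> i]; last by rewrite /= chi_sq.
  have [t [g [tg mE]]] := maximal_points c0 c1 c8 unc mm.
  have [|tE gE] := origin t g _ tg; last by rewrite mE tE gE.
  by move=> i; have := msq i; rewrite mE /= chi_sq.
- move=> m mm; have [t [g [tg mE]]] := maximal_points c0 c1 c8 unc mm.
  have [t0|/nonzero t0] := pselect (exists i, t i != 0).
    split=> [[]|m0]; first by rewrite mE; apply: smooth_chi.
    case: t0 => i; move: m0; rewrite mE => /chi_point_inj [-> _].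
    by rewrite eqxx.
  have [tE gE] := origin _ _ t0 tg; rewrite mE tE gE.
  by split=> // _; apply: singular_origin.
move=> m mm; have [t [g [tg mE]]] := maximal_points c0 c1 c8 unc mm.
have [t0|/nonzero t0] := pselect (exists i, t i != 0).
  split=> [_ m0|_]; last by rewrite mE; apply: azumaya_chi.
  case: t0 => i; move: m0; rewrite mE => /chi_point_inj [-> _].
  by rewrite eqxx.
have [tE gE] := origin _ _ t0 tg.
split=> [az _|[]]; last by rewrite mE tE gE.
have [rho [sim _ rm]] := azumaya_rep c0 c1 c8 mm az.
have [t' [g' [ch [i ti] _]]] := simple_char c0 c1 c8 sim.
move: rm; rewrite (rep_point_chi c0 c1 c8 ch) mE => /chi_point_inj [te _].
by rewrite te t0 eqxx in ti.
Qed.
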